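(* Let $\beta\in(0,1)$. Let $B_2\subset B_1\subset B$ be a Banach triple with norms $\|\cdot\|_2,\|\cdot\|_1,\|\cdot\|$, and let $B^{par}$ be another Banach space with norm $\|\cdot\|_{par}$. Assume: (i) $D=(D_1,\dots,D_n)$ with $D_i\in\mathcal L(B_1,B)\cap\mathcal L(B_2,B_1)$, the norms of all $D_i$ being bounded by $1$ in both $\mathcal L(B_1,B)$ and $\mathcal L(B_2,B_1)$. (ii) $A\in\mathcal L(B_2,B)$ generates a strongly continuous semigroup $e^{At}$ in both $B$ and $B_1$, with $\|e^{At}\|_{B\to B}\le Me^{mt}$ and $\|e^{At}\|_{B_1\to B_1}\le M_1e^{m_1t}$ for some nonnegative constants $M,m,M_1,m_1$, and $B_2$ is an invariant core for this semigroup in $B$. (iii) $H:\mathbf R\times B\times B^n\times B^{par}\to B$ is a continuous mapping such that, with some constants $L_H,L'_H,L_H^{par}$ and for all arguments, $$\|H(t,b_0,b_1,\dots,b_n,\alpha)-H(t,\tilde b_0,\tilde b_1,\dots,\tilde b_n,\alpha)\|\le L_H\sum_{j=0}^n\|b_j-\tilde b_j\|\Big(1+L'_H\sum_{j=1}^n\|b_j\|\Big),$$ $$\|H(t,b_0,\dots,b_n,\alpha)-H(t,b_0,\dots,b_n,\tilde\alpha)\|\le L_H^{par}\|\alpha-\tilde\alpha\|_{par}\Big(1+\sum_{j=1}^n\|b_j\|\Big),$$ $$\|H(t,b_0,\dots,b_n,\alpha)\|\le L_H\sum_{j=1}^n\|b_j\|.$$ (iv) For $t>0$ the operator $e^{At}$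 takes $B$ to $B_1$, and $\|e^{At}\|_{B\to B_1}\le\varkappa t^{-\omega}$ for $t\in(0,1]$, with some constants $\varkappa>0$ and $\omega\in(0,1)$. Let $a\in\mathbf R$. Then the equation $$b(t)=E_\beta(A(t-a)^\beta)Y+\beta\int_a^t(t-s)^{\beta-1}E'_\beta(A(t-s)^\beta)H(s,b(s),Db(s),\alpha)\,ds,\qquad t\ge a,$$ is well posed in $B_1$, that is, for any $Y\in B_1$, $\alpha\in B^{par}$ there exists its unique global solution $b(t)=b(t;Y,\alpha)\in B_1$ (continuous in $t\ge a$ with values in $B_1$), which depends Lipschitz continuously on the initial data $Y$ and the parameter $\alpha$, so that for every $T>a$ $$\sup_{t\in[a,T]}\|b(t;Y,\alpha)-b(t;\tilde Y,\tilde\alpha)\|_1\le K\big(\|\alpha-\tilde\alpha\|_{par}(1+\|Y\|_1)+\|Y-\tilde Y\|_1\big),$$ with a constant $K$ depending on $T-a$ and all constants entering the assumptions of the theorem.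
   Context: $\mathcal L(B,C)$ is the Banach space of bounded linear operators $B\to C$ with operator norm $\|\cdot\|_{B\to C}$. A Banach triple is a sequence of embedded Banach spaces $B_2\subset B_1\subset B$ with norms satisfying $\|\cdot\|_2\ge\|\cdot\|_1\ge\|\cdot\|$ (on the spaces where they are defined), such that $B_2$ is dense in $B_1$ in the topology of $B_1$ and $B_1$ is dense in $B$ in the topology of $B$. $Db=(D_1b,\dots,D_nb)$. $E_\beta(x)=\sum_{k\ge0}x^k/\Gamma(\beta k+1)$ is the Mittag-Leffler function. For a generator $A$ of a semigroup $e^{At}$ and $\tau\ge 0$ one defines, via the Zolotarev formula, $$E_\beta(A\tau)=\frac1\beta\int_0^\infty e^{A\tau x}x^{-1-1/\beta}G_\beta(1,x^{-1/\beta})\,dx,\qquad E'_\beta(A\tau)=\frac1\beta\int_0^\infty e^{A\tau x}x^{-1/\beta}G_\beta(1,x^{-1/\beta})\,dx,$$ where $G_\beta(t,x)=\frac1\pi\,\mathrm{Re}\int_0^\infty\exp\{ipx-tp^\beta e^{i\pi\beta/2}\}\,dp$ is the transition density of the stable Lévy subordinator of index $\beta$. The integral equation is the mild form of $D^\beta_{a+*}b(t)=Ab(t)+H(t,b(t),Db(t),\alpha)$, $b(a)=Y$, where $D^\beta_{a+*}$ is the Caputo–Dzherbashyan derivative of order $\beta$.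
   Formalization: The constant K is allowed to depend also on an upper bound for L'_H‖Y‖_1, since for L'_H>0 no K independent of Y exists (A=0, D_1=id on R², H=(0, u sin v) is a counterexample); for L'_H=0 it is the original claim. *)

(* Defs.v *)
From Stdlib Require Export Reals.
From mathcomp Require Export ssreflect ssrfun ssrbool eqtype ssrnat fintype bigop.
From Coquelicot Require Export Coquelicot.

Set Implicit Arguments.
Unset Strict Implicit.
Unset Printing Implicit Defensive.

(* Stdlib reals and Coquelicot; mathcomp only supplies 'I_n and finite sums.
   B^n is 'I_n -> B, which Coquelicot equips with the uniform structure of
   uniform convergence, i.e. here the product topology. *)
Open Scope R_scope.

Notation Banach := (CompleteNormedModule R_AbsRing).

Notation "\sumR_ ( i < n ) F" := (\big[Rplus/0]_(i < n) F%R)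
  (at level 41, F at level 41, i, n at level 50,
   format "\sumR_ ( i  <  n )  F") : R_scope.

Section BanachSpaces.
Context {V W : Banach}.

Definition op_norm (T : V -> W) : Rbar :=
  Lub_Rbar (fun r => exists x : V, norm x <= 1 /\ r = norm (T x)).

(* The inclusion V \subset W of embedded Banach spaces is represented by an
   injective linear map; V is moreover dense in W. *)
Record dense_embedding (i : V -> W) : Prop := {
  emb_linear : is_linear i;
  emb_inj : forall x y, i x = i y -> x = y;
  emb_norm : forall x, norm (i x) <= norm x;
  emb_dense : forall (y : W) (eps : R), 0 < eps ->
    exists x, norm (minus y (i x)) < eps }.

End BanachSpaces.

Section Semigroups.
Context {V : Banach}.

(* Only the values S t with t >= 0 are meaningful. *)
Record C0_semigroup (S : R -> V -> V) : Prop := {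
  sg_linear : forall t, 0 <= t -> is_linear (S t);
  sg_0 : forall x, S 0 x = x;
  sg_add : forall s t x, 0 <= s -> 0 <= t -> S (s + t) x = S s (S t x);
  sg_cont : forall x, filterlim (fun t => S t x) (at_right 0) (locally x) }.

(* Graph of the infinitesimal generator. *)
Definition generator (S : R -> V -> V) (x y : V) : Prop :=
  filterlim (fun h => scal (/ h) (minus (S h x) x)) (at_right 0) (locally y).

(* For a subspace given by j : U -> V and an operator A : U -> V, the
   generator of S extends A and is the closure of A. *)
Definition generates_with_core {U : Banach} (j : U -> V) (A : U -> V)
    (S : R -> V -> V) : Prop :=
  (forall u, generator S (j u) (A u)) /\
  (forall x y, generator S x y -> forall eps : R, 0 < eps ->
     exists u, norm (minus x (j u)) < eps /\ norm (minus y (A u)) < eps).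

Definition invariant_subspace {U : Banach} (j : U -> V) (S : R -> V -> V) :
    Prop :=
  forall t, 0 <= t -> forall u, exists u', j u' = S t (j u).

End Semigroups.

Definition Cexp (z : C) : C := (exp (Re z) * cos (Im z), exp (Re z) * sin (Im z)).

(* [Rpower p b] is p^b for p > 0 only (Stdlib has Rpower 0 b = 1); below its
   base is positive throughout every interval of integration. *)

(* Density G_beta(t,x) of the stable subordinator of index beta. *)
Definition stable_density (beta t x : R) : R :=
  / PI * Re (RInt_gen (V := C_R_CompleteNormedModule)
    (fun p : R => Cexp (Ci * RtoC (p * x)
        - RtoC (t * Rpower p beta) * Cexp (Ci * RtoC (PI * beta / 2)))%C)
    (at_right 0) (Rbar_locally p_infty)).

Section MittagLeffler.
Context {U V : Banach}.

(* Strong (pointwise) improper integrals in V, where T t : U -> V is e^{At}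
   acting from U to V. *)
Definition E_op (beta : R) (T : R -> U -> V) (tau : R) (u : U) : V :=
  scal (/ beta) (RInt_gen
    (fun x => scal (Rpower x (- 1 - 1 / beta)
                    * stable_density beta 1 (Rpower x (- (1 / beta))))
                   (T (tau * x) u))
    (at_right 0) (Rbar_locally p_infty)).

Definition E'_op (beta : R) (T : R -> U -> V) (tau : R) (u : U) : V :=
  scal (/ beta) (RInt_gen
    (fun x => scal (Rpower x (- (1 / beta))
                    * stable_density beta 1 (Rpower x (- (1 / beta))))
                   (T (tau * x) u))
    (at_right 0) (Rbar_locally p_infty)).

End MittagLeffler.

Section MildEquation.
Context {B1 B Bpar : Banach} (i1 : B1 -> B).

Definition continuous_from (a : R) (b : R -> B1) : Prop :=
  forall t, a <= t ->
    filterlim b (within (fun s => a <= s) (locally t)) (locally (b t)).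

(* S1 is the semigroup in B1 and R01 t (t > 0) is e^{At} as an operator from B
   to B1.  The integral over [a,t] is improper at s = t; the case t = a, where
   it vanishes and (t - a)^beta = 0, is written out separately. *)
Definition mild_solution (n : nat) (beta : R)
    (S1 : R -> B1 -> B1) (R01 : R -> B -> B1) (D : 'I_n -> B1 -> B)
    (H : R -> B -> ('I_n -> B) -> Bpar -> B)
    (a : R) (Y : B1) (alpha : Bpar) (b : R -> B1) : Prop :=
  continuous_from a b /\
  b a = E_op beta S1 0 Y /\
  forall t, a < t -> exists J : B1,
    is_RInt_gen
      (fun s => scal (Rpower (t - s) (beta - 1))
         (E'_op beta R01 (Rpower (t - s) beta)
            (H s (i1 (b s)) (fun j => D j (b s)) alpha)))
      (at_point a) (at_left t) J /\
    b t = plus (E_op beta S1 (Rpower (t - a) beta) Y) (scal beta J).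

End MildEquation.

(* Main.v *)
(* The weight [x^(-1-1/beta) G_beta(1, x^(-1/beta))] of Zolotarev's formula is
   continuous and decays faster than every exponential: shift the contour of the integral
   defining [G_beta] past a disc of radius of order [1/y] as [y -> 0], and rotate
   it by more than a quarter turn as [y -> infinity].  The operators therefore
   exist as absolutely convergent integrals; [E_beta(A t^beta)] is strongly
   continuous on [B1] and [t^(beta-1) E'_beta(A t^beta)] maps [B] to [B1] with norm
   [O(t^(gamma-1))], [gamma = beta (1 - omega)].  The mild equation is a Volterra
   equation with this weakly singular kernel.  In the norm
   [sup e^(-lam (t-a)) |b t|_1] with [lam] large the integral operator is a
   contraction, which gives an a priori bound linear in [|Y|_1] (by the growth
   condition on [H]), then Lipschitz dependence, since on the resulting ball [H]
   is Lipschitz, and convergence of the Picard iterates. *)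
Require Import Defs.
From Stdlib Require Import Lra Lia ClassicalEpsilon.

Set Implicit Arguments.
Unset Strict Implicit.
Unset Printing Implicit Defensive.

(** [K] is chosen before the spaces, the semigroups and [H], so every quantitative lemma first
    extracts its constant from scalar data and quantifies over spaces afterwards; the data enter
    only through the estimates bundled in [smoothing_semigroup] and [nonlinearity]. Improper
    integrals are compared with a function that has an explicit primitive with limits at both ends,
    so convergence, bounds and dominated passage to the limit all reduce to increments of that
    primitive. Contours are moved in the logarithmic variable [w = u + i th], where arcs and rays
    become the sides of a rectangle: the integral along a horizontal side is differentiated in its
    height, and the Cauchy-Riemann equation leaves only endpoint terms. The equation is posed on the
    whole line, with the solution frozen at its initial value for [t <= a], and its integral is
    written in [r = t - s]. Continuity is then two-sided, and the singularity of the kernel stays at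
    the fixed endpoint 0. *)

Lemma norm_scal_le {V : Banach} (k : R) (x : V) : norm (scal k x) <= Rabs k * norm x.
Proof. exact: (norm_scal k x). Qed.

Lemma norm_plus_le {V : Banach} (x y : V) : norm (plus x y) <= norm x + norm y.
Proof. exact: norm_triangle. Qed.

Lemma norm_minusC {V : Banach} (x y : V) : norm (minus x y) = norm (minus y x).
Proof. by rewrite -norm_opp opp_minus. Qed.

Lemma norm_minus_le {V : Banach} (x y : V) : norm (minus x y) <= norm x + norm y.
Proof. by have := norm_triangle x (opp y); rewrite norm_opp. Qed.

Lemma norm_le_minus {V : Banach} (x y : V) : norm x <= norm y + norm (minus x y).
Proof.
have -> : x = plus y (minus x y).
  by rewrite plus_comm /minus -plus_assoc plus_opp_l plus_zero_r.
have -> : minus (plus y (minus x y)) y = minus x y.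
  by rewrite (plus_comm y) /minus -plus_assoc plus_opp_r plus_zero_r.
exact: norm_triangle.
Qed.

Lemma norm_minus_trans {V : Banach} (x y z : V) :
  norm (minus x z) <= norm (minus x y) + norm (minus y z).
Proof. rewrite (minus_trans y x z); exact: norm_triangle. Qed.

Lemma minus_plus_cancel {V : Banach} (p u v : V) :
  minus (plus p u) (plus p v) = minus u v.
Proof.
rewrite /minus opp_plus (plus_comm p u) -plus_assoc (plus_assoc p (opp p)).
by rewrite plus_opp_r plus_zero_l.
Qed.

Lemma filterlim_norm_minus {T : Type} {V : Banach} (F : (T -> Prop) -> Prop)
  {FF : Filter F} (f : T -> V) (l : V) :
  filterlim f F (locally l) <->
  (forall eps, 0 < eps -> F (fun x => norm (minus (f x) l) < eps)).
Proof.
split=> [H eps heps|H].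
- apply: (filter_imp (fun x => ball_norm l eps (f x))) => [x Hx //|].
  apply: H; exact: (locally_ball_norm l (mkposreal eps heps)).
- apply/filterlim_locally => eps.
  apply: filter_imp (H eps (cond_pos eps)) => x; exact: norm_compat1.
Qed.

Lemma filterlim_Rabs_minus {T : Type} (F : (T -> Prop) -> Prop)
  {FF : Filter F} (f : T -> R) (l : R) :
  filterlim f F (locally l) <->
  (forall eps, 0 < eps -> F (fun x => Rabs (f x - l) < eps)).
Proof. exact: (filterlim_norm_minus (V := R_CompleteNormedModule)). Qed.

Lemma filterlim_norm_le {T : Type} {V : Banach} (F : (T -> Prop) -> Prop)
  {FF : ProperFilter F} (f : T -> V) (l : V) (c : R) :
  filterlim f F (locally l) -> F (fun x => norm (f x) <= c) -> norm l <= c.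
Proof.
move=> /filterlim_norm_minus H Hc; apply: le_epsilon => eps heps.
have [x [H1 H2]] := filter_ex _ (filter_and _ _ (H _ heps) Hc).
have := norm_le_minus l (f x); rewrite norm_minusC; lra.
Qed.

(** * Improper integrals dominated by a derivative *)

(* [lb - la] is the total mass of the dominating function [g]. *)
Record majorant (Fa Fb : (R -> Prop) -> Prop) (D : R -> Prop) (g G : R -> R)
    (la lb : R) : Prop := {
  maj_convex : forall x y z, D x -> D y -> x <= z <= y -> D z;
  maj_a : Fa D;
  maj_b : Fb D;
  maj_derive : forall x, D x -> is_derive G x (g x);
  maj_cont : forall x, D x -> continuous g x;
  maj_la : filterlim G Fa (locally la);
  maj_lb : filterlim G Fb (locally lb) }.

Section Dominated.
Context {V : Banach} {Fa Fb : (R -> Prop) -> Prop}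
  {FFa : ProperFilter Fa} {FFb : ProperFilter Fb}.
Variables (D : R -> Prop) (g G : R -> R) (la lb : R).
Hypothesis maj : majorant Fa Fb D g G la lb.

Let DD x y z : D x -> D y -> Rmin x y <= z <= Rmax x y -> D z.
Proof.
move=> Dx Dy; rewrite /Rmin /Rmax; case: Rle_dec => h hz.
- exact: (maj_convex maj Dx Dy).
- exact: (maj_convex maj Dy Dx).
Qed.

Lemma ex_RInt_on (f : R -> V) (x y : R) :
  (forall z, D z -> continuous f z) -> D x -> D y -> ex_RInt f x y.
Proof. by move=> cf Dx Dy; apply: ex_RInt_continuous => z /(DD Dx Dy); apply: cf. Qed.

(** The absolute value on the right covers both orders of the endpoints, so tails can be compared
    below without sorting [x] and [y]. *)
Lemma norm_RInt_majorant (f : R -> V) (c x y : R) :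
  (forall z, D z -> continuous f z) -> (forall z, D z -> norm (f z) <= c * g z) ->
  D x -> D y -> norm (RInt f x y) <= Rabs (c * (G y - G x)).
Proof.
move=> cf hf.
suff main u v : u <= v -> D u -> D v -> norm (RInt f u v) <= c * (G v - G u).
  move=> Dx Dy; case: (Rle_dec x y) => hxy.
    apply: Rle_trans (main _ _ hxy Dx Dy) _; exact: Rle_abs.
  rewrite -opp_RInt_swap; last exact: ex_RInt_on.
  rewrite norm_opp -Rabs_Ropp; apply: Rle_trans (main y x _ Dy Dx) _; first lra.
  have -> : c * (G x - G y) = - (c * (G y - G x)) by ring.
  exact: Rle_abs.
move=> huv Du Dv.
apply: (norm_RInt_le f (fun z => c * g z) u v) => //.
- by move=> z hz; apply: hf; apply: (maj_convex maj Du Dv).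
- by apply: RInt_correct; apply: ex_RInt_on.
- apply: (is_RInt_scal (V := R_NormedModule)).
  apply: (is_RInt_derive (V := R_CompleteNormedModule)) => z /(DD Du Dv).
  + exact: (maj_derive maj).
  + exact: (maj_cont maj).
Qed.

(** [is_RInt_gen] is relational. Continuity on [D] makes the integral exist for all endpoints near
    the limits, which turns it into an ordinary limit, open to completeness and to limit
    inequalities. *)
Lemma is_RInt_gen_filterlim (f : R -> V) (I : V) :
  (forall z, D z -> continuous f z) ->
  is_RInt_gen f Fa Fb I <->
  filterlim (fun ab => RInt f ab.1 ab.2) (filter_prod Fa Fb) (locally I).
Proof.
move=> cf.
have HD : filter_prod Fa Fb (fun ab => D ab.1 /\ D ab.2).
  by exists D D => //; [exact: (maj_a maj)|exact: (maj_b maj)].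
split=> H P hP; have := H P hP; rewrite /filtermapi /filtermap => H'.
- apply: filter_imp H' => ab [y [h1 h2]].
  by rewrite (is_RInt_unique _ _ _ _ h1).
- apply: filter_imp (filter_and _ _ HD H') => -[x y] /= [[Dx Dy] h].
  by exists (RInt f x y); split=> //; apply: RInt_correct; apply: ex_RInt_on.
Qed.

Lemma RInt_gen_ext_on (f f' : R -> V) (I : V) :
  (forall z, D z -> f z = f' z) -> is_RInt_gen f Fa Fb I -> RInt_gen f' Fa Fb = I.
Proof.
move=> hf hI.
have h : is_RInt_gen f' Fa Fb I.
  refine (is_RInt_gen_ext f f' I _ hI).
  exists D D; [exact: (maj_a maj)|exact: (maj_b maj)|] => x y Dx Dy z /= hz.
  by apply: hf; apply: (DD Dx Dy); lra.
by rewrite (is_RInt_gen_unique f' I h).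
Qed.

Lemma near_limits eps : 0 < eps ->
  Fa (fun x => D x /\ Rabs (G x - la) < eps) /\
  Fb (fun x => D x /\ Rabs (G x - lb) < eps).
Proof.
move=> heps; split; apply: filter_and.
- exact: (maj_a maj).
- exact: (proj1 (filterlim_Rabs_minus _ _) (maj_la maj)).
- exact: (maj_b maj).
- exact: (proj1 (filterlim_Rabs_minus _ _) (maj_lb maj)).
Qed.

Lemma RInt_split3 (f : R -> V) (x x' y' y : R) :
  (forall z, D z -> continuous f z) -> D x -> D x' -> D y' -> D y ->
  RInt f x y = plus (RInt f x x') (plus (RInt f x' y') (RInt f y' y)).
Proof.
move=> cf Dx Dx' Dy' Dy.
rewrite RInt_Chasles; try exact: ex_RInt_on.
rewrite RInt_Chasles //; exact: ex_RInt_on.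
Qed.

(** The [+ 1] keeps the quotient meaningful when [c = 0]. *)
Lemma Rabs_mult_lt (c x eps : R) : Rabs x < eps / (Rabs c + 1) -> 0 < eps ->
  Rabs (c * x) <= eps.
Proof.
move=> h heps; rewrite Rabs_mult.
have hc := Rabs_pos c; have hx := Rabs_pos x.
have h1 : Rabs c * Rabs x <= Rabs c * (eps / (Rabs c + 1)).
  by apply: Rmult_le_compat_l => //; lra.
apply: Rle_trans h1 _.
have -> : Rabs c * (eps / (Rabs c + 1)) = eps - eps / (Rabs c + 1) by field; lra.
have : 0 < eps / (Rabs c + 1) by apply: Rdiv_lt_0_compat; lra.
lra.
Qed.

Lemma Rabs_mult_tri (c u v l : R) :
  Rabs (c * (u - v)) <= Rabs (c * (u - l)) + Rabs (c * (v - l)).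
Proof.
have -> : c * (u - v) = c * (u - l) - c * (v - l) by ring.
rewrite -(Rabs_Ropp (c * (v - l))); exact: Rabs_triang.
Qed.

(** Cauchy criterion: two partial integrals differ by two end pieces, each bounded by an increment
    of [c * G], and [G] has limits at both ends. The norm bound survives the limit. *)
Lemma ex_RInt_gen_majorant (f : R -> V) (c : R) :
  (forall z, D z -> continuous f z) -> (forall z, D z -> norm (f z) <= c * g z) ->
  exists I, is_RInt_gen f Fa Fb I /\ norm I <= Rabs (c * (lb - la)).
Proof.
move=> cf hf.
have key eps : 0 < eps -> exists Pa Pb, Fa Pa /\ Fb Pb /\
    forall x x' y y', Pa x -> Pa x' -> Pb y -> Pb y' ->
     D x /\ D y /\ Rabs (c * (G y - G x)) <= Rabs (c * (lb - la)) + eps /\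
     norm (minus (RInt f x y) (RInt f x' y')) <= eps.
  move=> heps.
  have hc := Rabs_pos c.
  (* Each of the four values [G x], [G x'], [G y], [G y'] then contributes at most [eps / 4]. *)
  pose eta := eps / 4 / (Rabs c + 1).
  have heta : 0 < eta by rewrite /eta; apply: Rdiv_lt_0_compat; lra.
  have [Ha Hb] := near_limits heta.
  eexists; eexists; split; [exact: Ha|split; [exact: Hb|]].
  move=> x x' y y' [Dx hx] [Dx' hx'] [Dy hy] [Dy' hy'].
  have e4 : 0 < eps / 4 by lra.
  have kx := @Rabs_mult_lt c _ _ hx e4.
  have kx' := @Rabs_mult_lt c _ _ hx' e4.
  have ky := @Rabs_mult_lt c _ _ hy e4.
  have ky' := @Rabs_mult_lt c _ _ hy' e4.
  split => //; split => //; split.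
    move: kx ky; split_Rabs; lra.
  rewrite (RInt_split3 cf Dx Dx' Dy' Dy).
  have -> : minus (plus (RInt f x x') (plus (RInt f x' y') (RInt f y' y))) (RInt f x' y')
     = plus (RInt f x x') (RInt f y' y).
    rewrite /minus -!plus_assoc; congr plus.
    by rewrite plus_comm -plus_assoc plus_opp_l plus_zero_r.
  apply: Rle_trans (norm_triangle _ _) _.
  have h1 := norm_RInt_majorant cf hf Dx Dx'.
  have h2 := norm_RInt_majorant cf hf Dy' Dy.
  have := Rabs_mult_tri c (G x') (G x) la; have := Rabs_mult_tri c (G y) (G y') lb; lra.
have [I hI] : exists I, filterlim (fun ab => RInt f ab.1 ab.2) (filter_prod Fa Fb) (locally I).
  apply/filterlim_locally_cauchy => eps.
  have e2 : 0 < eps / 2 by have := cond_pos eps; lra.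
  have [Pa [Pb [Ha [Hb H]]]] := key _ e2.
  exists (fun ab => Pa ab.1 /\ Pb ab.2); split; first by exists Pa Pb.
  move=> [x y] [x' y'] /= [Px Py] [Px' Py'].
  apply: norm_compat1.
  have [_ [_ [_ h]]] := H _ _ _ _ Px' Px Py' Py.
  apply: Rle_lt_trans h _; have := cond_pos eps; lra.
exists I; split; first exact/is_RInt_gen_filterlim.
apply: le_epsilon => eps heps.
apply: filterlim_norm_le hI _.
have [Pa [Pb [Ha [Hb H]]]] := key _ heps.
exists Pa Pb => // x y Px Py /=.
have [Dx [Dy [h _]]] := H _ _ _ _ Px Px Py Py.
by apply: Rle_trans (norm_RInt_majorant cf hf Dx Dy) h.
Qed.

Lemma RInt_gen_majorant (f : R -> V) (c : R) :
  (forall z, D z -> continuous f z) -> (forall z, D z -> norm (f z) <= c * g z) ->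
  is_RInt_gen f Fa Fb (RInt_gen f Fa Fb) /\
  norm (RInt_gen f Fa Fb) <= Rabs (c * (lb - la)).
Proof.
move=> cf hf; have [I [h1 h2]] := ex_RInt_gen_majorant cf hf.
by rewrite (is_RInt_gen_unique f I h1).
Qed.

(* Domination makes the two tails uniformly small, so convergence that is
   uniform on compact subintervals suffices. *)
Lemma filterlim_RInt_gen_majorant {T : Type} (F : (T -> Prop) -> Prop)
  {FF : Filter F} (f : T -> R -> V) (f0 : R -> V) (c : R) :
  F (fun t => forall z, D z -> continuous (f t) z) ->
  F (fun t => forall z, D z -> norm (f t z) <= c * g z) ->
  (forall z, D z -> continuous f0 z) -> (forall z, D z -> norm (f0 z) <= c * g z) ->
  (forall x y eps, D x -> D y -> 0 < eps ->
     F (fun t => forall z, x <= z <= y -> norm (minus (f t z) (f0 z)) <= eps)) ->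
  filterlim (fun t => RInt_gen (f t) Fa Fb) F (locally (RInt_gen f0 Fa Fb)).
Proof.
move=> cf hf cf0 hf0 hu; apply/filterlim_norm_minus => eps heps.
have hc := Rabs_pos c.
(* The difference of the integrands is dominated by [2 * c * g], so each tail costs at most
   [2 * (eps / 16 + eps / 16)]. With [eps / 4] for the middle part the total is [3 / 4 * eps], which
   leaves room for the strict inequality. *)
pose eta := eps / 16 / (Rabs c + 1).
have heta : 0 < eta by rewrite /eta; apply: Rdiv_lt_0_compat; lra.
have e16 : 0 < eps / 16 by lra.
have [Ha Hb] := near_limits heta.
have [x1 [Dx1 hx1]] := filter_ex _ Ha.
have [y1 [Dy1 hy1]] := filter_ex _ Hb.
have kx1 := @Rabs_mult_lt c _ _ hx1 e16.
have ky1 := @Rabs_mult_lt c _ _ hy1 e16.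
pose w := Rabs (y1 - x1) + 1.
have hw : 0 < w by have := Rabs_pos (y1 - x1); rewrite /w; lra.
have hd : 0 < eps / 4 / w by apply: Rdiv_lt_0_compat; lra.
have Dmin : D (Rmin x1 y1).
  by rewrite /Rmin; case: Rle_dec.
have Dmax : D (Rmax x1 y1).
  by rewrite /Rmax; case: Rle_dec.
apply: filter_imp (filter_and _ _ (filter_and _ _ cf hf) (hu _ _ _ Dmin Dmax hd)).
move=> t [[cft hft] hut].
pose d z := minus (f t z) (f0 z).
have cd z : D z -> continuous d z.
  by move=> Dz; apply: continuous_minus; [exact: cft|exact: cf0].
have hdz z : D z -> norm (d z) <= 2 * c * g z.
  move=> Dz; have := norm_minus_le (f t z) (f0 z).
  have := hft z Dz; have := hf0 z Dz; rewrite /d; lra.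
have [i1 _] := RInt_gen_majorant cft hft.
have [i0 _] := RInt_gen_majorant cf0 hf0.
have idf : is_RInt_gen d Fa Fb (minus (RInt_gen (f t) Fa Fb) (RInt_gen f0 Fa Fb)).
  exact: is_RInt_gen_minus.
apply: Rle_lt_trans (_ : _ <= 3 / 4 * eps) _; last lra.
have /= ld := proj1 (is_RInt_gen_filterlim _ cd) idf.
apply: (filterlim_norm_le ld).
have [Ha' Hb'] := near_limits heta.
eexists; [exact: Ha'|exact: Hb'|] => x y [Dx hx] [Dy hy] /=.
have kx := @Rabs_mult_lt c _ _ hx e16.
have ky := @Rabs_mult_lt c _ _ hy e16.
rewrite (RInt_split3 cd Dx Dx1 Dy1 Dy).
apply: Rle_trans (norm_triangle _ _) _.
have h1 := norm_RInt_majorant cd hdz Dx Dx1.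
have h2 := norm_RInt_majorant cd hdz Dy1 Dy.
have h3 := norm_plus_le (RInt d x1 y1) (RInt d y1 y).
have h4 : norm (RInt d x1 y1) <= eps / 4.
  (* The cut points [x1] and [y1] come from two arbitrary filters and may lie in either order. *)
  have hint u v : u <= v -> D u -> D v -> Rmin x1 y1 <= u -> v <= Rmax x1 y1 ->
      v - u = Rabs (y1 - x1) -> norm (RInt d u v) <= eps / 4.
    move=> huv Du Dv hmu hMv hl.
    have hle : norm (RInt d u v) <= (v - u) * (eps / 4 / w).
      apply: (norm_RInt_le_const d) => //.
        by move=> z hz; apply: hut; lra.
      by apply: RInt_correct; apply: ex_RInt_on.
    apply: Rle_trans hle _.
    have -> : eps / 4 = w * (eps / 4 / w) by field; lra.
    have -> : w * (eps / 4 / w) / w = eps / 4 / w by field; lra.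
    apply: Rmult_le_compat_r; first lra.
    by rewrite hl /w; lra.
  case: (Rle_dec x1 y1) => hxy.
    apply: hint => //; first exact: Rmin_l.
      exact: Rmax_r.
    by rewrite Rabs_pos_eq; lra.
  rewrite -opp_RInt_swap; last exact: ex_RInt_on.
  rewrite norm_opp; apply: hint => //; first lra.
    exact: Rmin_r.
    exact: Rmax_l.
  by rewrite Rabs_left; lra.
rewrite Rmult_assoc Rabs_mult (Rabs_pos_eq 2) in h1; last lra.
rewrite Rmult_assoc Rabs_mult (Rabs_pos_eq 2) in h2; last lra.
have := Rabs_mult_tri c (G x1) (G x) la; have := Rabs_mult_tri c (G y) (G y1) lb; lra.
Qed.

End Dominated.

(** * Elementary estimates *)

Lemma lipschitz_MVT (f df : R -> R) (c a b : R) :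
  (forall x, is_derive f x (df x)) ->
  (forall x, Rmin a b <= x <= Rmax a b -> Rabs (df x) <= c) ->
  Rabs (f b - f a) <= c * Rabs (b - a).
Proof.
move=> hd hc.
have [x [hx ->]] : exists x, Rmin a b <= x <= Rmax a b /\ f b - f a = df x * (b - a).
  apply: MVT_gen => x _; first exact: hd.
  apply/continuity_pt_filterlim; apply: (ex_derive_continuous f); by exists (df x).
rewrite Rabs_mult; apply: Rmult_le_compat_r; [exact: Rabs_pos|exact: hc].
Qed.

Lemma Rabs_sin_le1 x : Rabs (sin x) <= 1.
Proof. by apply: Rabs_le; exact: SIN_bound. Qed.

Lemma Rabs_cos_le1 x : Rabs (cos x) <= 1.
Proof. by apply: Rabs_le; exact: COS_bound. Qed.

Lemma sin_lipschitz x y : Rabs (sin x - sin y) <= Rabs (x - y).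
Proof.
rewrite -(Rmult_1_l (Rabs (x - y))); apply: (@lipschitz_MVT _ cos) => z.
  exact: is_derive_sin.
move=> _; exact: Rabs_cos_le1.
Qed.

Lemma cos_lipschitz x y : Rabs (cos x - cos y) <= Rabs (x - y).
Proof.
rewrite -(Rmult_1_l (Rabs (x - y))); apply: (@lipschitz_MVT _ (fun x => - sin x)) => z.
  exact: is_derive_cos.
move=> _; rewrite Rabs_Ropp; exact: Rabs_sin_le1.
Qed.

Lemma Rpower_pos x a : 0 < Rpower x a.
Proof. exact: exp_pos. Qed.

Lemma Rpower_exp u a : Rpower (exp u) a = exp (a * u).
Proof. by rewrite /Rpower ln_exp. Qed.

Lemma exp_le x y : x <= y -> exp x <= exp y.
Proof. by case=> [h|->]; [left; exact: exp_increasing|right]. Qed.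

(** Both [1] and [q] lie below [1 + q <= e^q], and [q^a] is at most the larger of them. *)
Lemma Rpower_mul_exp_le1 q a : 0 < q -> 0 <= a <= 1 -> Rpower q a * exp (- q) <= 1.
Proof.
move=> hq ha.
have h : Rpower q a <= exp q.
  apply: Rle_trans (_ : 1 + q <= _); last exact: exp_ineq1_le.
  case: (Rle_dec 1 q) => h1.
    apply: Rle_trans (_ : Rpower q 1 <= _); first by apply: Rle_Rpower => //; lra.
    by rewrite Rpower_1 //; lra.
  apply: Rle_trans (_ : Rpower 1 a <= _); first by apply: Rle_Rpower_l; lra.
  by rewrite /Rpower ln_1 Rmult_0_r exp_0; lra.
have := Rmult_le_compat_r _ _ _ (Rlt_le _ _ (exp_pos (- q))) h.
by rewrite -exp_plus Rplus_opp_r exp_0.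
Qed.

(** With [s = p^beta] and [M = N / beta] the function is [s^M e^(-kappa s)], maximal at
    [s = M / kappa]. Writing [s = (M / kappa) q] and using [q <= e^q] gives the constant
    [(M / kappa)^M]. *)
Lemma Rpower_mul_exp_bound (kappa beta N : R) : 0 < kappa -> 0 < beta -> 0 < N ->
  exists C, 0 < C /\ forall p, 0 < p -> Rpower p N * exp (- (kappa * Rpower p beta)) <= C.
Proof.
move=> hk hb hN; set M := N / beta.
have hM : 0 < M by apply: Rdiv_lt_0_compat.
exists (Rpower (M / kappa) M); split; first exact: Rpower_pos.
move=> p hp; set s := Rpower p beta.
have hs : 0 < s by exact: Rpower_pos.
have -> : Rpower p N = Rpower s M.
  by rewrite /s Rpower_mult /M; congr Rpower; field; lra.
have h1 : 0 < kappa * s / M.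
  by apply: Rdiv_lt_0_compat => //; apply: Rmult_lt_0_compat.
have -> : s = M / kappa * (kappa * s / M) by field; lra.
rewrite -Rpower_mult_distr //; last by apply: Rdiv_lt_0_compat.
have -> : kappa * (M / kappa * (kappa * s / M)) = M * (kappa * s / M) by field; lra.
set q := kappa * s / M in h1 *.
rewrite -{2}(Rmult_1_r (Rpower (M / kappa) M)) Rmult_assoc.
apply: Rmult_le_compat_l; first by left; exact: Rpower_pos.
have -> : exp (- (M * q)) = Rpower (exp q) (- M).
  by rewrite Rpower_exp; congr exp; ring.
rewrite Rpower_Ropp.
have h2 : Rpower q M <= Rpower (exp q) M.
  apply: Rle_Rpower_l; first lra.
  by split=> //; have := exp_ineq1_le q; lra.
have h3 := Rpower_pos (exp q) M.
apply: (Rmult_le_reg_r (Rpower (exp q) M)) => //.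
rewrite Rmult_assoc Rinv_l; lra.
Qed.

Lemma poly_mul_exp_bound (kappa beta : R) (N : nat) : 0 < kappa -> 0 < beta ->
  exists C, 0 < C /\
  forall p, 0 < p -> (1 + p) ^ N * exp (- (kappa * Rpower p beta)) <= C.
Proof.
move=> hk hb.
(* The power is raised from [N] to [N + 1] because the preceding bound asks for a positive exponent,
   while [N] may be 0. *)
have hN : 0 < INR N.+1 by apply: lt_0_INR; lia.
have [C [hC H]] := Rpower_mul_exp_bound hk hb hN.
exists (2 ^ N.+1 * (1 + C)); split.
  by apply: Rmult_lt_0_compat; [apply: pow_lt|]; lra.
move=> p hp.
have he := exp_pos (- (kappa * Rpower p beta)).
have he1 : exp (- (kappa * Rpower p beta)) <= 1.
  rewrite -exp_0; apply: exp_le.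
  have : 0 < kappa * Rpower p beta by apply: Rmult_lt_0_compat => //; exact: Rpower_pos.
  lra.
have hpow : (1 + p) ^ N <= 2 ^ N.+1 * (1 + Rpower p (INR N.+1)).
  rewrite Rpower_pow //.
  apply: Rle_trans (_ : (1 + p) ^ N.+1 <= _).
    by apply: Rle_pow; [lra|lia].
  have h2 : 0 < 2 ^ N.+1 by apply: pow_lt; lra.
  have hpp : 0 < p ^ N.+1 by apply: pow_lt.
  case: (Rle_dec 1 p) => h1.
    apply: Rle_trans (_ : (2 * p) ^ N.+1 <= _); first by apply: pow_incr; lra.
    by rewrite Rpow_mult_distr; apply: Rmult_le_compat_l; lra.
  apply: Rle_trans (_ : 2 ^ N.+1 <= _); first by apply: pow_incr; lra.
  by rewrite -{1}(Rmult_1_r (2 ^ N.+1)); apply: Rmult_le_compat_l; lra.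
apply: Rle_trans (Rmult_le_compat_r _ _ _ (Rlt_le _ _ he) hpow) _.
rewrite Rmult_assoc; apply: Rmult_le_compat_l; first by left; apply: pow_lt; lra.
have := H p hp; rewrite Rmult_plus_distr_r; lra.
Qed.

(** Two further powers of [1 + p] bring every stretched exponential under one majorant,
    [/ (1 + p) ^ 2]. *)
Lemma exp_le_rational (kappa beta : R) (N : nat) : 0 < kappa -> 0 < beta ->
  exists C, 0 < C /\
  forall p, 0 < p -> (1 + p) ^ N * exp (- (kappa * Rpower p beta)) <= C * / (1 + p) ^ 2.
Proof.
move=> hk hb; have [C [hC H]] := poly_mul_exp_bound (N + 2) hk hb.
exists C; split=> // p hp.
have hq : 0 < (1 + p) ^ 2 by apply: pow_lt; lra.
apply: (Rmult_le_reg_r ((1 + p) ^ 2)) => //.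
rewrite Rmult_assoc (Rmult_assoc C) Rinv_l; last lra.
rewrite Rmult_1_r (Rmult_comm (exp _)) -Rmult_assoc.
have -> : (1 + p) ^ N * (1 + p) ^ 2 = (1 + p) ^ (N + 2).
  by rewrite -Rdef_pow_add.
exact: H.
Qed.

Lemma filterlim_0_right (P : R -> Prop) (d : R) :
  0 < d -> (forall x, 0 < x < d -> P x) -> at_right 0 P.
Proof.
move=> hd hP; exists (mkposreal d hd) => x.
rewrite /ball /= /AbsRing_ball /abs /minus /plus /opp /= => hx h0.
by apply: hP; split=> //; move: hx; rewrite Ropp_0 Rplus_0_r Rabs_pos_eq; lra.
Qed.

(** The common majorant, of mass 1, for all integrals over the half line: the stable density and
    both Mittag-Leffler operators. *)
Lemma majorant_rational :
  majorant (at_right 0) (Rbar_locally p_infty) (Rlt 0)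
    (fun x => / (1 + x) ^ 2) (fun x => - / (1 + x)) (-1) 0.
Proof.
split.
- by move=> x y z; lra.
- by apply: (filterlim_0_right (d := 1)); [lra|move=> x []].
- by exists 0.
- by move=> x hx; auto_derive; [lra|field; lra].
- move=> x hx; apply: (ex_derive_continuous (V := R_NormedModule)).
  auto_derive; have : 0 < (1 + x) * ((1 + x) * 1) by apply: Rmult_lt_0_compat; lra.
  lra.
- apply/filterlim_Rabs_minus => eps heps.
  apply: (filterlim_0_right heps) => x hx.
  have h : 0 < / (1 + x) by apply: Rinv_0_lt_compat; lra.
  have e : / (1 + x) = 1 - x * / (1 + x) by field; lra.
  have h1 : x * / (1 + x) < eps.
    have h2 : / (1 + x) < 1 by rewrite -Rinv_1; apply: Rinv_lt_contravar; lra.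
    have : x * / (1 + x) <= x * 1 by apply: Rmult_le_compat_l; lra.
    lra.
  have h3 : 0 < x * / (1 + x) by apply: Rmult_lt_0_compat; lra.
  apply: Rabs_def1; lra.
- apply/filterlim_Rabs_minus => eps heps.
  exists (/ eps) => x hx.
  have h0 : 0 < / eps by exact: Rinv_0_lt_compat.
  have h : 0 < / (1 + x) by apply: Rinv_0_lt_compat; lra.
  have h1 : / (1 + x) < eps.
    rewrite -(Rinv_inv eps); apply: Rinv_lt_contravar; last lra.
    by apply: Rmult_lt_0_compat; lra.
  apply: Rabs_def1; lra.
Qed.

(** The majorant for the Volterra integrals: only the left end is improper, and [gamma > 0] makes
    the singularity there integrable. *)
Lemma majorant_power (gamma X : R) : 0 < gamma -> 0 < X ->
  majorant (at_right 0) (at_point X) (fun r => 0 < r <= X)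
    (fun r => Rpower r (gamma - 1)) (fun r => Rpower r gamma / gamma)
    0 (Rpower X gamma / gamma).
Proof.
move=> hg hX; split.
- by move=> x y z; lra.
- by apply: (filterlim_0_right hX) => x; lra.
- by rewrite /at_point; lra.
- move=> x [hx _]; rewrite /Rpower; auto_derive => //.
  have -> : exp ((gamma - 1) * ln x) = exp (gamma * ln x) * / x.
    have -> : (gamma - 1) * ln x = gamma * ln x + - ln x by ring.
    by rewrite exp_plus exp_Ropp exp_ln.
  field; lra.
- move=> x [hx _]; apply: (ex_derive_continuous (V := R_NormedModule)).
  by rewrite /Rpower; auto_derive.
- apply/filterlim_Rabs_minus => eps heps.
  have he : 0 < eps * gamma by apply: Rmult_lt_0_compat.
  apply: (filterlim_0_right (Rpower_pos (eps * gamma) (/ gamma))) => x hx.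
  rewrite Rminus_0_r Rabs_pos_eq.
    have : Rpower x gamma < Rpower (Rpower (eps * gamma) (/ gamma)) gamma.
      by apply: Rlt_Rpower_l.
    rewrite Rpower_mult Rinv_l; last lra.
    rewrite Rpower_1 // => h; apply: (Rmult_lt_reg_r gamma) => //.
    by rewrite /Rdiv Rmult_assoc Rinv_l; lra.
  by left; apply: Rdiv_lt_0_compat => //; exact: Rpower_pos.
- by move=> P [d hd]; rewrite /filtermap /at_point; apply: hd; exact: ball_center.
Qed.

(** * The stable density *)

Lemma Rabs_RInt_gen_le (f : R -> R) (I c : R) :
  (forall z, 0 < z -> continuous f z) ->
  is_RInt_gen (V := R_NormedModule) f (at_right 0) (Rbar_locally p_infty) I ->
  filter_prod (at_right 0) (Rbar_locally p_infty)
    (fun ab => Rabs (RInt f ab.1 ab.2) <= c) ->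
  Rabs I <= c.
Proof.
move=> cf /(is_RInt_gen_filterlim (V := R_CompleteNormedModule) majorant_rational _ cf) h hc.
exact: (filterlim_norm_le (V := R_CompleteNormedModule) h hc).
Qed.

Section StableDensity.
Variable beta : R.
Hypothesis hbeta : 0 < beta < 1.

(** The real part of [e^(i PI beta / 2)], hence the rate in the decay [e^(-kappa p^beta)] of the
    integrand of the density; positive because [beta < 1]. *)
Let kappa := cos (beta * (PI / 2)).

Let hkappa : 0 < kappa.
Proof.
have h := PI_RGT_0; apply: cos_gt_0.
  have : 0 < beta * (PI / 2) by apply: Rmult_lt_0_compat; lra.
  lra.
have : beta * (PI / 2) < 1 * (PI / 2) by apply: Rmult_lt_compat_r; lra.
lra.
Qed.

(* With [w = u + i theta], [logP] and [logQ] are the real and imaginary parts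
   of [y e^w - e^(beta w) + w]; in the variable [p = e^u] the integrand of
   [stable_density beta 1 y] is the imaginary part of [exp] of this at
   [theta = PI / 2]. *)
Definition logP (y u th : R) : R :=
  y * exp u * cos th - exp (beta * u) * cos (beta * th) + u.
Definition logQ (y u th : R) : R :=
  y * exp u * sin th - exp (beta * u) * sin (beta * th) + th.
Definition logRe y u th := exp (logP y u th) * cos (logQ y u th).
Definition logIm y u th := exp (logP y u th) * sin (logQ y u th).

(** [dP] and [dQ] are the derivatives of [logP] and [logQ] in [u]. Then [dRe] is at once the
    [u]-derivative of [logRe] and the [th]-derivative of [logIm]: the Cauchy-Riemann equation on
    which the contour argument rests. *)
Let dP (y u th : R) : R :=
  y * exp u * cos th - beta * exp (beta * u) * cos (beta * th) + 1.
Let dQ (y u th : R) : R :=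
  y * exp u * sin th - beta * exp (beta * u) * sin (beta * th).
Let dRe y u th := exp (logP y u th) *
  (dP y u th * cos (logQ y u th) - dQ y u th * sin (logQ y u th)).

Lemma is_derive_logIm_theta y u th : is_derive (logIm y u) th (dRe y u th).
Proof.
rewrite /logIm /logP /logQ; auto_derive => //.
rewrite /dRe /dP /dQ /logP /logQ /Rminus; ring.
Qed.

Lemma is_derive_logRe_u y u th : is_derive (fun u => logRe y u th) u (dRe y u th).
Proof.
rewrite /logRe /logP /logQ; auto_derive => //.
rewrite /dRe /dP /dQ /logP /logQ /Rminus; ring.
Qed.

Lemma continuous_dRe y u th : continuous (fun u => dRe y u th) u.
Proof.
apply: (ex_derive_continuous (V := R_NormedModule)).
by rewrite /dRe /logP /logQ /dP /dQ; auto_derive.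
Qed.

Lemma continuous_logIm y u th : continuous (fun u => logIm y u th) u.
Proof.
apply: (ex_derive_continuous (V := R_NormedModule)).
by rewrite /logIm /logP /logQ; auto_derive.
Qed.

Lemma continuity_2d_dRe y th u : continuity_2d_pt (fun th u => dRe y u th) th u.
Proof.
have c1 (f : R -> R) g a b : (forall x, ex_derive f x) ->
    continuity_2d_pt g a b -> continuity_2d_pt (fun u v => f (g u v)) a b.
  move=> hf hg; apply: continuity_1d_2d_pt_comp => //.
  by apply/continuity_pt_filterlim; apply: (ex_derive_continuous f).
have ce g a b : continuity_2d_pt g a b -> continuity_2d_pt (fun u v => exp (g u v)) a b.
  by apply: c1 => x; auto_derive.
have cs g a b : continuity_2d_pt g a b -> continuity_2d_pt (fun u v => sin (g u v)) a b.
  by apply: c1 => x; auto_derive.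
have cc g a b : continuity_2d_pt g a b -> continuity_2d_pt (fun u v => cos (g u v)) a b.
  by apply: c1 => x; auto_derive.
rewrite /dRe /dP /dQ /logP /logQ.
repeat first [exact: continuity_2d_pt_const | exact: continuity_2d_pt_id1
  | exact: continuity_2d_pt_id2 | apply: (ce _ _ _)
  | apply: (cs _ _ _) | apply: (cc _ _ _)
  | apply: continuity_2d_pt_mult | apply: continuity_2d_pt_minus
  | apply: continuity_2d_pt_plus].
Qed.

(** Under the integral sign the derivative in [th] is, by Cauchy-Riemann, a derivative in [u], so
    the integral collapses to its endpoints. This is Cauchy's theorem on an infinitely thin
    rectangle. *)
Lemma is_derive_int_logIm y u1 u2 th :
  is_derive (fun th => RInt (fun u => logIm y u th) u1 u2) th
    (logRe y u2 th - logRe y u1 th).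
Proof.
have ext t u : Derive (fun z => logIm y u z) t = dRe y u t.
  by apply: is_derive_unique; exact: is_derive_logIm_theta.
have -> : logRe y u2 th - logRe y u1 th =
    RInt (fun u => Derive (fun z => logIm y u z) th) u1 u2.
  have h : is_RInt (fun u => dRe y u th) u1 u2 (minus (logRe y u2 th) (logRe y u1 th)).
    apply: (@is_RInt_derive R_CompleteNormedModule (fun u => logRe y u th)) => u _.
      exact: is_derive_logRe_u.
    exact: continuous_dRe.
  rewrite -[LHS](is_RInt_unique _ _ _ _ h).
  by apply: RInt_ext => u _; rewrite ext.
apply: (@is_derive_RInt_param (fun z u => logIm y u z)).
- apply: filter_forall => t u _; exists (dRe y u t); exact: is_derive_logIm_theta.
- move=> u _; apply: continuity_2d_pt_ext (continuity_2d_dRe y th u) => t v.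
  by rewrite ext.
- apply: filter_forall => t; apply: (ex_RInt_continuous (V := R_CompleteNormedModule)).
  by move=> z _; exact: continuous_logIm.
Qed.

Lemma Rabs_logRe_le y u th : Rabs (logRe y u th) <= exp (logP y u th).
Proof.
rewrite /logRe Rabs_mult (Rabs_pos_eq (exp _)); last by left; exact: exp_pos.
rewrite -{2}(Rmult_1_r (exp _)); apply: Rmult_le_compat_l; first by left; exact: exp_pos.
exact: Rabs_cos_le1.
Qed.

(* Cauchy's theorem on the rectangle [u1, u2] x [tha, thb]: the contributions
   of the two vertical sides bound the difference. *)
Lemma rectangle_bound y u1 u2 tha thb e1 e2 : tha <= thb ->
  (forall th, tha <= th <= thb -> exp (logP y u1 th) <= e1) ->
  (forall th, tha <= th <= thb -> exp (logP y u2 th) <= e2) ->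
  Rabs (RInt (fun u => logIm y u thb) u1 u2 - RInt (fun u => logIm y u tha) u1 u2)
  <= (e2 + e1) * (thb - tha).
Proof.
move=> hth h1 h2.
rewrite -(Rabs_pos_eq (thb - tha)); last lra.
apply: (@lipschitz_MVT (fun th => RInt (fun u => logIm y u th) u1 u2)) => th.
  exact: is_derive_int_logIm.
rewrite Rmin_left // Rmax_right // => h.
have := Rabs_triang (logRe y u2 th) (- logRe y u1 th).
rewrite Rabs_Ropp -/(Rminus _ _).
have := Rabs_logRe_le y u1 th; have := Rabs_logRe_le y u2 th.
have := h1 th h; have := h2 th h; lra.
Qed.

(** * The density as a real improper integral *)

Definition stable_integrand (y p : R) : R :=
  exp (- (kappa * Rpower p beta)) * cos (p * y - sin (beta * (PI / 2)) * Rpower p beta).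

Lemma continuous_stable_integrand y p : 0 < p -> continuous (stable_integrand y) p.
Proof.
move=> hp; apply: (ex_derive_continuous (V := R_NormedModule)).
by rewrite /stable_integrand /Rpower; auto_derive.
Qed.

Lemma stable_integrand_le y p :
  Rabs (stable_integrand y p) <= exp (- (kappa * Rpower p beta)).
Proof.
rewrite /stable_integrand Rabs_mult (Rabs_pos_eq (exp _)); last by left; exact: exp_pos.
rewrite -{2}(Rmult_1_r (exp _)); apply: Rmult_le_compat_l; first by left; exact: exp_pos.
exact: Rabs_cos_le1.
Qed.

(** [RInt_gen] has a value even for a divergent integral, so convergence comes first: the modulus of
    the complex integrand is exactly [e^(-kappa p^beta)]. The real part is then read off
    componentwise. *)
Lemma stable_densityE y :
  is_RInt_gen (stable_integrand y) (at_right 0) (Rbar_locally p_infty)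
    (PI * stable_density beta 1 y).
Proof.
rewrite /stable_density; set f := fun p => _.
have fE p : f p = (stable_integrand y p,
   exp (- (kappa * Rpower p beta)) * sin (p * y - sin (beta * (PI / 2)) * Rpower p beta)).
  rewrite /f /stable_integrand /Cexp /=.
  have -> : PI * beta / 2 = beta * (PI / 2) by field.
  rewrite -/kappa.
  have e1 : exp (0 * (beta * (PI / 2)) - 1 * 0) = 1.
    by rewrite Rmult_0_l Rmult_0_r Rminus_0_r exp_0.
  congr pair; congr (_ * _); try congr exp; try congr cos; try congr sin;
    rewrite e1 -?/kappa /kappa;
    (have -> : 0 * 0 + 1 * (beta * (PI / 2)) = beta * (PI / 2) by ring); ring.
have [C [hC H]] := exp_le_rational 0 hkappa (proj1 hbeta).
have [hI _] : is_RInt_gen f (at_right 0) (Rbar_locally p_infty)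
    (RInt_gen (V := C_R_CompleteNormedModule) f (at_right 0) (Rbar_locally p_infty)) /\
   norm (RInt_gen (V := C_R_CompleteNormedModule) f (at_right 0) (Rbar_locally p_infty))
   <= Rabs (C * (0 - -1)).
{ refine (RInt_gen_majorant (V := C_R_CompleteNormedModule) majorant_rational (f := f) (c := C) _ _) => p hp.
  - apply: (continuous_ext (fun p => (stable_integrand y p,
   exp (- (kappa * Rpower p beta)) * sin (p * y - sin (beta * (PI / 2)) * Rpower p beta)))).
      by move=> q; rewrite fE.
    apply: (continuous_comp_2 (stable_integrand y) _ (fun a b => (a, b))).
    + exact: continuous_stable_integrand.
    + apply: (ex_derive_continuous (V := R_NormedModule)).
      by rewrite /Rpower; auto_derive.
    + apply: continuous_ext (continuous_id _); by case.
  - rewrite fE; apply: Rle_trans (H p hp); rewrite Rmult_1_l.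
    rewrite /norm /= /prod_norm /stable_integrand /=.
    set e := exp _; set q := _ - _.
    rewrite /norm /= /abs /=.
    have -> : Rabs (e * cos q) * (Rabs (e * cos q) * 1) +
      Rabs (e * sin q) * (Rabs (e * sin q) * 1) = Rsqr e.
      have -> (a b : R) : Rabs a * (Rabs a * 1) + Rabs b * (Rabs b * 1) = Rsqr a + Rsqr b.
        by rewrite (Rsqr_abs a) (Rsqr_abs b) /Rsqr; ring.
      rewrite !Rsqr_mult -Rmult_plus_distr_l Rplus_comm sin2_cos2; ring.
    rewrite sqrt_Rsqr; [exact: Rle_refl|left; exact: exp_pos]. }
move: hI; set I := RInt_gen _ _ _ => hI.
have -> : PI * (/ PI * Re I) = Re I by field; exact: PI_neq0.
move=> P hP.
have hP' : locally I (fun z : prod R R => P (fst z)).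
  have [d hd] := hP; exists d => z [h _]; exact: hd.
have h : filter_prod (at_right 0) (Rbar_locally p_infty) (fun ab => exists z : prod R R,
    is_RInt (V := C_R_NormedModule) f ab.1 ab.2 z /\ P (fst z)) := hI _ hP'.
apply: filter_imp h => -[a b] /= [z [h1 h2]].
exists (fst z); split=> //.
apply: is_RInt_ext (is_RInt_fct_extend_fst _ _ _ _ h1) => x _.
exact: (f_equal fst (fE x)).
Qed.

(** The cosine is 1-Lipschitz, and the resulting factor [p] is still integrable against
    [e^(-kappa p^beta)]. The estimate serves the continuity of the Zolotarev weights. *)
Lemma stable_density_lipschitz :
  exists C, forall y y',
    Rabs (stable_density beta 1 y - stable_density beta 1 y') <= C * Rabs (y - y').
Proof.
have [C [hC H]] := exp_le_rational 1 hkappa (proj1 hbeta).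
have hpi := PI_RGT_0.
exists (C / PI) => y y'.
pose d p := minus (stable_integrand y p) (stable_integrand y' p).
have hd : is_RInt_gen d (at_right 0) (Rbar_locally p_infty)
   (minus (PI * stable_density beta 1 y) (PI * stable_density beta 1 y')).
  by apply: (is_RInt_gen_minus (V := R_NormedModule)); apply: stable_densityE.
have [] := RInt_gen_majorant (V := R_CompleteNormedModule) majorant_rational (f := d)
   (c := C * Rabs (y - y')).
- move=> p hp; apply: (continuous_minus (V := R_NormedModule));
    exact: continuous_stable_integrand.
- move=> p hp.
  apply: Rle_trans (_ : exp (- (kappa * Rpower p beta)) * (p * Rabs (y - y')) <= _).
    rewrite /d /stable_integrand /norm /= /abs /= /minus /plus /opp /=.
    set e := exp _; set a := cos _; set b := cos _.
    have -> : e * a + - (e * b) = e * (a - b) by ring.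
    rewrite Rabs_mult (Rabs_pos_eq e); last by left; exact: exp_pos.
    apply: Rmult_le_compat_l; first by left; exact: exp_pos.
    apply: Rle_trans (cos_lipschitz _ _) _.
    rewrite -(Rabs_pos_eq p); last lra.
    rewrite -Rabs_mult (Rabs_pos_eq p); last lra.
    by right; congr Rabs; ring.
  have hy := Rabs_pos (y - y').
  have := H p hp; rewrite pow_1 => h.
  have he := exp_pos (- (kappa * Rpower p beta)).
  have h' : p * exp (- (kappa * Rpower p beta)) <= C * / (1 + p) ^ 2.
    apply: Rle_trans h; apply: Rmult_le_compat_r; lra.
  have := Rmult_le_compat_r _ _ _ hy h'; lra.
- move=> _; rewrite (is_RInt_gen_unique _ _ hd) => h.
  have {h} : Rabs (PI * (stable_density beta 1 y - stable_density beta 1 y'))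
     <= C * Rabs (y - y').
    apply: Rle_trans (_ : _ <= Rabs (C * Rabs (y - y') * (0 - -1))) _.
      by apply: Rle_trans h; right; rewrite /norm /= /abs /= /minus /plus /opp /=; congr Rabs; ring.
    right; rewrite Rabs_pos_eq; first ring.
    have := Rmult_le_pos _ _ (Rlt_le _ _ hC) (Rabs_pos (y - y')); lra.
  rewrite Rabs_mult (Rabs_pos_eq PI); last lra.
  move=> h; apply: (Rmult_le_reg_l PI) => //.
  have -> : PI * (C / PI * Rabs (y - y')) = C * Rabs (y - y') by field; lra.
  exact: h.
Qed.

(** The Jacobian of [z = e^w] is [e^w], which equals [i p] at height [PI / 2]; this factor [i] is
    why the real part of the integrand turns into the imaginary part [logIm]. *)
Lemma RInt_stable_log y p1 p2 : 0 < p1 -> 0 < p2 ->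
  RInt (stable_integrand y) p1 p2 = RInt (fun u => logIm y u (PI / 2)) (ln p1) (ln p2).
Proof.
move=> h1 h2.
have h : is_RInt (fun u => scal (exp u) (stable_integrand y (exp u))) (ln p1) (ln p2)
    (RInt (stable_integrand y) (exp (ln p1)) (exp (ln p2))).
  apply: (is_RInt_comp (V := R_CompleteNormedModule)) => u _.
    by apply: continuous_stable_integrand; exact: exp_pos.
  split; first exact: is_derive_exp.
  by apply: (ex_derive_continuous (V := R_NormedModule)); auto_derive.
rewrite !exp_ln // in h.
rewrite -(is_RInt_unique _ _ _ _ h); apply: RInt_ext => u _.
rewrite /scal /= /mult /= /logIm /logP /logQ /stable_integrand Rpower_exp.
rewrite cos_PI2 sin_PI2 -/kappa.
have -> : y * exp u * 1 - exp (beta * u) * sin (beta * (PI / 2)) + PI / 2 =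
  PI / 2 + (exp u * y - sin (beta * (PI / 2)) * exp (beta * u)) by ring.
rewrite -cos_sin -Rmult_assoc -exp_plus; congr (exp _ * _); ring.
Qed.

Lemma exp_logP_ln y p th : 0 < p ->
  exp (logP y (ln p) th) =
  p * exp (y * p * cos th - Rpower p beta * cos (beta * th)).
Proof.
by move=> hp; rewrite /logP exp_plus exp_ln // Rmult_comm.
Qed.

(** * Decay of the stable density at both ends *)

Lemma cos_le1 x : cos x <= 1.
Proof. have := COS_bound x; lra. Qed.

Lemma RInt_logIm_0 y u1 u2 : RInt (fun u => logIm y u 0) u1 u2 = 0.
Proof.
apply: is_RInt_unique.
apply: (is_RInt_ext (fun _ : R => 0)) => [u _|].
  by rewrite /logIm /logQ Rmult_0_r sin_0 !Rmult_0_r Rminus_0_r Rplus_0_r sin_0 Rmult_0_r.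
by have := is_RInt_const (V := R_NormedModule) u1 u2 0;
  rewrite /scal /= /mult /= Rmult_0_r.
Qed.

(** The segment from [p1] to [c] is turned from height [PI / 2] down to the positive real axis,
    where the integrand is real and [logIm] vanishes. Only the arcs of radius [p1] and [c] remain;
    their angle is at most 2, and [cos (beta * th) >= kappa] along them. *)
Lemma stable_head_bound y p1 c : 0 < y -> 0 < p1 -> 0 < c ->
  Rabs (RInt (stable_integrand y) p1 c) <=
  2 * (c * exp (c * y - kappa * Rpower c beta) + p1 * exp (p1 * y)).
Proof.
move=> hy hp hc; rewrite RInt_stable_log //.
have hpi := PI_RGT_0; have hpi4 := PI_4.
have hcos th : 0 <= th <= PI / 2 -> kappa <= cos (beta * th).
  move=> hth; apply: cos_decr_1.
  - by apply: Rmult_le_pos; lra.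
  - have : beta * th <= 1 * (PI / 2) by apply: Rmult_le_compat; lra.
    lra.
  - by apply: Rmult_le_pos; lra.
  - have : beta * (PI / 2) <= 1 * (PI / 2) by apply: Rmult_le_compat; lra.
    lra.
  - by apply: Rmult_le_compat_l; lra.
have hP p th : 0 < p -> 0 <= th <= PI / 2 ->
    exp (logP y (ln p) th) <= p * exp (p * y - kappa * Rpower p beta).
  move=> hp0 hth; rewrite exp_logP_ln //.
  apply: Rmult_le_compat_l; first lra.
  apply: exp_le.
  have h1 : y * p * cos th <= y * p * 1.
    apply: Rmult_le_compat_l; last exact: cos_le1.
    by apply: Rmult_le_pos; lra.
  have h2 : Rpower p beta * kappa <= Rpower p beta * cos (beta * th).
    by apply: Rmult_le_compat_l; [left; exact: Rpower_pos|exact: hcos].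
  lra.
have := @rectangle_bound y (ln p1) (ln c) 0 (PI / 2) _ _ _ (fun th => @hP p1 th hp)
  (fun th => @hP c th hc).
rewrite RInt_logIm_0 !Rminus_0_r => h.
apply: Rle_trans (h _) _; first lra.
have e1 : 0 < c * exp (c * y - kappa * Rpower c beta).
  by apply: Rmult_lt_0_compat => //; exact: exp_pos.
have e2 : 0 < p1 * exp (p1 * y - kappa * Rpower p1 beta).
  by apply: Rmult_lt_0_compat => //; exact: exp_pos.
apply: Rle_trans (_ : _ <= (c * exp (c * y - kappa * Rpower c beta) +
   p1 * exp (p1 * y - kappa * Rpower p1 beta)) * 2) _.
  by apply: Rmult_le_compat_l; lra.
rewrite Rmult_comm; apply: Rmult_le_compat_l; first lra.
apply: Rplus_le_compat_l; apply: Rmult_le_compat_l; first lra.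
apply: exp_le.
have : 0 < kappa * Rpower p1 beta by apply: Rmult_lt_0_compat => //; exact: Rpower_pos.
lra.
Qed.

Lemma exp_le3 x : x <= 1 -> exp x <= 3.
Proof. by move=> /exp_le h; have := exp_le_3; lra. Qed.

(* Shifting the contour so that it avoids the disc [|z| < c]; with [c] of order
   [1 / y] this beats every [exp (- lam * y^-beta)]. *)
Lemma stable_density_shift : exists C, 0 < C /\ forall y c, 0 < y -> 0 < c ->
  Rabs (stable_density beta 1 y) <=
  C * (1 + exp (c * y)) * exp (- (kappa / 2 * Rpower c beta)).
Proof.
(* The decay rate is halved: one half pays for the integrability of the tail ([C]) and for the
   radius [c] of the arc ([C1]), the other half survives as the factor [E]. *)
have hk2 : 0 < kappa / 2 by lra.
have [C [hC H]] := exp_le_rational 0 hk2 (proj1 hbeta).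
have [C1 [hC1 H1]] := poly_mul_exp_bound 1 hk2 (proj1 hbeta).
have hpi := PI_RGT_0; have hpi1 : 1 <= PI by have := PI2_1; lra.
exists (C + 2 * C1); split=> [|y c hy hc]; first lra.
set E := exp (- (kappa / 2 * Rpower c beta)).
have hE : 0 < E by exact: exp_pos.
have hey : 0 < exp (c * y) by exact: exp_pos.
have hEE : exp (c * y - kappa * Rpower c beta) = exp (c * y) * (E * E).
  by rewrite /E -!exp_plus; congr exp; field.
have hcE : c * E <= C1.
  apply: Rle_trans (H1 c hc); rewrite pow_1; apply: Rmult_le_compat_r; [exact: Rlt_le|lra].
apply: Rle_trans (_ : Rabs (PI * stable_density beta 1 y) <= _).
  rewrite Rabs_mult (Rabs_pos_eq PI); last lra.
  rewrite -{1}(Rmult_1_l (Rabs _)); apply: Rmult_le_compat_r => //; exact: Rabs_pos.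
apply: le_epsilon => eps heps.
have cf z : 0 < z -> continuous (stable_integrand y) z by exact: continuous_stable_integrand.
apply: (Rabs_RInt_gen_le cf (@stable_densityE y)).
(* [p1 < / y] gives [e^(p1 y) <= e <= 3], and [p1 < eps / 6] then bounds the inner arc by [eps / 2],
   which enters doubled. *)
pose d := Rmin c (Rmin (/ y) (eps / 6)).
have hd : 0 < d.
  apply: Rmin_glb_lt => //; apply: Rmin_glb_lt; last lra.
  exact: Rinv_0_lt_compat.
apply: (Filter_prod _ _ _ (fun x => 0 < x < d) (fun x => c < x)).
- exact: (filterlim_0_right hd).
- by exists c.
move=> p1 p2 [hp1 hp1d] hp2 /=; rewrite /norm /= /abs /=.
have hd1 : p1 < / y /\ p1 < eps / 6.
  have h1 := Rmin_l (/ y) (eps / 6); have h2 := Rmin_r (/ y) (eps / 6).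
  have := Rmin_r c (Rmin (/ y) (eps / 6)); rewrite -/d; lra.
have exR a b : 0 < a -> 0 < b -> ex_RInt (stable_integrand y) a b.
  by move=> ha hb; apply: (ex_RInt_on (V := R_CompleteNormedModule) majorant_rational).
rewrite -(RInt_Chasles _ p1 c p2); [|exact: exR|by apply: exR; lra].
apply: Rle_trans (Rabs_triang _ _) _.
have b1 := stable_head_bound hy hp1 hc.
have b2 : Rabs (RInt (stable_integrand y) c p2) <= C * E.
  have hI : is_RInt (fun z => C * E * / (1 + z) ^ 2) c p2
      (C * E * (- / (1 + p2) - - / (1 + c))).
    apply: (is_RInt_scal (V := R_NormedModule)).
    apply: (@is_RInt_derive R_CompleteNormedModule (fun x => - / (1 + x))) => z.
      rewrite Rmin_left ?Rmax_right; try lra; move=> hz.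
      by apply: (maj_derive majorant_rational); lra.
    rewrite Rmin_left ?Rmax_right; try lra; move=> hz.
    by apply: (maj_cont majorant_rational); lra.
  apply: Rle_trans (norm_RInt_le (V := R_NormedModule) _ _ _ _ _ _ _ _ (RInt_correct _ _ _ (exR _ _ hc _)) hI) _.
  - lra.
  - move=> z hz; rewrite /norm /= /abs /=.
    apply: Rle_trans (stable_integrand_le _ _) _.
    have hz0 : 0 < z by lra.
    have := H z hz0; rewrite Rmult_1_l => h.
    have h2 : exp (- (kappa / 2 * Rpower z beta)) <= E.
      apply: exp_le; apply: Ropp_le_contravar; apply: Rmult_le_compat_l; first lra.
      by apply: Rle_Rpower_l; lra.
    have -> : - (kappa * Rpower z beta) =
      - (kappa / 2 * Rpower z beta) + - (kappa / 2 * Rpower z beta) by field.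
    rewrite exp_plus.
    have -> : C * E * / (1 + z) ^ 2 = C * / (1 + z) ^ 2 * E by ring.
    by apply: Rmult_le_compat => //; left; exact: exp_pos.
  - lra.
  - have i1 : 0 < / (1 + p2) by apply: Rinv_0_lt_compat; lra.
    have i2 : / (1 + c) <= 1 by rewrite -Rinv_1; apply: Rinv_le_contravar; lra.
    rewrite -{2}(Rmult_1_r (C * E)); apply: Rmult_le_compat_l; last lra.
    by apply: Rmult_le_pos; lra.
have b3 : p1 * exp (p1 * y) <= eps / 2.
  have h3 : exp (p1 * y) <= 3.
    apply: exp_le3; rewrite -(Rinv_l y); last lra.
    by apply: Rmult_le_compat_r; lra.
  have : p1 * exp (p1 * y) <= eps / 6 * 3.
    by apply: Rmult_le_compat; try lra; left; exact: exp_pos.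
  lra.
have b4 : c * exp (c * y - kappa * Rpower c beta) <= C1 * (exp (c * y) * E).
  rewrite hEE.
  have -> : c * (exp (c * y) * (E * E)) = c * E * (exp (c * y) * E) by ring.
  by apply: Rmult_le_compat_r => //; apply: Rmult_le_pos; lra.
have b5 : 0 < C1 * E by apply: Rmult_lt_0_compat.
have b6 : 0 < C * (exp (c * y) * E).
  by apply: Rmult_lt_0_compat => //; apply: Rmult_lt_0_compat.
have -> : (C + 2 * C1) * (1 + exp (c * y)) * E =
  C * E + 2 * (C1 * (exp (c * y) * E)) + (2 * (C1 * E) + C * (exp (c * y) * E)) by ring.
have b2' : abs (RInt (stable_integrand y) c p2) <= C * E := b2.
apply: Rle_trans (Rplus_le_compat _ _ _ _ b1 b2') _; lra.
Qed.

(* Rotating the contour by more than a quarter turn; the leading term [e^(yz)]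
   integrates to a real multiple of [1 / y] and drops out. *)
Lemma stable_density_rotate : exists C, 0 < C /\ forall y, 0 < y ->
  Rabs (stable_density beta 1 y) <= C * Rpower y (-1 - beta).
Proof.
have hpi := PI_RGT_0; have hpi4 := PI_4.
have hpi1 : 1 <= PI by have := PI2_1; lra.
(* This angle exceeds [PI / 2], so [cos th1 < 0]. Since [beta * (2 - beta) = 1 - (1 - beta)^2 < 1],
   also [beta * th1 < PI / 2], so both exponentials decay along the rotated ray. *)
pose th1 := PI / 2 * (2 - beta).
have hth1 : PI / 2 < th1 < PI.
  rewrite /th1; split; last nra.
  rewrite -{1}(Rmult_1_r (PI / 2)); apply: Rmult_lt_compat_l; lra.
have hbth : 0 < beta * th1 < PI / 2.
  rewrite /th1; split; first by apply: Rmult_lt_0_compat; [lra|apply: Rmult_lt_0_compat; lra].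
  have : 0 < (1 - beta) * (1 - beta) by apply: Rmult_lt_0_compat; lra.
  nra.
pose k1 := cos (beta * th1).
have hk1 : 0 < k1 by apply: cos_gt_0; lra.
have hk1' : k1 <= 1 by exact: cos_le1.
pose k := - cos th1.
have hk : 0 < k by have := cos_lt_0 th1; rewrite /k; lra.
have [C1 [hC1 H1]] := poly_mul_exp_bound 2 hk1 (proj1 hbeta).
exists (2 * Rpower (2 / k) (1 + beta)); split.
  by apply: Rmult_lt_0_compat; [lra|exact: Rpower_pos].
(* With this [s], [e^(y p cos th1)] is the square of [e^(-p / s)]. One factor absorbs [p^beta] at
   the price [s^beta], the other integrates to at most [s]; the result [s^(1 + beta)] has the
   required order in [y]. *)
move=> y hy; set s := 2 / (k * y).
have hky : 0 < k * y by apply: Rmult_lt_0_compat.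
have hs : 0 < s by apply: Rdiv_lt_0_compat; lra.
have -> : 2 * Rpower (2 / k) (1 + beta) * Rpower y (-1 - beta) = 2 * (Rpower s beta * s).
  have -> : s = 2 / k * / y by rewrite /s; field; lra.
  rewrite -{2}(Rpower_1 (2 / k * / y)); last first.
    by apply: Rmult_lt_0_compat; [apply: Rdiv_lt_0_compat|apply: Rinv_0_lt_compat]; lra.
  rewrite -Rpower_plus -Rpower_mult_distr; last first.
  - exact: Rinv_0_lt_compat.
  - by apply: Rdiv_lt_0_compat; lra.
  have -> : Rpower (/ y) (beta + 1) = Rpower y (-1 - beta).
    rewrite /Rpower ln_Rinv //; congr exp; ring.
  rewrite (Rplus_comm beta); ring.
have hcos th : PI / 2 <= th <= th1 -> k1 <= cos (beta * th) /\ cos th <= 0.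
  move=> hth; split.
    have hb1 : beta * th <= beta * th1 by apply: Rmult_le_compat_l; lra.
    have hb2 : 0 <= beta * th by apply: Rmult_le_pos; lra.
    by apply: cos_decr_1; lra.
  by apply: cos_le_0; lra.
have hP p th : 0 < p -> PI / 2 <= th <= th1 ->
    exp (logP y (ln p) th) <= p * exp (- (k1 * Rpower p beta)).
  move=> hp0 hth; rewrite exp_logP_ln //.
  apply: Rmult_le_compat_l; first lra.
  have [hc1 hc2] := hcos th hth.
  apply: exp_le.
  have h1 : 0 <= y * p * - cos th.
    by apply: Rmult_le_pos; [apply: Rmult_le_pos|]; lra.
  have h2 : Rpower p beta * k1 <= Rpower p beta * cos (beta * th).
    by apply: Rmult_le_compat_l => //; left; exact: Rpower_pos.
  lra.
(* [Z] is the imaginary part of [e^(y e^w) / y] at height [th1], a primitive of the leading term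
   obtained by dropping [e^(beta w)]. It tends to 0 at both ends of the ray. *)
pose Z u := exp (y * exp u * cos th1) * sin (y * exp u * sin th1) / y.
pose dZ u := exp (y * exp u * cos th1 + u) * sin (y * exp u * sin th1 + th1).
have hZ u : is_derive Z u (dZ u).
  rewrite /Z; auto_derive => //; rewrite /dZ exp_plus sin_plus; field; lra.
have cZ u : continuous dZ u.
  by apply: (ex_derive_continuous (V := R_NormedModule)); rewrite /dZ; auto_derive.
(* Dropping [e^(beta w)] removes a damping [e^(-A)] and a phase shift [q]; both [A] and [q] are at
   most [e^(beta u)] in absolute value, hence the factor 2. *)
have hdiff u : Rabs (logIm y u th1 - dZ u) <= 2 * Rpower s beta * (exp u * exp (- (exp u / s))).
  set phi := y * exp u * sin th1 + th1.
  set A := exp (beta * u) * k1.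
  set q := exp (beta * u) * sin (beta * th1).
  have heb : 0 < exp (beta * u) by exact: exp_pos.
  have hA : 0 < A by apply: Rmult_lt_0_compat.
  have -> : logIm y u th1 - dZ u =
      exp u * exp (- (exp u / s)) * exp (- (exp u / s)) *
      ((exp (- A) - 1) * sin (phi - q) + (sin (phi - q) - sin phi)).
    rewrite /logIm /dZ /logP /logQ -/phi.
    have -> : y * exp u * sin th1 - exp (beta * u) * sin (beta * th1) + th1 = phi - q.
      by rewrite /phi /q; ring.
    have -> : y * exp u * cos th1 - exp (beta * u) * cos (beta * th1) + u =
      u + - (exp u / s) + - (exp u / s) + - A.
      rewrite /A /s /k1 /k; field; rewrite /k in hk; lra.
    have -> : y * exp u * cos th1 + u = u + - (exp u / s) + - (exp u / s).
      rewrite /s /k; field; rewrite /k in hk; lra.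
    rewrite !exp_plus; ring.
  have hE := exp_pos (- (exp u / s)); have heu := exp_pos u.
  have hEu : 0 < exp u * exp (- (exp u / s)) by apply: Rmult_lt_0_compat.
  rewrite Rabs_mult Rabs_pos_eq; last by apply: Rmult_le_pos; lra.
  have h1 : Rabs ((exp (- A) - 1) * sin (phi - q) + (sin (phi - q) - sin phi))
      <= 2 * exp (beta * u).
    apply: Rle_trans (Rabs_triang _ _) _.
    have h1 : Rabs ((exp (- A) - 1) * sin (phi - q)) <= A * 1.
      rewrite Rabs_mult; apply: Rmult_le_compat; try exact: Rabs_pos; last exact: Rabs_sin_le1.
      have := exp_ineq1_le (- A).
      have : exp (- A) <= 1 by rewrite -exp_0; apply: exp_le; lra.
      by move=> a1 a2; apply: Rabs_le; lra.
    have h2 := sin_lipschitz (phi - q) phi.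
    have h3 : Rabs (phi - q - phi) <= exp (beta * u) * 1.
      have -> : phi - q - phi = - q by ring.
      rewrite Rabs_Ropp /q Rabs_mult Rabs_pos_eq; last lra.
      by apply: Rmult_le_compat_l; [lra|exact: Rabs_sin_le1].
    have h4 : A <= exp (beta * u) * 1 by apply: Rmult_le_compat_l; lra.
    lra.
  have h2 : exp (beta * u) * exp (- (exp u / s)) <= Rpower s beta.
    have hq : 0 < exp u / s by apply: Rdiv_lt_0_compat.
    have hb : 0 <= beta <= 1 by lra.
    have := Rpower_mul_exp_le1 hq hb => h.
    have -> : exp (beta * u) = Rpower s beta * Rpower (exp u / s) beta.
      rewrite Rpower_mult_distr //.
      have -> : s * (exp u / s) = exp u by field; lra.
      by rewrite Rpower_exp.
    rewrite Rmult_assoc -{2}(Rmult_1_r (Rpower s beta)).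
    by apply: Rmult_le_compat_l => //; left; exact: Rpower_pos.
  apply: Rle_trans (Rmult_le_compat_l _ _ _ _ h1) _; first by apply: Rmult_le_pos; lra.
  have -> : exp u * exp (- (exp u / s)) * exp (- (exp u / s)) * (2 * exp (beta * u)) =
    exp (beta * u) * exp (- (exp u / s)) * (2 * (exp u * exp (- (exp u / s)))) by ring.
  have -> : 2 * Rpower s beta * (exp u * exp (- (exp u / s))) =
    Rpower s beta * (2 * (exp u * exp (- (exp u / s)))) by ring.
  by apply: Rmult_le_compat_r => //; lra.
apply: Rle_trans (_ : Rabs (PI * stable_density beta 1 y) <= _).
  rewrite Rabs_mult (Rabs_pos_eq PI); last lra.
  rewrite -{1}(Rmult_1_l (Rabs _)); apply: Rmult_le_compat_r => //; exact: Rabs_pos.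
apply: le_epsilon => eps heps.
have cf z : 0 < z -> continuous (stable_integrand y) z by exact: continuous_stable_integrand.
apply: (Rabs_RInt_gen_le cf (@stable_densityE y)).
have e8 : 0 < eps / 8 by lra.
(* Error budget: two arcs of size [eps / 8] over an angle of at most 2, and two boundary values of
   [Z] of size [eps / 8], hence [3 / 4 * eps] in all. *)
pose q2 := Rmax 1 (Rmax (C1 / (eps / 8)) (s / y / (eps / 8))).
apply: (Filter_prod _ _ _ (fun x => 0 < x < Rmin 1 (eps / 8)) (fun x => q2 < x)).
- by apply: (filterlim_0_right (d := Rmin 1 (eps / 8))); [apply: Rmin_glb_lt; lra|].
- by exists q2.
move=> p1 p2 [hp1 hp1m] hp2 /=; rewrite /norm /= /abs /=.
have hp1d : p1 < eps / 8 by have := Rmin_r 1 (eps / 8); lra.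
have hp11 : p1 < 1 by have := Rmin_l 1 (eps / 8); lra.
have [hp2a [hp2b hp2c]] : 1 < p2 /\ C1 / (eps / 8) < p2 /\ s / y / (eps / 8) < p2.
  have a1 := Rmax_l 1 (Rmax (C1 / (eps / 8)) (s / y / (eps / 8))).
  have a2 := Rmax_r 1 (Rmax (C1 / (eps / 8)) (s / y / (eps / 8))).
  have a3 := Rmax_l (C1 / (eps / 8)) (s / y / (eps / 8)).
  have a4 := Rmax_r (C1 / (eps / 8)) (s / y / (eps / 8)).
  rewrite /q2 in hp2; lra.
have hp20 : 0 < p2 by lra.
rewrite RInt_stable_log //.
have c1 : p2 * exp (- (k1 * Rpower p2 beta)) <= eps / 8.
  have h := H1 p2 hp20.
  have he := exp_pos (- (k1 * Rpower p2 beta)).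
  have h2 : p2 * (p2 * exp (- (k1 * Rpower p2 beta))) <= C1.
    apply: Rle_trans h; rewrite -Rmult_assoc; apply: Rmult_le_compat_r; [lra|nra].
  apply: (Rmult_le_reg_l p2) => //; apply: Rle_trans h2 _.
  have -> : C1 = C1 / (eps / 8) * (eps / 8) by field; lra.
  by apply: Rmult_le_compat_r; lra.
have c2 : p1 * exp (- (k1 * Rpower p1 beta)) <= eps / 8.
  have : exp (- (k1 * Rpower p1 beta)) <= 1.
    rewrite -exp_0; apply: exp_le.
    have : 0 < k1 * Rpower p1 beta by apply: Rmult_lt_0_compat => //; exact: Rpower_pos.
    lra.
  move=> h; have := Rmult_le_compat_l _ _ _ (Rlt_le _ _ hp1) h; lra.
have hth1' : PI / 2 <= th1 by lra.
have rb := @rectangle_bound y (ln p1) (ln p2) (PI / 2) th1 _ _ hth1'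
  (fun th => @hP p1 th hp1) (fun th => @hP p2 th hp20).
have rb' : (p2 * exp (- (k1 * Rpower p2 beta)) + p1 * exp (- (k1 * Rpower p1 beta))) *
    (th1 - PI / 2) <= (eps / 4) * 2.
  apply: Rmult_le_compat; try lra.
  have : 0 < p2 * exp (- (k1 * Rpower p2 beta)) by apply: Rmult_lt_0_compat => //; exact: exp_pos.
  have : 0 < p1 * exp (- (k1 * Rpower p1 beta)) by apply: Rmult_lt_0_compat => //; exact: exp_pos.
  lra.
have zb2 : Rabs (Z (ln p2)) <= eps / 8.
  rewrite /Z exp_ln //.
  have hq : 0 < k * y * p2 by apply: Rmult_lt_0_compat.
  have h1 : exp (y * p2 * cos th1) <= / (k * y * p2).
    have -> : y * p2 * cos th1 = - (k * y * p2) by rewrite /k; ring.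
    rewrite exp_Ropp; apply: Rinv_le_contravar => //.
    have := exp_ineq1_le (k * y * p2); lra.
  have iy : 0 < / y by exact: Rinv_0_lt_compat.
  rewrite /Rdiv !Rabs_mult (Rabs_pos_eq (exp _)); last by left; exact: exp_pos.
  rewrite (Rabs_pos_eq (/ y)); last lra.
  have h2 : exp (y * p2 * cos th1) * Rabs (sin (y * p2 * sin th1)) <= / (k * y * p2) * 1.
    apply: Rmult_le_compat => //; [by left; exact: exp_pos|exact: Rabs_pos|exact: Rabs_sin_le1].
  apply: Rle_trans (Rmult_le_compat_r _ _ _ (Rlt_le _ _ iy) h2) _.
  have -> : / (k * y * p2) * 1 * / y = s / y / (eps / 8) * (/ p2) * (eps / 16).
    rewrite /s; field; lra.
  have : s / y / (eps / 8) * / p2 <= 1.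
    rewrite -(Rinv_r p2); last lra.
    by apply: Rmult_le_compat_r; [left; exact: Rinv_0_lt_compat|lra].
  move=> h; have : s / y / (eps / 8) * / p2 * (eps / 16) <= 1 * (eps / 16).
    by apply: Rmult_le_compat_r; lra.
  lra.
have zb1 : Rabs (Z (ln p1)) <= eps / 8.
  rewrite /Z exp_ln //.
  have h1 : exp (y * p1 * cos th1) <= 1.
    rewrite -exp_0; apply: exp_le.
    have : 0 <= y * p1 * k by apply: Rmult_le_pos; [apply: Rmult_le_pos|]; lra.
    rewrite /k; lra.
  have iy : 0 < / y by exact: Rinv_0_lt_compat.
  rewrite /Rdiv !Rabs_mult (Rabs_pos_eq (exp _)); last by left; exact: exp_pos.
  rewrite (Rabs_pos_eq (/ y)); last lra.
  have h3 : Rabs (sin (y * p1 * sin th1)) <= y * p1.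
    have := sin_lipschitz (y * p1 * sin th1) 0; rewrite sin_0 !Rminus_0_r => h.
    apply: Rle_trans h _; rewrite Rabs_mult Rabs_pos_eq; last by apply: Rmult_le_pos; lra.
    rewrite -{2}(Rmult_1_r (y * p1)); apply: Rmult_le_compat_l; last exact: Rabs_sin_le1.
    by apply: Rmult_le_pos; lra.
  have h2 : exp (y * p1 * cos th1) * Rabs (sin (y * p1 * sin th1)) <= 1 * (y * p1).
    apply: Rmult_le_compat => //; [by left; exact: exp_pos|exact: Rabs_pos].
  apply: Rle_trans (Rmult_le_compat_r _ _ _ (Rlt_le _ _ iy) h2) _.
  have -> : 1 * (y * p1) * / y = p1 by field; lra.
  lra.
have exl a b : ex_RInt (fun u => logIm y u th1) a b.
  by apply: (ex_RInt_continuous (V := R_CompleteNormedModule)) => z _; exact: continuous_logIm.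
have hZI : is_RInt dZ (ln p1) (ln p2) (minus (Z (ln p2)) (Z (ln p1))).
  apply: (@is_RInt_derive R_CompleteNormedModule Z) => z _; [exact: hZ|exact: cZ].
have hID := is_RInt_minus _ _ _ _ _ _ (RInt_correct _ _ _ (exl (ln p1) (ln p2))) hZI.
pose W u := - s * exp (- (exp u / s)).
have hW : is_RInt (fun u => 2 * Rpower s beta * (exp u * exp (- (exp u / s)))) (ln p1) (ln p2)
    (2 * Rpower s beta * (W (ln p2) - W (ln p1))).
  apply: (is_RInt_scal (V := R_NormedModule)).
  apply: (@is_RInt_derive R_CompleteNormedModule W) => z _.
    rewrite /W; auto_derive => //; rewrite /Rdiv; field; lra.
  by apply: (ex_derive_continuous (V := R_NormedModule)); auto_derive.
have hlnle : ln p1 <= ln p2 by left; apply: ln_increasing; lra.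
have hb := norm_RInt_le (V := R_NormedModule) _ _ _ _ _ _ hlnle (fun u _ => hdiff u) hID hW.
have hb' : Rabs (RInt (fun u => logIm y u th1) (ln p1) (ln p2) - (Z (ln p2) - Z (ln p1)))
   <= 2 * (Rpower s beta * s).
  apply: Rle_trans hb _.
  rewrite Rmult_assoc; apply: Rmult_le_compat_l; first lra.
  apply: Rmult_le_compat_l; first by left; exact: Rpower_pos.
  rewrite /W.
  have w1 : 0 < s * exp (- (exp (ln p2) / s)) by apply: Rmult_lt_0_compat => //; exact: exp_pos.
  have w2 : exp (- (exp (ln p1) / s)) <= 1.
    rewrite -exp_0; apply: exp_le.
    have : 0 < exp (ln p1) / s by apply: Rdiv_lt_0_compat => //; exact: exp_pos.
    lra.
  have := Rmult_le_compat_l _ _ _ (Rlt_le _ _ hs) w2; lra.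
move: rb hb' zb1 zb2; split_Rabs; lra.
Qed.

(** Divided by [beta], this is the density of the inverse stable subordinator at time 1 (the
    Mittag-Leffler law). *)
Definition mittag_weight (x : R) : R :=
  Rpower x (- 1 - 1 / beta) * stable_density beta 1 (Rpower x (- (1 / beta))).

(** Put [y = x^(-1/beta)]. For [x < 1] the rotated contour bounds the density by a multiple of
    [y^(-1-beta)], which cancels the prefactor [x^(-1-1/beta)] exactly. For [x >= 1] the prefactor
    is at most 1 and the shifted contour yields the exponential. *)
Lemma mittag_weight_bound (lam : R) : 0 < lam ->
  exists C, 0 < C /\ forall x, 0 < x -> Rabs (mittag_weight x) <= C * exp (- (lam * x)).
Proof.
move=> hlam.
have [C1 [hC1 H1]] := stable_density_shift.
have [C2 [hC2 H2]] := stable_density_rotate.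
(* The radius will be [c = L x^(1/beta)]: then [c y = L] does not depend on [x], and
   [kappa / 2 * c^beta = lam * x]. *)
pose L := Rpower (2 * lam / kappa) (/ beta).
have hL : 0 < L by exact: Rpower_pos.
have hlk : 0 < 2 * lam / kappa by apply: Rdiv_lt_0_compat; lra.
pose K1 := C1 * (1 + exp L).
have hK1 : 0 < K1 by apply: Rmult_lt_0_compat => //; have := exp_pos L; lra.
have hK2 : 0 < C2 * exp lam by apply: Rmult_lt_0_compat => //; exact: exp_pos.
exists (K1 + C2 * exp lam); split=> [|x hx]; first lra.
have hE := exp_pos (- (lam * x)).
have hy := Rpower_pos x (- (1 / beta)).
rewrite /mittag_weight Rabs_mult (Rabs_pos_eq (Rpower x (- 1 - 1 / beta))); last by left; exact: Rpower_pos.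
rewrite Rmult_plus_distr_r.
case: (Rle_dec 1 x) => h1.
- have hc : 0 < L * Rpower x (1 / beta) by apply: Rmult_lt_0_compat => //; exact: Rpower_pos.
  have h := H1 _ _ hy hc.
  have e1 : L * Rpower x (1 / beta) * Rpower x (- (1 / beta)) = L.
    by rewrite Rmult_assoc -Rpower_plus Rplus_opp_r Rpower_O // Rmult_1_r.
  have e2 : kappa / 2 * Rpower (L * Rpower x (1 / beta)) beta = lam * x.
    rewrite -Rpower_mult_distr //; last exact: Rpower_pos.
    rewrite /L !Rpower_mult Rinv_l; last lra.
    have -> : 1 / beta * beta = 1 by field; lra.
    rewrite !Rpower_1 //; field; lra.
  rewrite e1 e2 -/K1 in h.
  have h2 : Rpower x (-1 - 1 / beta) <= 1.
    apply: Rle_trans (_ : _ <= Rpower x 0) _; last by rewrite Rpower_O //; lra.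
    apply: Rle_Rpower => //.
    have : 0 < 1 / beta by apply: Rdiv_lt_0_compat; lra.
    lra.
  have h3 : 0 < C2 * exp lam * exp (- (lam * x)) by apply: Rmult_lt_0_compat.
  have := Rmult_le_compat _ _ _ _ (Rlt_le _ _ (Rpower_pos x (-1 - 1 / beta)))
    (Rabs_pos _) h2 h.
  lra.
- have := H2 _ hy.
  rewrite Rpower_mult => h.
  have h2 := Rmult_le_compat_l _ _ _ (Rlt_le _ _ (Rpower_pos x (-1 - 1 / beta))) h.
  apply: Rle_trans h2 _.
  have -> : Rpower x (-1 - 1 / beta) * (C2 * Rpower x (- (1 / beta) * (-1 - beta))) = C2.
    rewrite (Rmult_comm C2) -Rmult_assoc -Rpower_plus.
    have -> : -1 - 1 / beta + - (1 / beta) * (-1 - beta) = 0 by field; lra.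
    by rewrite Rpower_O // Rmult_1_l.
  have h3 : 1 <= exp lam * exp (- (lam * x)).
    rewrite -exp_plus -exp_0; apply: exp_le.
    have : lam * x <= lam * 1 by apply: Rmult_le_compat_l; lra.
    lra.
  have := Rmult_le_compat_l _ _ _ (Rlt_le _ _ hC2) h3.
  have : 0 < K1 * exp (- (lam * x)) by apply: Rmult_lt_0_compat.
  lra.
Qed.

Lemma continuous_stable_density_Rpower x : 0 < x ->
  continuous (fun x => stable_density beta 1 (Rpower x (- (1 / beta)))) x.
Proof.
move=> hx.
apply: (continuous_comp (fun x => Rpower x (- (1 / beta))) (stable_density beta 1)).
  apply: (ex_derive_continuous (V := R_NormedModule)).
  by rewrite /Rpower; auto_derive.
have [C H] := stable_density_lipschitz.
set y := Rpower _ _.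
apply/(filterlim_Rabs_minus (F := locally y)) => eps heps.
have hC : 0 < Rabs C + 1 by have := Rabs_pos C; lra.
have hd : 0 < eps / (Rabs C + 1) by apply: Rdiv_lt_0_compat.
exists (mkposreal _ hd) => z hz.
have {}hz : Rabs (z - y) < eps / (Rabs C + 1) := hz.
apply: Rle_lt_trans (H _ _) _.
apply: Rle_lt_trans (_ : _ <= Rabs C * Rabs (z - y)) _.
  by apply: Rmult_le_compat_r; [exact: Rabs_pos|exact: Rle_abs].
have h1 : Rabs C * Rabs (z - y) <= Rabs C * (eps / (Rabs C + 1)).
  by apply: Rmult_le_compat_l; [exact: Rabs_pos|lra].
have e : Rabs C * (eps / (Rabs C + 1)) = eps - eps / (Rabs C + 1) by field; lra.
lra.
Qed.

Lemma continuous_mittag_weight x : 0 < x -> continuous mittag_weight x.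
Proof.
move=> hx; apply: (continuous_mult (K := R_AbsRing)).
  apply: (ex_derive_continuous (V := R_NormedModule)).
  by rewrite /Rpower; auto_derive.
exact: continuous_stable_density_Rpower.
Qed.

Definition mittag_weight' (x : R) : R :=
  Rpower x (- (1 / beta)) * stable_density beta 1 (Rpower x (- (1 / beta))).

Lemma mittag_weight'E x : 0 < x -> mittag_weight' x = x * mittag_weight x.
Proof.
move=> hx; rewrite /mittag_weight' /mittag_weight -Rmult_assoc; congr (_ * _).
rewrite -{2}(Rpower_1 x) // -Rpower_plus; congr Rpower; ring.
Qed.

Lemma continuous_mittag_weight' x : 0 < x -> continuous mittag_weight' x.
Proof.
move=> hx; apply: (continuous_mult (K := R_AbsRing)).
  apply: (ex_derive_continuous (V := R_NormedModule)).
  by rewrite /Rpower; auto_derive.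
exact: continuous_stable_density_Rpower.
Qed.

End StableDensity.

(** * Semigroups *)

Lemma op_norm_bound {V W : Banach} (T : V -> W) (c : R) :
  (forall k x, T (scal k x) = scal k (T x)) -> Rbar_le (op_norm T) c ->
  forall x, norm (T x) <= c * norm x.
Proof.
move=> hT hc.
have h1 x : norm x <= 1 -> norm (T x) <= c.
  move=> hx.
  have [hub _] := Lub_Rbar_correct (fun r => exists x : V, norm x <= 1 /\ r = norm (T x)).
  have h := hub (norm (T x)) (ex_intro _ x (conj hx erefl)).
  exact: (Rbar_le_trans _ _ _ h hc).
move=> x; case: (Req_dec (norm x) 0) => hx.
  have -> : x = zero by exact: norm_eq_zero.
  have -> : T zero = zero by rewrite -(scal_zero_l (zero : V)) hT scal_zero_l.
  by rewrite !norm_zero; lra.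
have hx0 : 0 < norm x by have := norm_ge_0 x; lra.
have hi : 0 < / norm x by exact: Rinv_0_lt_compat.
have e : x = scal (norm x) (scal (/ norm x) x).
  by rewrite scal_assoc /mult /= Rinv_r // (scal_one x).
rewrite {1}e hT; apply: Rle_trans (norm_scal_le _ _) _.
rewrite Rabs_pos_eq; last lra.
rewrite Rmult_comm; apply: Rmult_le_compat_r; first lra.
apply: h1; apply: Rle_trans (norm_scal_le _ _) _.
by rewrite Rabs_pos_eq ?Rinv_l; lra.
Qed.

Lemma exp_ge1 x : 0 <= x -> 1 <= exp x.
Proof. have := exp_ineq1_le x; lra. Qed.

Lemma Rmax0_lipschitz p q : Rabs (Rmax 0 p - Rmax 0 q) <= Rabs (p - q).
Proof. rewrite /Rmax; do 2 case: Rle_dec => ?; split_Rabs; lra. Qed.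

Lemma continuousP {U : UniformSpace} {V : Banach} (f : U -> V) (x : U) :
  continuous f x <->
  (forall eps, 0 < eps -> locally x (fun y => norm (minus (f y) (f x)) < eps)).
Proof. exact: filterlim_norm_minus. Qed.

Lemma locally_Rabs (x d : R) (P : R -> Prop) : 0 < d ->
  (forall y, Rabs (y - x) < d -> P y) -> locally x P.
Proof. by move=> hd H; exists (mkposreal d hd) => y hy; exact: H. Qed.

Lemma locally_RabsE (x : R) (P : R -> Prop) :
  locally x P -> exists d, 0 < d /\ forall y, Rabs (y - x) < d -> P y.
Proof. by move=> [d hd]; exists d; split; [exact: cond_pos|exact: hd]. Qed.

Lemma at_right_0E (P : R -> Prop) :
  at_right 0 P -> exists d, 0 < d /\ forall y, 0 < y < d -> P y.
Proof.
move=> /locally_RabsE [d [hd H]]; exists d; split=> // y hy; apply: H; last lra.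
by rewrite Rminus_0_r Rabs_pos_eq; lra.
Qed.

(** For [p <= p'] one has [S p' x - S p x = S p (S (p' - p) x - x)], so right continuity at 0 and
    the local bound give continuity from both sides. [Rmax 0] freezes the orbit on the negative
    axis, which makes it a continuous function on the line. *)
Lemma semigroup_continuous {V : Banach} (S : R -> V -> V) (M m : R) :
  C0_semigroup S -> 0 <= M -> 0 <= m ->
  (forall t x, 0 <= t -> norm (S t x) <= M * exp (m * t) * norm x) ->
  forall x q, continuous (fun q => S (Rmax 0 q) x) q.
Proof.
move=> hS hM hm hb x q; apply/(continuousP (U := R_UniformSpace)) => eps heps.
set c := M * exp (m * (Rabs q + 1)) + 1.
have hc : 0 < c.
  have := Rmult_le_pos _ _ hM (Rlt_le _ _ (exp_pos (m * (Rabs q + 1)))); rewrite /c; lra.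
have hec : 0 < eps / c by apply: Rdiv_lt_0_compat.
have [d [hd Hd]] := at_right_0E (proj1 (filterlim_norm_minus _ _) (@sg_cont _ _ hS x) _ hec).
have key p p' : 0 <= p <= p' -> p <= Rabs q + 1 -> p' - p < d ->
    norm (minus (S p' x) (S p x)) < eps.
  move=> hp hpq hpd; case: (Req_dec p p') => [->|hne].
    by rewrite minus_eq_zero norm_zero.
  have -> : S p' x = S p (S (p' - p) x).
    by rewrite -(sg_add hS); try lra; congr S; ring.
  rewrite -(linear_minus _ _ _ (sg_linear hS (proj1 hp))).
  apply: Rle_lt_trans (hb _ _ (proj1 hp)) _.
  have h1 : norm (minus (S (p' - p) x) x) < eps / c by apply: Hd; lra.
  have h2 : M * exp (m * p) <= c - 1.
    rewrite /c; have : M * exp (m * p) <= M * exp (m * (Rabs q + 1)).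
      by apply: Rmult_le_compat_l => //; apply: exp_le; apply: Rmult_le_compat_l.
    lra.
  have h3 := norm_ge_0 (minus (S (p' - p) x) x).
  have h4 : M * exp (m * p) * norm (minus (S (p' - p) x) x) <=
      (c - 1) * norm (minus (S (p' - p) x) x) by apply: Rmult_le_compat_r.
  apply: Rle_lt_trans h4 _.
  have : c * norm (minus (S (p' - p) x) x) < c * (eps / c) by apply: Rmult_lt_compat_l.
  have -> : c * (eps / c) = eps by field; lra.
  lra.
have hd1 : 0 < Rmin d 1 by apply: Rmin_glb_lt; lra.
apply: (locally_Rabs hd1) => q' hq'.
have h1 := Rmin_l d 1; have h2 := Rmin_r d 1.
have hq := Rmax0_lipschitz q' q.
have a1 := Rmax_l 0 q; have a2 := Rmax_l 0 q'.
have a3 : Rmax 0 q <= Rabs q by rewrite /Rmax; case: Rle_dec => ?; split_Rabs; lra.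
have hq2 : Rabs (Rmax 0 q' - Rmax 0 q) < Rmin d 1 by lra.
have [hq3 hq4] := Rabs_def2 _ _ hq2.
case: (Rle_dec (Rmax 0 q) (Rmax 0 q')) => h.
  apply: key; lra.
rewrite norm_minusC; apply: key; lra.
Qed.

(* [S1 t] and [R01 t] are [e^{At}] on [B1] and from [B] to [B1]. *)
Record smoothing_semigroup (B1 B : Banach) (S1 : R -> B1 -> B1) (R01 : R -> B -> B1)
    (M1 m1 C0 mu omega : R) : Prop := {
  ss_linear : forall t, 0 <= t -> is_linear (S1 t);
  ss_bound : forall t x, 0 <= t -> norm (S1 t x) <= M1 * exp (m1 * t) * norm x;
  ss_cont : forall x q, continuous (fun q => S1 (Rmax 0 q) x) q;
  ss_plus : forall t x y, 0 < t -> R01 t (plus x y) = plus (R01 t x) (R01 t y);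
  ss_scal : forall t k x, 0 < t -> R01 t (scal k x) = scal k (R01 t x);
  ss_bound01 : forall t x, 0 < t ->
    norm (R01 t x) <= C0 * Rpower t (- omega) * exp (mu * t) * norm x;
  ss_cont01 : forall x q, 0 < q -> continuous (fun q => R01 q x) q }.

(** Algebraic identities for [R01] are checked in [B] and pulled back by injectivity of [i1]. For
    [t > 1], [R01 t = S1 (t - 1) (R01 1)] is bounded by [M1 e^(m1 t) kappa], and
    [1 <= t^(-omega) e^t] restores the power of [t]; hence the constants [kappa * (1 + M1)] and
    [m1 + 1]. *)
Lemma smoothing_semigroupI {B1 B : Banach} (i1 : B1 -> B)
  (S : R -> B -> B) (S1 : R -> B1 -> B1) (R01 : R -> B -> B1)
  (M1 m1 kappa omega : R) :
  0 <= M1 -> 0 <= m1 -> 0 < kappa -> 0 < omega < 1 ->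
  dense_embedding i1 -> C0_semigroup S -> C0_semigroup S1 ->
  (forall t, 0 <= t -> forall x, i1 (S1 t x) = S t (i1 x)) ->
  (forall t, 0 <= t -> Rbar_le (op_norm (S1 t)) (M1 * exp (m1 * t))) ->
  (forall t, 0 < t -> forall x, i1 (R01 t x) = S t x) ->
  (forall t, 0 < t <= 1 -> Rbar_le (op_norm (R01 t)) (kappa * Rpower t (- omega))) ->
  smoothing_semigroup S1 R01 M1 m1 (kappa * (1 + M1)) (m1 + 1) omega.
Proof.
move=> hM1 hm1 hk ho hi hS hS1 hSS1 hS1n hR hRn.
have il := emb_linear hi.
have hb t x : 0 <= t -> norm (S1 t x) <= M1 * exp (m1 * t) * norm x.
  move=> ht; apply: op_norm_bound; last exact: hS1n.
  exact: (linear_scal _ (sg_linear hS1 ht)).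
have hc := semigroup_continuous hS1 hM1 hm1 hb.
have rs t k x : 0 < t -> R01 t (scal k x) = scal k (R01 t x).
  move=> ht; apply: (emb_inj hi).
  rewrite hR // (linear_scal _ il) hR //.
  by apply: (linear_scal _ (sg_linear hS _)); lra.
have radd s t x : 0 <= s -> 0 < t -> R01 (s + t) x = S1 s (R01 t x).
  move=> hs ht; apply: (emb_inj hi).
  by rewrite hR ?hSS1 ?hR // ?(sg_add hS) //; lra.
have rb1 t x : 0 < t <= 1 -> norm (R01 t x) <= kappa * Rpower t (- omega) * norm x.
  by move=> ht; apply: op_norm_bound; [move=> k y; apply: rs; lra|exact: hRn].
split=> //.
- move=> t ht; exact: sg_linear.
- move=> t x y ht; apply: (emb_inj hi).
  rewrite hR // (linear_plus _ il) !hR //.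
  by apply: (linear_plus _ (sg_linear hS _)); lra.
- move=> t x ht; have hx := norm_ge_0 x.
  case: (Rle_dec t 1) => h1.
    apply: Rle_trans (rb1 _ _ _) _; first lra.
    apply: Rmult_le_compat_r => //.
    rewrite -(Rmult_1_r (kappa * Rpower t (- omega))).
    have -> : kappa * (1 + M1) * Rpower t (- omega) * exp ((m1 + 1) * t) =
      kappa * Rpower t (- omega) * ((1 + M1) * exp ((m1 + 1) * t)) by ring.
    apply: Rmult_le_compat_l; first by apply: Rmult_le_pos; [lra|left; exact: Rpower_pos].
    have he : 1 <= exp ((m1 + 1) * t).
      by apply: exp_ge1; apply: Rmult_le_pos; lra.
    nra.
  have -> : R01 t x = S1 (t - 1) (R01 1 x) by rewrite -radd; [congr R01; ring|lra|lra].
  have ht1 : 0 <= t - 1 by lra.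
  have h01 : 0 < 1 <= 1 by lra.
  apply: Rle_trans (hb _ _ ht1) _.
  have h2 : norm (R01 1 x) <= kappa * norm x.
    by have := rb1 1 x h01; rewrite /Rpower ln_1 Rmult_0_r exp_0 Rmult_1_r.
  have h3 : 1 <= Rpower t (- omega) * exp t.
    have -> : Rpower t (- omega) * exp t = exp (t - omega * ln t).
      by rewrite /Rpower -exp_plus; congr exp; ring.
    apply: exp_ge1.
    have hln : ln t <= t.
      apply: Rle_trans (_ : ln t <= ln (exp t)) _; last by rewrite ln_exp; lra.
      by apply: ln_le => //; have := exp_ineq1_le t; lra.
    have hln0 : 0 <= ln t by rewrite -ln_1; apply: ln_le; lra.
    nra.
  have h4 : exp (m1 * (t - 1)) <= exp (m1 * t).
    by apply: exp_le; apply: Rmult_le_compat_l; lra.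
  have e1 : exp ((m1 + 1) * t) = exp (m1 * t) * exp t by rewrite -exp_plus; congr exp; ring.
  have p1 := exp_pos (m1 * (t - 1)); have p2 := exp_pos (m1 * t).
  have p3 : 0 <= kappa * norm x by apply: Rmult_le_pos; lra.
  apply: Rle_trans (_ : _ <= M1 * exp (m1 * t) * (kappa * norm x)) _.
    apply: Rmult_le_compat => //; first by apply: Rmult_le_pos; lra.
      exact: norm_ge_0.
    by apply: Rmult_le_compat_l.
  rewrite e1.
  have -> : kappa * (1 + M1) * Rpower t (- omega) * (exp (m1 * t) * exp t) * norm x =
    (1 + M1) * exp (m1 * t) * (kappa * norm x) * (Rpower t (- omega) * exp t) by ring.
  have h5 : 0 <= exp (m1 * t) * (kappa * norm x) by apply: Rmult_le_pos; lra.
  have h6 : (1 + M1) * exp (m1 * t) * (kappa * norm x) * 1 <=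
    (1 + M1) * exp (m1 * t) * (kappa * norm x) * (Rpower t (- omega) * exp t).
    apply: Rmult_le_compat_l => //; rewrite Rmult_assoc; apply: Rmult_le_pos; lra.
  rewrite Rmult_assoc in h6 *; lra.
(* Near [q] the orbit factors through the fixed vector [R01 (q / 2) x] of [B1], on which [S1] is
   strongly continuous. *)
- move=> x q hq.
  have hq2 : 0 < q / 2 by lra.
  apply: (continuous_ext_loc _ (fun q' => S1 (Rmax 0 (q' - q / 2)) (R01 (q / 2) x))).
    apply: (locally_Rabs hq2) => y hy; have [h1 h2] := Rabs_def2 _ _ hy.
    rewrite -radd ?Rmax_right; try lra; congr R01; ring.
  apply: (continuous_comp (fun q' => q' - q / 2) (fun r => S1 (Rmax 0 r) (R01 (q / 2) x))).
    by apply: (ex_derive_continuous (V := R_NormedModule)); auto_derive.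
  exact: hc.
Qed.

(** * Mittag-Leffler operators *)

(** On a compact range of [x] uniform convergence follows from uniform continuity of [phi] on
    [[q1, q2]]; domination handles the rest. The last hypothesis is phrased through [q1] and [q2] so
    as to cover both the orbit in [B1], continuous on the line, and [R01], continuous only on the
    open half line. *)
Lemma continuous_weighted_integral {V : Banach} (wt : R -> R) (phi : R -> V)
  (tau0 delta c : R) : 0 < delta ->
  (forall x, 0 < x -> continuous wt x) ->
  (forall tau, Rabs (tau - tau0) < delta -> forall x, 0 < x ->
     continuous phi (tau * x)) ->
  (forall tau, Rabs (tau - tau0) < delta -> forall x, 0 < x ->
     norm (scal (wt x) (phi (tau * x))) <= c * / (1 + x) ^ 2) ->
  (forall x1 x2, 0 < x1 <= x2 -> exists q1 q2,
     (forall q, q1 <= q <= q2 -> continuous phi q) /\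
     forall tau, Rabs (tau - tau0) < delta -> forall x, x1 <= x <= x2 ->
       q1 <= tau * x <= q2) ->
  continuous (fun tau => RInt_gen (fun x => scal (wt x) (phi (tau * x)))
    (at_right 0) (Rbar_locally p_infty)) tau0.
Proof.
move=> hd cw cphi hb hq.
have h0 : Rabs (tau0 - tau0) < delta by rewrite Rminus_diag Rabs_R0.
have cf tau : Rabs (tau - tau0) < delta -> forall x, 0 < x ->
    continuous (fun x => scal (wt x) (phi (tau * x))) x.
  move=> ht x hx; apply: continuous_scal; first exact: cw.
  apply: (continuous_comp (fun x => tau * x) phi); last exact: cphi.
  by apply: (ex_derive_continuous (V := R_NormedModule)); auto_derive.
apply: (filterlim_RInt_gen_majorant (F := locally tau0) majorant_rational (c := c)).
- by apply: (locally_Rabs hd) => tau /cf.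
- by apply: (locally_Rabs hd) => tau /hb.
- exact: cf.
- exact: hb.
move=> x y eps hx hy heps.
case: (Rle_dec x y) => hxy; last first.
  by apply: filter_forall => tau z hz; lra.
have [q1 [q2 [cq hq12]]] := hq _ _ (conj hx hxy).
have [W hW] := bounded_continuity (V := R_NormedModule) wt x y
  (fun z hz => cw z (Rlt_le_trans _ _ _ hx (proj1 hz))).
have hW0 : 0 < W.
  have := hW x (conj (Rle_refl x) hxy); have := Rabs_pos (wt x); rewrite /norm /= /abs /=; lra.
have he : 0 < eps / W by apply: Rdiv_lt_0_compat.
have [d hdu] := unifcont_normed_1d phi q1 q2 cq (mkposreal _ he).
have hd2 : 0 < Rmin delta (d / y).
  by apply: Rmin_glb_lt => //; apply: Rdiv_lt_0_compat => //; exact: cond_pos.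
apply: (locally_Rabs hd2) => tau ht z hz.
have ht1 : Rabs (tau - tau0) < delta by have := Rmin_l delta (d / y); lra.
have ht2 : Rabs (tau - tau0) < d / y by have := Rmin_r delta (d / y); lra.
have hz0 : 0 < z by lra.
have hball : norm (minus (phi (tau * z)) (phi (tau0 * z))) < eps / W.
  apply: (hdu (tau0 * z) (tau * z)); [exact: hq12|exact: hq12|].
  rewrite /ball /= /AbsRing_ball /abs /minus /plus /opp /=.
  have -> : tau * z + - (tau0 * z) = (tau - tau0) * z by ring.
  rewrite Rabs_mult (Rabs_pos_eq z); last lra.
  apply: Rle_lt_trans (_ : _ <= Rabs (tau - tau0) * y) _.
    by apply: Rmult_le_compat_l; [exact: Rabs_pos|lra].
  have -> : pos d = d / y * y by field; lra.
  by apply: Rmult_lt_compat_r.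
rewrite -scal_minus_distr_l; apply: Rle_trans (norm_scal_le _ _) _.
have hWz : Rabs (wt z) < W := hW z hz.
have -> : eps = W * (eps / W) by field; lra.
by apply: Rmult_le_compat; [exact: Rabs_pos|exact: norm_ge_0|exact: Rlt_le|exact: Rlt_le].
Qed.

Section MittagLefflerOperators.
Variable beta : R.
Hypothesis hbeta : 0 < beta < 1.

(** Decay at rate [mu + 1] cancels [e^(mu x)] and leaves [e^(-x)] for the rational majorant. *)
Lemma mittag_weight_dom (mu : R) : 0 <= mu -> exists C, 0 < C /\ forall x, 0 < x ->
  Rabs (mittag_weight beta x) * exp (mu * x) <= C * / (1 + x) ^ 2.
Proof.
move=> hmu; have hmu1 : 0 < mu + 1 by lra.
have [C1 [hC1 H1]] := mittag_weight_bound hbeta hmu1.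
have [C2 [hC2 H2]] := exp_le_rational 0 Rlt_0_1 Rlt_0_1.
exists (C1 * C2); split; first by apply: Rmult_lt_0_compat.
move=> x hx; have hE := exp_pos (mu * x).
apply: Rle_trans (Rmult_le_compat_r _ _ _ (Rlt_le _ _ hE) (H1 x hx)) _.
rewrite !Rmult_assoc; apply: Rmult_le_compat_l; first lra.
apply: Rle_trans (H2 x hx); rewrite Rpower_1 //= -exp_plus Rmult_1_l; right; congr exp; ring.
Qed.

(** The extra factor [x] in [mittag_weight'] compensates the singularity:
    [x * x^(-omega) <= 1 + x]. *)
Lemma mittag_weight'_dom (mu omega : R) : 0 <= mu -> 0 < omega < 1 ->
  exists C, 0 < C /\ forall x, 0 < x ->
  Rabs (mittag_weight' beta x) * Rpower x (- omega) * exp (mu * x) <= C * / (1 + x) ^ 2.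
Proof.
move=> hmu ho; have hmu1 : 0 < mu + 1 by lra.
have [C1 [hC1 H1]] := mittag_weight_bound hbeta hmu1.
have [C2 [hC2 H2]] := exp_le_rational 1 Rlt_0_1 Rlt_0_1.
exists (C1 * C2); split; first by apply: Rmult_lt_0_compat.
move=> x hx; have hE := exp_pos (mu * x); have hR := Rpower_pos x (- omega).
rewrite mittag_weight'E // Rabs_mult (Rabs_pos_eq x); last lra.
have hxo : x * Rpower x (- omega) <= 1 + x.
  have -> : x * Rpower x (- omega) = Rpower x (1 - omega).
    by rewrite /Rminus Rpower_plus Rpower_1.
  case: (Rle_dec 1 x) => h1.
    apply: Rle_trans (_ : Rpower x 1 <= _); first by apply: Rle_Rpower; lra.
    by rewrite Rpower_1 //; lra.
  apply: Rle_trans (_ : Rpower 1 (1 - omega) <= _); first by apply: Rle_Rpower_l; lra.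
  by rewrite /Rpower ln_1 Rmult_0_r exp_0; lra.
have -> : x * Rabs (mittag_weight beta x) * Rpower x (- omega) * exp (mu * x) =
  Rabs (mittag_weight beta x) * (x * Rpower x (- omega) * exp (mu * x)) by ring.
have h0 : 0 <= x * Rpower x (- omega) * exp (mu * x).
  by apply: Rmult_le_pos; [apply: Rmult_le_pos|]; lra.
apply: Rle_trans (Rmult_le_compat_r _ _ _ h0 (H1 x hx)) _.
rewrite !Rmult_assoc; apply: Rmult_le_compat_l; first lra.
apply: Rle_trans (H2 x hx); rewrite Rpower_1 // pow_1.
have -> : exp (- ((mu + 1) * x)) * (x * (Rpower x (- omega) * exp (mu * x))) =
  x * Rpower x (- omega) * (exp (- ((mu + 1) * x)) * exp (mu * x)) by ring.
rewrite -exp_plus.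
have -> : - ((mu + 1) * x) + mu * x = - (1 * x) by ring.
by apply: Rmult_le_compat_r => //; left; exact: exp_pos.
Qed.

Variables M1 m1 C0 mu omega : R.
Hypotheses (hM1 : 0 <= M1) (hm1 : 0 <= m1) (hC0 : 0 <= C0) (hmu : 0 <= mu)
  (homega : 0 < omega < 1).

Let E_int {B1 : Banach} (S1 : R -> B1 -> B1) (tau : R) (Y : B1) (x : R) : B1 :=
  scal (mittag_weight beta x) (S1 (Rmax 0 (tau * x)) Y).

(** For [tau <= X] the growth of the orbit is at most [e^(m1 X x)], one integrable function for all
    such [tau]. [Rmax 0] extends the operator to negative [tau], so that continuity at 0 is
    two-sided. *)
Lemma E_op_facts (X : R) : 0 <= X -> exists C, 0 <= C /\
  forall (B1 B : Banach) (S1 : R -> B1 -> B1) (R01 : R -> B -> B1),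
  smoothing_semigroup S1 R01 M1 m1 C0 mu omega ->
  (forall tau Y, 0 <= tau <= X -> norm (E_op beta S1 tau Y) <= C * norm Y) /\
  (forall tau Y Y', 0 <= tau <= X -> E_op beta S1 tau (minus Y Y') =
     minus (E_op beta S1 tau Y) (E_op beta S1 tau Y')) /\
  (forall tau Y, tau < X -> continuous (fun t => E_op beta S1 (Rmax 0 t) Y) tau).
Proof.
move=> hX; have hmX : 0 <= m1 * X by apply: Rmult_le_pos.
have [C [hC H]] := mittag_weight_dom hmX.
exists (/ beta * (C * M1)); split.
  apply: Rmult_le_pos; first by left; apply: Rinv_0_lt_compat; lra.
  by apply: Rmult_le_pos; lra.
move=> B1 B S1 R01 hS.
have hib : 0 < / beta by apply: Rinv_0_lt_compat; lra.
have bound tau Y x : tau <= X -> 0 < x ->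
    norm (E_int S1 tau Y x) <= C * M1 * norm Y * / (1 + x) ^ 2.
  move=> ht hx; rewrite /E_int; apply: Rle_trans (norm_scal_le _ _) _.
  have hY := norm_ge_0 Y.
  apply: Rle_trans (_ : _ <= Rabs (mittag_weight beta x) * (M1 * exp (m1 * X * x) * norm Y)) _.
    apply: Rmult_le_compat_l; first exact: Rabs_pos.
    apply: Rle_trans (ss_bound hS _ (Rmax_l _ _)) _.
    apply: Rmult_le_compat_r => //; apply: Rmult_le_compat_l => //.
    apply: exp_le; rewrite Rmult_assoc; apply: Rmult_le_compat_l => //.
    apply: Rmax_lub; first by apply: Rmult_le_pos; lra.
    by apply: Rmult_le_compat_r; lra.
  have -> : Rabs (mittag_weight beta x) * (M1 * exp (m1 * X * x) * norm Y) =
    M1 * norm Y * (Rabs (mittag_weight beta x) * exp (m1 * X * x)) by ring.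
  have -> : C * M1 * norm Y * / (1 + x) ^ 2 = M1 * norm Y * (C * / (1 + x) ^ 2) by ring.
  by apply: Rmult_le_compat_l (H x hx); apply: Rmult_le_pos.
have cphi Y q : continuous (fun q => S1 (Rmax 0 q) Y) q by exact: (ss_cont hS).
have cw x : 0 < x -> continuous (mittag_weight beta) x by exact: continuous_mittag_weight.
have cE tau Y x : 0 < x -> continuous (E_int S1 tau Y) x.
  move=> hx; apply: continuous_scal; first exact: cw.
  apply: (continuous_comp (fun x => tau * x) (fun q => S1 (Rmax 0 q) Y)); last exact: cphi.
  by apply: (ex_derive_continuous (V := R_NormedModule)); auto_derive.
have isI tau Y : tau <= X -> is_RInt_gen (E_int S1 tau Y) (at_right 0) (Rbar_locally p_infty)
    (RInt_gen (E_int S1 tau Y) (at_right 0) (Rbar_locally p_infty)) /\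
    norm (RInt_gen (E_int S1 tau Y) (at_right 0) (Rbar_locally p_infty))
     <= Rabs (C * M1 * norm Y * (0 - -1)).
  move=> ht; apply: (RInt_gen_majorant majorant_rational).
  - exact: cE.
  - by move=> x; apply: bound.
have E_opE tau Y : tau <= X -> E_op beta S1 (Rmax 0 tau) Y =
    scal (/ beta) (RInt_gen (E_int S1 tau Y) (at_right 0) (Rbar_locally p_infty)).
  move=> ht; rewrite /E_op; congr scal.
  apply: (RInt_gen_ext_on majorant_rational _ (proj1 (isI tau Y ht))) => x hx.
  rewrite /E_int; congr scal; congr S1.
  rewrite /Rmax; case: Rle_dec => h1; case: Rle_dec => h2 //; try nra.
have max0 tau : 0 <= tau -> Rmax 0 tau = tau by exact: Rmax_right.
split; [|split].
- move=> tau Y [ht0 ht]; rewrite -(max0 _ ht0) E_opE //.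
  apply: Rle_trans (norm_scal_le _ _) _.
  rewrite Rabs_pos_eq ?Rmult_assoc; last lra; apply: Rmult_le_compat_l; first lra.
  apply: Rle_trans (proj2 (isI tau Y ht)) _.
  rewrite Rabs_pos_eq; first lra.
  have := Rmult_le_pos _ _ (Rmult_le_pos _ _ (Rlt_le _ _ hC) hM1) (norm_ge_0 Y); lra.
- move=> tau Y Y' [ht0 ht]; rewrite -(max0 _ ht0) !E_opE // -scal_minus_distr_l.
  congr scal.
  apply: (RInt_gen_ext_on majorant_rational (f := fun x => minus (E_int S1 tau Y x) (E_int S1 tau Y' x))).
    move=> x hx; rewrite /E_int -scal_minus_distr_l; congr scal.
    by rewrite (linear_minus _ _ _ (ss_linear hS (Rmax_l _ _))).
  by apply: is_RInt_gen_minus; [exact: (proj1 (isI tau Y ht))|exact: (proj1 (isI tau Y' ht))].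
- move=> tau Y ht.
  have hd : 0 < X - tau by lra.
  apply: (continuous_ext_loc _ (fun t => scal (/ beta)
     (RInt_gen (E_int S1 t Y) (at_right 0) (Rbar_locally p_infty)))).
    apply: (locally_Rabs hd) => t /Rabs_def2 h; rewrite E_opE //; lra.
  apply: continuous_scal_r.
  apply: (@continuous_weighted_integral _ _ (fun q => S1 (Rmax 0 q) Y) _ _
    (C * M1 * norm Y) hd cw).
  + by move=> *; exact: cphi.
  + by move=> t /Rabs_def2 h x hx; apply: bound; lra.
  + move=> x1 x2 hx; exists (- ((Rabs tau + (X - tau)) * x2)), ((Rabs tau + (X - tau)) * x2).
    split=> [q _|t h x hx']; first exact: cphi.
    apply/Rabs_le_between; rewrite Rabs_mult.
    apply: Rmult_le_compat; try exact: Rabs_pos.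
      by have := Rabs_triang_inv t tau; lra.
    by rewrite Rabs_pos_eq; lra.
Qed.

(** Splitting [(tau x)^(-omega)] lets [tau^(-omega)] out of the integral, while [x^(-omega)] stays
    integrable against the weight. *)
Lemma E'_op_facts (X : R) : 0 <= X -> exists C, 0 <= C /\
  forall (B1 B : Banach) (S1 : R -> B1 -> B1) (R01 : R -> B -> B1),
  smoothing_semigroup S1 R01 M1 m1 C0 mu omega ->
  (forall tau v, 0 < tau <= X ->
     norm (E'_op beta R01 tau v) <= C * Rpower tau (- omega) * norm v) /\
  (forall tau v v', 0 < tau <= X -> E'_op beta R01 tau (minus v v') =
     minus (E'_op beta R01 tau v) (E'_op beta R01 tau v')) /\
  (forall tau v, 0 < tau < X -> continuous (fun t => E'_op beta R01 t v) tau).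
Proof.
move=> hX; have hmX : 0 <= mu * X by apply: Rmult_le_pos.
have [C [hC H]] := mittag_weight'_dom hmX homega.
exists (/ beta * (C * C0)); split.
  apply: Rmult_le_pos; first by left; apply: Rinv_0_lt_compat; lra.
  by apply: Rmult_le_pos; lra.
move=> B1 B S1 R01 hS.
have hib : 0 < / beta by apply: Rinv_0_lt_compat; lra.
pose I tau v x : B1 := scal (mittag_weight' beta x) (R01 (tau * x) v).
have bound tau v x : 0 < tau <= X -> 0 < x ->
    norm (I tau v x) <= C * C0 * Rpower tau (- omega) * norm v * / (1 + x) ^ 2.
  move=> ht hx; rewrite /I; apply: Rle_trans (norm_scal_le _ _) _.
  have hv := norm_ge_0 v; have hR := Rpower_pos tau (- omega).
  have hRx := Rpower_pos x (- omega).
  have htx : 0 < tau * x by apply: Rmult_lt_0_compat; lra.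
  apply: Rle_trans (_ : _ <= Rabs (mittag_weight' beta x) *
     (C0 * (Rpower tau (- omega) * Rpower x (- omega)) * exp (mu * X * x) * norm v)) _.
    apply: Rmult_le_compat_l; first exact: Rabs_pos.
    apply: Rle_trans (ss_bound01 hS _ htx) _.
    apply: Rmult_le_compat_r => //; rewrite Rpower_mult_distr //; last lra.
    apply: Rmult_le_compat_l; first by apply: Rmult_le_pos => //; left; exact: Rpower_pos.
    apply: exp_le; rewrite Rmult_assoc; apply: Rmult_le_compat_l => //.
    by apply: Rmult_le_compat_r; lra.
  have -> : Rabs (mittag_weight' beta x) *
     (C0 * (Rpower tau (- omega) * Rpower x (- omega)) * exp (mu * X * x) * norm v) =
    C0 * Rpower tau (- omega) * norm v *
     (Rabs (mittag_weight' beta x) * Rpower x (- omega) * exp (mu * X * x)) by ring.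
  have -> : C * C0 * Rpower tau (- omega) * norm v * / (1 + x) ^ 2 =
    C0 * Rpower tau (- omega) * norm v * (C * / (1 + x) ^ 2) by ring.
  by apply: Rmult_le_compat_l (H x hx); apply: Rmult_le_pos => //; apply: Rmult_le_pos; lra.
have cphi v q : 0 < q -> continuous (fun q => R01 q v) q by exact: (ss_cont01 hS).
have cw x : 0 < x -> continuous (mittag_weight' beta) x by exact: continuous_mittag_weight'.
have cI tau v x : 0 < tau -> 0 < x -> continuous (I tau v) x.
  move=> ht hx; apply: continuous_scal; first exact: cw.
  apply: (continuous_comp (fun x => tau * x) (fun q => R01 q v)).
    by apply: (ex_derive_continuous (V := R_NormedModule)); auto_derive.
  by apply: cphi; apply: Rmult_lt_0_compat.
have isI tau v : 0 < tau <= X -> is_RInt_gen (I tau v) (at_right 0) (Rbar_locally p_infty)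
    (RInt_gen (I tau v) (at_right 0) (Rbar_locally p_infty)) /\
    norm (RInt_gen (I tau v) (at_right 0) (Rbar_locally p_infty))
     <= Rabs (C * C0 * Rpower tau (- omega) * norm v * (0 - -1)).
  move=> ht; apply: (RInt_gen_majorant majorant_rational).
  - by move=> x; apply: cI; lra.
  - by move=> x; apply: bound.
have E_opE tau v : E'_op beta R01 tau v =
    scal (/ beta) (RInt_gen (I tau v) (at_right 0) (Rbar_locally p_infty)) by [].
split; [|split].
- move=> tau v ht; rewrite E_opE; apply: Rle_trans (norm_scal_le _ _) _.
  rewrite Rabs_pos_eq ?Rmult_assoc; last lra; apply: Rmult_le_compat_l; first lra.
  apply: Rle_trans (proj2 (isI tau v ht)) _.
  rewrite Rabs_pos_eq; first lra.
  have := Rmult_le_pos _ _ (Rmult_le_pos _ _ (Rmult_le_pos _ _ (Rlt_le _ _ hC) hC0)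
     (Rlt_le _ _ (Rpower_pos tau (- omega)))) (norm_ge_0 v); lra.
- move=> tau v v' ht; rewrite !E_opE // -scal_minus_distr_l.
  congr scal.
  apply: (RInt_gen_ext_on majorant_rational (f := fun x => minus (I tau v x) (I tau v' x))).
    move=> x hx; rewrite /I -scal_minus_distr_l; congr scal.
    have htx : 0 < tau * x by apply: Rmult_lt_0_compat; lra.
    have := ss_plus hS v (opp v') htx; rewrite -/(minus _ _) => ->.
    by rewrite -(scal_opp_one v') (ss_scal hS _ _ htx) scal_opp_one.
  by apply: is_RInt_gen_minus; [exact: (proj1 (isI tau v ht))|exact: (proj1 (isI tau v' ht))].
- move=> tau v ht.
  (* Keeping [t] above [tau / 2] replaces [t^(-omega)] by a constant in the domination. *)
  set d := Rmin (tau / 2) (X - tau).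
  have hd : 0 < d by apply: Rmin_glb_lt; lra.
  have hd1 : d <= tau / 2 by exact: Rmin_l.
  have hd2 : d <= X - tau by exact: Rmin_r.
  have ho := Rpower_pos.
  apply: (@continuous_scal_r R_UniformSpace).
  apply: (@continuous_weighted_integral _ _ (fun q => R01 q v) _ _
    (C * C0 * Rpower (tau / 2) (- omega) * norm v) hd cw).
  + move=> t /Rabs_def2 h x hx; apply: cphi; apply: Rmult_lt_0_compat; lra.
  + move=> t /Rabs_def2 h x hx; apply: Rle_trans (bound t v x _ hx) _; first lra.
    apply: Rmult_le_compat_r.
      by left; apply: Rinv_0_lt_compat; apply: pow_lt; lra.
    apply: Rmult_le_compat_r; first exact: norm_ge_0.
    apply: Rmult_le_compat_l; first by apply: Rmult_le_pos; lra.
    rewrite !Rpower_Ropp; apply: Rinv_le_contravar => //.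
    by apply: Rle_Rpower_l; lra.
  + move=> x1 x2 hx; exists (tau / 2 * x1), (X * x2).
    split=> [q hq|t /Rabs_def2 h x hx'].
      apply: cphi; have : 0 < tau / 2 * x1 by apply: Rmult_lt_0_compat; lra.
      lra.
    by split; apply: Rmult_le_compat; lra.
Qed.

End MittagLefflerOperators.

(** * Volterra operators with a weakly singular kernel *)

Record singular_kernel (B1 B : Banach) (K : R -> B -> B1) (gamma X C : R) : Prop := {
  sk_minus : forall r v v', 0 < r < X -> K r (minus v v') = minus (K r v) (K r v');
  sk_cont : forall r v, 0 < r < X -> continuous (fun r => K r v) r;
  sk_bound : forall r v, 0 < r < X -> norm (K r v) <= C * Rpower r (gamma - 1) * norm v }.

(** In the variable [r = t - s] the singularity sits at 0 whatever [t] is, so one majorant serves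
    all [t]. The value for [t <= a] makes this a continuous function on the line. *)
Definition volterra {B1 B : Banach} (K : R -> B -> B1) (a : R) (h : R -> B) (t : R) : B1 :=
  if Rlt_dec a t then
    RInt_gen (fun r => K r (h (t - r))) (at_right 0) (at_point (t - a))
  else zero.

Lemma volterra_gt {B1 B : Banach} (K : R -> B -> B1) a (h : R -> B) t : a < t ->
  volterra K a h t = RInt_gen (fun r => K r (h (t - r))) (at_right 0) (at_point (t - a)).
Proof. by rewrite /volterra; case: Rlt_dec. Qed.

Lemma volterra_le {B1 B : Banach} (K : R -> B -> B1) a (h : R -> B) t : t <= a ->
  volterra K a h t = zero.
Proof. by rewrite /volterra; case: Rlt_dec => // h1 h2; lra. Qed.

Section Kernel.
Context {B1 B : Banach}.
Variables (K : R -> B -> B1) (gamma X C : R).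
Hypotheses (hK : singular_kernel K gamma X C) (hg : 0 < gamma) (hC : 0 <= C).

(** Only strong continuity of [K] is at hand; together with a bound on [K r'] that is uniform for
    [r'] near [r] it allows the argument of [K] to move as well. *)
Lemma continuous_kernel_comp (h : R -> B) (t r : R) : 0 < r < X ->
  (forall s, continuous h s) -> continuous (fun r => K r (h (t - r))) r.
Proof.
move=> hr ch.
have ch' : continuous (fun r => h (t - r)) r.
  apply: (continuous_comp (fun r => t - r) h); last exact: ch.
  by apply: (ex_derive_continuous (V := R_NormedModule)); auto_derive.
apply/(continuousP (U := R_UniformSpace)) => eps heps.
(* The sum of the powers at [r / 2] and [2 r] bounds [r'^(gamma - 1)] whether this power decreases
   or increases. *)
pose c1 := C * (Rpower (r / 2) (gamma - 1) + Rpower (r + r) (gamma - 1)) + 1.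
have hc1 : 0 < c1.
  have := Rmult_le_pos C (Rpower (r / 2) (gamma - 1) + Rpower (r + r) (gamma - 1)) hC.
  have := Rpower_pos (r / 2) (gamma - 1); have := Rpower_pos (r + r) (gamma - 1).
  rewrite /c1; lra.
have he2 : 0 < eps / 2 by lra.
have hec : 0 < eps / 2 / c1 by apply: Rdiv_lt_0_compat.
have h1 := proj1 (continuousP _ _) (@sk_cont _ _ _ _ _ _ hK r (h (t - r)) hr) _ he2.
have h2 := proj1 (continuousP _ _) ch' _ hec.
pose d := Rmin (r / 2) (X - r).
have hd : 0 < d by apply: Rmin_glb_lt; lra.
have h3 : locally r (fun r' => Rabs (r' - r) < d) by apply: (locally_Rabs hd).
apply: filter_imp (filter_and _ _ (filter_and _ _ h1 h2) h3) => r' [[k1 k2]].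
move=> /Rabs_def2 k3.
have d1 := Rmin_l (r / 2) (X - r); have d2 := Rmin_r (r / 2) (X - r).
rewrite -/d in d1 d2.
have hr' : 0 < r' < X by lra.
apply: Rle_lt_trans (norm_minus_trans _ (K r' (h (t - r))) _) _.
rewrite -(sk_minus hK) //.
have k4 := sk_bound hK (minus (h (t - r')) (h (t - r))) hr'.
have k5 : C * Rpower r' (gamma - 1) <= c1.
  rewrite /c1.
  have p1 := Rpower_pos (r / 2) (gamma - 1); have p2 := Rpower_pos (r + r) (gamma - 1).
  have : Rpower r' (gamma - 1) <= Rpower (r / 2) (gamma - 1) + Rpower (r + r) (gamma - 1).
    case: (Rle_dec 1 gamma) => hg1.
      have : Rpower r' (gamma - 1) <= Rpower (r + r) (gamma - 1) by apply: Rle_Rpower_l; lra.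
      lra.
    have e q : Rpower q (gamma - 1) = / Rpower q (1 - gamma).
      by rewrite -Rpower_Ropp; congr Rpower; ring.
    have : Rpower r' (gamma - 1) <= Rpower (r / 2) (gamma - 1).
      rewrite !e; apply: Rinv_le_contravar; first exact: Rpower_pos.
      by apply: Rle_Rpower_l; lra.
    lra.
  move=> /(Rmult_le_compat_l _ _ _ hC); lra.
have k6 : C * Rpower r' (gamma - 1) * norm (minus (h (t - r')) (h (t - r))) <=
    c1 * norm (minus (h (t - r')) (h (t - r))).
  by apply: Rmult_le_compat_r => //; exact: norm_ge_0.
have k7 : c1 * norm (minus (h (t - r')) (h (t - r))) <= c1 * (eps / 2 / c1).
  by apply: Rmult_le_compat_l; [lra|exact: Rlt_le].
have e : c1 * (eps / 2 / c1) = eps / 2 by field; lra.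
lra.
Qed.

(** The exponent [g0] is free because the plain estimate takes [gamma] and the weighted one
    [gamma / 2]. *)
Lemma volterra_tail (h : R -> B) (t u c g0 : R) : 0 < g0 -> 0 < u < X ->
  (forall s, continuous h s) ->
  (forall r, 0 < r <= u -> norm (K r (h (t - r))) <= c * Rpower r (g0 - 1)) ->
  is_RInt_gen (fun r => K r (h (t - r))) (at_right 0) (at_point u)
    (RInt_gen (fun r => K r (h (t - r))) (at_right 0) (at_point u)) /\
  norm (RInt_gen (fun r => K r (h (t - r))) (at_right 0) (at_point u)) <=
    Rabs (c * (Rpower u g0 / g0)).
Proof.
move=> hg0 hu ch hb.
have := RInt_gen_majorant (majorant_power hg0 (proj1 hu)) (f := fun r => K r (h (t - r)))
  (c := c); rewrite Rminus_0_r; apply=> // r hr.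
by apply: continuous_kernel_comp => //; lra.
Qed.

Lemma volterra_plain (h : R -> B) (t u N : R) : 0 < u < X ->
  (forall s, continuous h s) -> 0 <= N ->
  (forall r, 0 < r <= u -> norm (h (t - r)) <= N) ->
  is_RInt_gen (fun r => K r (h (t - r))) (at_right 0) (at_point u)
    (RInt_gen (fun r => K r (h (t - r))) (at_right 0) (at_point u)) /\
  norm (RInt_gen (fun r => K r (h (t - r))) (at_right 0) (at_point u)) <=
    C * N * (Rpower u gamma / gamma).
Proof.
move=> hu ch hN hb.
have hr : 0 <= Rpower u gamma / gamma.
  by left; apply: Rdiv_lt_0_compat => //; exact: Rpower_pos.
rewrite -(Rabs_pos_eq (C * N * (Rpower u gamma / gamma))); last first.
  by apply: Rmult_le_pos => //; apply: Rmult_le_pos.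
apply: volterra_tail => // r hru.
apply: Rle_trans (sk_bound hK _ _) _; first lra.
have -> : C * N * Rpower r (gamma - 1) = C * Rpower r (gamma - 1) * N by ring.
apply: Rmult_le_compat_l; last exact: hb.
by apply: Rmult_le_pos => //; left; exact: Rpower_pos.
Qed.

Lemma bounded_on (h : R -> B) (p q : R) : (forall s, continuous h s) ->
  exists N, 0 <= N /\ forall s, p <= s <= q -> norm (h s) <= N.
Proof.
move=> ch; have [N hN] := bounded_continuity h p q (fun s _ => ch s).
exists (Rabs N); split=> [|s hs]; first exact: Rabs_pos.
have := hN s hs; have := Rle_abs N; lra.
Qed.

Lemma volterra_correct (a : R) (h : R -> B) (t : R) : a < t < a + X ->
  (forall s, continuous h s) ->
  is_RInt_gen (fun r => K r (h (t - r))) (at_right 0) (at_point (t - a)) (volterra K a h t).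
Proof.
move=> ht ch; have hat : a < t by lra.
rewrite volterra_gt //.
have [N [hN H]] := bounded_on a t ch.
have hu : 0 < t - a < X by lra.
by apply: (proj1 (volterra_plain hu ch hN _)) => r hr; apply: H; lra.
Qed.

Lemma volterra_minus (a : R) (h h' : R -> B) (t : R) : t < a + X ->
  (forall s, continuous h s) -> (forall s, continuous h' s) ->
  volterra K a (fun s => minus (h s) (h' s)) t =
  minus (volterra K a h t) (volterra K a h' t).
Proof.
move=> ht ch ch'.
case: (Rlt_dec a t) => hat; last first.
  by rewrite !volterra_le ?minus_eq_zero //; lra.
have i1 := volterra_correct (conj hat ht) ch.
have i2 := volterra_correct (conj hat ht) ch'.
have hu : 0 < t - a by lra.
rewrite volterra_gt //.
apply: (RInt_gen_ext_on (majorant_power hg hu)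
  (f := fun r => minus (K r (h (t - r))) (K r (h' (t - r))))).
  by move=> r hr; rewrite (sk_minus hK) //; lra.
exact: is_RInt_gen_minus.
Qed.

(* With an exponential weight the kernel gains the factor [lam^(-gamma/2)],
   because [r^(gamma/2) e^(-lam r) <= lam^(-gamma/2)]. *)
Lemma volterra_weighted (a lam N : R) (h : R -> B) (t : R) :
  0 < lam -> 0 <= N -> gamma <= 2 -> a <= t < a + X -> (forall s, continuous h s) ->
  (forall s, a <= s <= t -> norm (h s) <= N * exp (lam * (s - a))) ->
  norm (volterra K a h t) <=
  C * (Rpower (t - a) (gamma / 2) / (gamma / 2) * Rpower lam (- (gamma / 2)))
    * N * exp (lam * (t - a)).
Proof.
move=> hl hN hg2 ht ch hb.
have hg' : 0 < gamma / 2 by lra.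
set E := exp (lam * (t - a)); have hE : 0 < E by exact: exp_pos.
have hL := Rpower_pos lam (- (gamma / 2)).
have hq : 0 < Rpower (t - a) (gamma / 2) / (gamma / 2).
  by apply: Rdiv_lt_0_compat => //; exact: Rpower_pos.
case: (Rlt_dec a t) => hat; last first.
  rewrite volterra_le ?norm_zero; last lra.
  apply: Rmult_le_pos; last lra.
  apply: Rmult_le_pos => //; apply: Rmult_le_pos => //; apply: Rmult_le_pos; lra.
have hu : 0 < t - a < X by lra.
set c := C * N * E * Rpower lam (- (gamma / 2)).
have hc : 0 <= c by repeat apply: Rmult_le_pos => //; lra.
have [] := volterra_tail (c := c) hg' hu ch (t := t).
  move=> r hr.
  apply: Rle_trans (sk_bound hK _ _) _; first lra.
  have hlr : 0 < lam * r by apply: Rmult_lt_0_compat; lra.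
  have hg01 : 0 <= gamma / 2 <= 1 by lra.
  have h1 := Rpower_mul_exp_le1 hlr hg01.
  have h2 : norm (h (t - r)) <= N * (E * exp (- (lam * r))).
    have -> : E * exp (- (lam * r)) = exp (lam * (t - r - a)).
      by rewrite /E -exp_plus; congr exp; ring.
    by apply: hb; lra.
  have e1 : Rpower r (gamma - 1) = Rpower r (gamma / 2 - 1) * Rpower r (gamma / 2).
    by rewrite -Rpower_plus; congr Rpower; field.
  have e2 : Rpower r (gamma / 2) = Rpower lam (- (gamma / 2)) * Rpower (lam * r) (gamma / 2).
    rewrite -Rpower_mult_distr; try lra.
    by rewrite -Rmult_assoc -Rpower_plus Rplus_opp_l Rpower_O // Rmult_1_l.
  have p1 := Rpower_pos r (gamma / 2 - 1).
  have p0 := Rpower_pos r (gamma - 1).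
  apply: Rle_trans (Rmult_le_compat_l _ _ _ (Rmult_le_pos _ _ hC (Rlt_le _ _ p0)) h2) _.
  rewrite e1 e2 /c.
  set u := Rpower (lam * r) _ in h1 *; set w := exp (- _) in h1 *.
  set l := Rpower lam _ in hL *.
  have -> : C * (Rpower r (gamma / 2 - 1) * (l * u)) * (N * (E * w)) =
    C * N * E * l * Rpower r (gamma / 2 - 1) * (u * w) by ring.
  rewrite -{2}(Rmult_1_r (C * N * E * l * _)).
  by apply: Rmult_le_compat_l => //; repeat apply: Rmult_le_pos => //; lra.
move=> _; rewrite Rabs_pos_eq; last by apply: Rmult_le_pos; lra.
rewrite volterra_gt // => le1; apply: Rle_trans le1 _.
by right; rewrite /c; ring.
Qed.

(** At [t0 = a] the integral is of order [(t - a)^gamma]. For [t0 > a] the change is split in two: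
    first [h] is shifted over the old interval of integration, then the length of the interval is
    changed. *)
Lemma continuous_volterra (a : R) (h : R -> B) (t0 : R) : t0 < a + X ->
  (forall s, continuous h s) -> continuous (volterra K a h) t0.
Proof.
move=> ht0 ch; apply/(continuousP (U := R_UniformSpace)) => eps heps.
case: (Rlt_dec t0 a) => h0.
  have hd : 0 < a - t0 by lra.
  apply: (locally_Rabs hd) => t /Rabs_def2 ht.
  by rewrite !volterra_le ?minus_eq_zero ?norm_zero; lra.
(* Generous enough for [[- p - p, p + p]] to contain every argument of [h] met below. *)
pose p := Rabs a + Rabs t0 + X + 2.
have [N [hN HN]] := bounded_on (- p - p) (p + p) ch.
have hXp : 0 < X by lra.
have hcn0 : 0 <= C * N / gamma.
  by apply: Rmult_le_pos; [exact: Rmult_le_pos|left; exact: Rinv_0_lt_compat].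
have hcn : 0 < C * N / gamma + 1 by lra.
have hpa := Rle_abs a; have hpa' := Rle_abs (- a).
have hpt := Rle_abs t0; have hpt' := Rle_abs (- t0).
rewrite !Rabs_Ropp in hpa' hpt'.
case: (Req_dec t0 a) => [e0|hne].
  have -> : volterra K a h t0 = zero by rewrite volterra_le //; lra.
  have hd0 : 0 < eps / (C * N / gamma + 1) by apply: Rdiv_lt_0_compat.
  set d := Rmin (Rpower (eps / (C * N / gamma + 1)) (/ gamma)) (Rmin 1 (X / 2)).
  have hd : 0 < d by apply: Rmin_glb_lt; [exact: Rpower_pos|apply: Rmin_glb_lt; lra].
  have d1 : d <= Rpower (eps / (C * N / gamma + 1)) (/ gamma) by exact: Rmin_l.
  have d23 : d <= Rmin 1 (X / 2) by exact: Rmin_r.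
  have d2 := Rmin_l 1 (X / 2); have d3 := Rmin_r 1 (X / 2).
  apply: (locally_Rabs hd) => t /Rabs_def2 ht.
  rewrite minus_zero_r; case: (Rlt_dec a t) => hat; last by rewrite volterra_le ?norm_zero; lra.
  rewrite volterra_gt //.
  have hu : 0 < t - a < X by lra.
  have [|_ hle] := volterra_plain hu ch hN (t := t); first by move=> r hr; apply: HN; rewrite /p; lra.
  apply: Rle_lt_trans hle _.
  have hpow : Rpower (t - a) gamma < eps / (C * N / gamma + 1).
    have : Rpower (t - a) gamma < Rpower (Rpower (eps / (C * N / gamma + 1)) (/ gamma)) gamma.
      by apply: Rlt_Rpower_l => //; lra.
    by rewrite Rpower_mult Rinv_l ?Rpower_1 //; lra.
  have -> : C * N * (Rpower (t - a) gamma / gamma) = C * N / gamma * Rpower (t - a) gamma.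
    by field; lra.
  have hle2 : C * N / gamma * Rpower (t - a) gamma <= C * N / gamma * (eps / (C * N / gamma + 1)).
    by apply: Rmult_le_compat_l => //; lra.
  have e : C * N / gamma * (eps / (C * N / gamma + 1)) = eps - eps / (C * N / gamma + 1).
    by set z := C * N / gamma in hcn *; field; lra.
  lra.
have hat : a < t0 by lra.
set u0 := t0 - a; have hu0 : 0 < u0 < X by rewrite /u0; lra.
have hG : 0 < C * (Rpower u0 gamma / gamma) + 1.
  have : 0 <= C * (Rpower u0 gamma / gamma).
    by apply: Rmult_le_pos => //; left; apply: Rdiv_lt_0_compat => //; exact: Rpower_pos.
  lra.
have he1 : 0 < eps / 2 / (C * (Rpower u0 gamma / gamma) + 1) by apply: Rdiv_lt_0_compat; lra.
have he2 : 0 < eps / 2 / (C * N / gamma + 1) by apply: Rdiv_lt_0_compat; lra.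
have [d0 hd0] := unifcont_normed_1d h (- p - p) (p + p) (fun s _ => ch s) (mkposreal _ he1).
have cpow : continuous (fun t => Rpower (t - a) gamma) t0.
  apply: (ex_derive_continuous (V := R_NormedModule)).
  by rewrite /Rpower; auto_derive; lra.
have [d1 [hd1 Hd1]] := locally_RabsE (proj1 (filterlim_Rabs_minus (F := locally t0) _ _) cpow _ he2).
pose d := Rmin (Rmin d0 d1) (Rmin 1 (Rmin u0 (X - u0))).
have hd : 0 < d.
  apply: Rmin_glb_lt; first by apply: Rmin_glb_lt => //; exact: cond_pos.
  by apply: Rmin_glb_lt; [lra|apply: Rmin_glb_lt; lra].
apply: (locally_Rabs hd) => t ht.
have k1 := Rmin_l (Rmin d0 d1) (Rmin 1 (Rmin u0 (X - u0))).
have k2 := Rmin_r (Rmin d0 d1) (Rmin 1 (Rmin u0 (X - u0))).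
have k3 := Rmin_l d0 d1; have k4 := Rmin_r d0 d1.
have k5 := Rmin_l 1 (Rmin u0 (X - u0)); have k6 := Rmin_r 1 (Rmin u0 (X - u0)).
have k7 := Rmin_l u0 (X - u0); have k8 := Rmin_r u0 (X - u0).
rewrite -/d in k1 k2.
have ht0' : Rabs (t - t0) < d0 by lra.
have hpow := Hd1 t (Rlt_le_trans _ _ _ ht (Rle_trans _ _ _ k1 k4)).
have [ht1 ht2] := Rabs_def2 _ _ ht.
have eu0 : u0 = t0 - a by [].
have hu : 0 < t - a < X by lra.
have c0 : forall s, continuous (fun s => minus (h (s + (t - t0))) (h s)) s.
  move=> s; apply: continuous_minus; last exact: ch.
  apply: (continuous_comp (fun s => s + (t - t0)) h); last exact: ch.
  by apply: (ex_derive_continuous (V := R_NormedModule)); auto_derive.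
rewrite volterra_gt; last lra; rewrite volterra_gt //.
rewrite -/u0.
have [|it0 _] := volterra_plain hu0 ch hN (t := t0); first by move=> r hr; apply: HN; rewrite /p; lra.
have [|it _] := volterra_plain hu0 ch hN (t := t); first by move=> r hr; apply: HN; rewrite /p; lra.
have [|it' _] := volterra_plain hu ch hN (t := t); first by move=> r hr; apply: HN; rewrite /p; lra.
set I0 := RInt_gen _ _ (at_point u0) in it0 *.
set I1 := RInt_gen _ _ (at_point (t - a)) in it' *.
set I2 := RInt_gen _ _ (at_point u0) in it.
(* Uniform continuity of [h]: the difference is itself a Volterra integral, of the increment of [h]
   under a shift by [t - t0]. For [t < t0] the integral [I2] reads [h] to the left of [a], where it
   is continuous too. *)
have b1 : norm (minus I2 I0) <= eps / 2 - 0.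
  have idf : is_RInt_gen (fun r => minus (K r (h (t - r))) (K r (h (t0 - r))))
      (at_right 0) (at_point u0) (minus I2 I0) by exact: is_RInt_gen_minus.
  have hle : 0 <= eps / 2 / (C * (Rpower u0 gamma / gamma) + 1) by lra.
  have [|_ h2] := volterra_plain hu0 c0 hle (t := t0).
    move=> r hr.
    have -> : t0 - r + (t - t0) = t - r by ring.
    left; apply: (hd0 (t0 - r) (t - r)).
    - by rewrite /p /u0 in hr *; lra.
    - by rewrite /p /u0 in hr *; lra.
    - rewrite /ball /= /AbsRing_ball /abs /minus /plus /opp /=.
      by have -> : t - r + - (t0 - r) = t - t0 by ring.
  have e : RInt_gen (fun r => K r (minus (h (t0 - r + (t - t0))) (h (t0 - r))))
      (at_right 0) (at_point u0) = minus I2 I0.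
    apply: (RInt_gen_ext_on (majorant_power hg (proj1 hu0)) _ idf) => r hr.
    rewrite -(sk_minus hK); last lra.
    by have -> : t0 - r + (t - t0) = t - r by ring.
  rewrite e in h2; apply: Rle_trans h2 _.
  move: hG hle; set z := C * (Rpower u0 gamma / gamma) => hG hle.
  have -> : C * (eps / 2 / (z + 1)) * (Rpower u0 gamma / gamma) = z * (eps / 2 / (z + 1)).
    by rewrite /z; ring.
  have e2 : z * (eps / 2 / (z + 1)) = eps / 2 - eps / 2 / (z + 1) by field; lra.
  lra.
(* The two integrals differ by a proper integral from [u0] to [t - a], controlled by the increment
   of [r^gamma / gamma]. *)
have b2 : norm (minus I1 I2) < eps / 2.
  have hmax : 0 < Rmax (t - a) u0 < X.
    by rewrite /Rmax; case: Rle_dec; lra.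
  have maj := majorant_power hg (proj1 hmax).
  have ckt r : 0 < r <= Rmax (t - a) u0 -> continuous (fun r => K r (h (t - r))) r.
    by move=> hr; apply: continuous_kernel_comp => //; lra.
  have D1 : 0 < u0 <= Rmax (t - a) u0 by split; [lra|exact: Rmax_r].
  have D2 : 0 < t - a <= Rmax (t - a) u0 by split; [lra|exact: Rmax_l].
  have hb r : 0 < r <= Rmax (t - a) u0 -> norm (K r (h (t - r))) <= C * N * Rpower r (gamma - 1).
    move=> hr; apply: Rle_trans (sk_bound hK _ _) _; first lra.
    have -> : C * N * Rpower r (gamma - 1) = C * Rpower r (gamma - 1) * N by ring.
    apply: Rmult_le_compat_l; first by apply: Rmult_le_pos => //; left; exact: Rpower_pos.
    by apply: HN; rewrite /p; lra.
  have := norm_RInt_majorant maj ckt hb D1 D2.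
  set J := RInt _ u0 (t - a).
  have -> : J = minus I1 I2.
    have iJ : is_RInt_gen (fun r => K r (h (t - r))) (at_point u0) (at_point (t - a)) J.
      apply/is_RInt_gen_at_point; apply: RInt_correct.
      exact: (ex_RInt_on maj).
    have isum : is_RInt_gen (fun r => K r (h (t - r))) (at_right 0) (at_point (t - a)) (plus I2 J).
      exact: (is_RInt_gen_Chasles _ u0).
    rewrite /I1 (is_RInt_gen_unique _ _ isum) /minus (plus_comm I2) -plus_assoc.
    by rewrite plus_opp_r plus_zero_r.
  move=> hle; apply: Rle_lt_trans hle _.
  have -> : C * N * (Rpower (t - a) gamma / gamma - Rpower u0 gamma / gamma) =
    C * N / gamma * (Rpower (t - a) gamma - Rpower u0 gamma) by field; lra.
  rewrite Rabs_mult Rabs_pos_eq; last first.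
    by apply: Rmult_le_pos; [exact: Rmult_le_pos|left; exact: Rinv_0_lt_compat].
  set z := C * N / gamma in hcn he2 hpow *.
  have hz : 0 <= z.
    by apply: Rmult_le_pos; [exact: Rmult_le_pos|left; exact: Rinv_0_lt_compat].
  have h1 : z * Rabs (Rpower (t - a) gamma - Rpower u0 gamma) <= z * (eps / 2 / (z + 1)).
    by apply: Rmult_le_compat_l; [lra|left].
  have e2 : z * (eps / 2 / (z + 1)) = eps / 2 - eps / 2 / (z + 1) by field; lra.
  lra.
have := norm_minus_trans I1 I2 I0; lra.
Qed.

End Kernel.

(** * Weakly singular Volterra equations *)

(** Under the weight [e^(-lam (t - a))], the Volterra operator after a map with Lipschitz constant
    [ell] has norm at most 1/2 on an interval of length [T]. *)
Definition contracting_weight (gamma C T ell lam : R) : Prop :=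
  0 < lam /\ C * (Rpower T (gamma / 2) / (gamma / 2) * Rpower lam (- (gamma / 2))) * ell <= / 2.

Lemma contracting_weight_exists (gamma C T ell : R) : 0 < gamma -> 0 <= C -> 0 <= ell ->
  exists lam, contracting_weight gamma C T ell lam.
Proof.
move=> hg hC hl.
set z := C * (Rpower T (gamma / 2) / (gamma / 2)) * ell.
have hz : 0 <= z.
  apply: Rmult_le_pos => //; apply: Rmult_le_pos => //.
  by left; apply: Rdiv_lt_0_compat; [exact: Rpower_pos|lra].
(* Chosen so that [lam^(-gamma/2) = / (2 z + 1)]; then [z / (2 z + 1) <= / 2]. *)
exists (Rpower (2 * z + 1) (2 / gamma)); split; first exact: Rpower_pos.
rewrite Rpower_mult.
have -> : 2 / gamma * - (gamma / 2) = -1 by field; lra.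
rewrite (Rpower_Ropp _ 1) Rpower_1; last lra.
have -> : C * (Rpower T (gamma / 2) / (gamma / 2) * / (2 * z + 1)) * ell = z * / (2 * z + 1).
  by rewrite /z; ring.
apply: (Rmult_le_reg_r (2 * z + 1)); first lra.
rewrite Rmult_assoc Rinv_l; lra.
Qed.

Section WeightedStep.
Context {B1 B : Banach}.
Variables (K : R -> B -> B1) (gamma X C T : R).
Hypotheses (hK : singular_kernel K gamma X C) (hg : 0 < gamma <= 2) (hC : 0 <= C)
  (hT : 0 < T < X).

Lemma weighted_step (ell lam a N : R) (h : R -> B) :
  contracting_weight gamma C T ell lam -> 0 <= ell -> 0 <= N ->
  (forall s, continuous h s) ->
  (forall s, a <= s <= a + T -> norm (h s) <= ell * N * exp (lam * (s - a))) ->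
  forall t, a <= t <= a + T -> norm (volterra K a h t) <= N / 2 * exp (lam * (t - a)).
Proof.
move=> [hl hcw] hell hN ch hb t ht.
have hE := exp_pos (lam * (t - a)).
have hN2 : 0 <= N / 2 * exp (lam * (t - a)) by apply: Rmult_le_pos; lra.
case: (Rlt_dec a t) => hat; last first.
  by rewrite volterra_le ?norm_zero //; lra.
have hlN : 0 <= ell * N by apply: Rmult_le_pos.
apply: Rle_trans (volterra_weighted hK _ hC hl hlN _ _ ch _) _; try lra.
  by move=> s hs; apply: hb; lra.
apply: Rmult_le_compat_r; first lra.
have hp : Rpower (t - a) (gamma / 2) <= Rpower T (gamma / 2) by apply: Rle_Rpower_l; lra.
have hlp := Rpower_pos lam (- (gamma / 2)).
have hle : C * (Rpower (t - a) (gamma / 2) / (gamma / 2) * Rpower lam (- (gamma / 2)))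
  <= C * (Rpower T (gamma / 2) / (gamma / 2) * Rpower lam (- (gamma / 2))).
  apply: Rmult_le_compat_l => //; apply: Rmult_le_compat_r; first lra.
  by apply: Rmult_le_compat_r => //; left; apply: Rinv_0_lt_compat; lra.
have := Rmult_le_compat_r _ _ _ hlN hle.
have := Rmult_le_compat_r _ _ _ hN hcw; lra.
Qed.

(* Gronwall's inequality, read off the maximum of [e^(-lam (t - a)) |x t|]. *)
Lemma volterra_gronwall (L lam a A0 A1 : R) (x : R -> B1) (h : R -> B) :
  contracting_weight gamma C T (L + 1) lam -> 0 <= L -> 0 <= A0 -> 0 <= A1 ->
  (forall s, continuous x s) -> (forall s, continuous h s) ->
  (forall t, a <= t <= a + T -> norm (x t) <= A0 + norm (volterra K a h t)) ->
  (forall s, a <= s <= a + T -> norm (h s) <= A1 + L * norm (x s)) ->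
  forall t, a <= t <= a + T -> norm (x t) <= (2 * A0 + A1) * exp (lam * T).
Proof.
move=> hcw hL hA0 hA1 cx ch hx hh.
have [hlam _] := hcw.
pose f t := exp (- (lam * (t - a))) * norm (x t).
have cf t : continuity_pt f t.
  apply/continuity_pt_filterlim; rewrite -/(continuous f t).
  apply: (continuous_mult (K := R_AbsRing) (fun t => exp (- (lam * (t - a)))) (fun t => norm (x t))).
    by apply: (ex_derive_continuous (V := R_NormedModule)); auto_derive.
  by apply: (continuous_comp x norm); [exact: cx|exact: filterlim_norm].
have [ts [hmax hts]] := continuity_ab_maj f a (a + T) ltac:(lra) (fun c _ => cf c).
set N := f ts in hmax.
have hN : 0 <= N by apply: Rmult_le_pos; [left; exact: exp_pos|exact: norm_ge_0].
have ee s : exp (lam * (s - a)) * exp (- (lam * (s - a))) = 1.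
  by rewrite -exp_plus Rplus_opp_r exp_0.
have hxN s : a <= s <= a + T -> norm (x s) <= N * exp (lam * (s - a)).
  move=> hs; have := hmax s hs; rewrite /f => h0.
  have := Rmult_le_compat_l _ _ _ (Rlt_le _ _ (exp_pos (lam * (s - a)))) h0.
  rewrite -Rmult_assoc ee; lra.
have he1 s : a <= s -> 1 <= exp (lam * (s - a)).
  by move=> hs; apply: exp_ge1; apply: Rmult_le_pos; lra.
(* [A1 + L * norm (x s)] is at most [(L + 1) * (A1 + N)] times the weight: the contraction for
   [L + 1] instead of [L] absorbs the additive term. *)
have hst := weighted_step hcw (N := A1 + N) (a := a) ltac:(lra) ltac:(lra) ch.
have hb s : a <= s <= a + T -> norm (h s) <= (L + 1) * (A1 + N) * exp (lam * (s - a)).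
  move=> hs; apply: Rle_trans (hh s hs) _.
  have h1 := Rmult_le_compat_l _ _ _ hL (hxN s hs).
  have h2 := Rmult_le_compat_l _ _ _ hA1 (he1 s (proj1 hs)).
  have hE := exp_pos (lam * (s - a)).
  have h3 : 0 <= L * A1 * exp (lam * (s - a)).
    by apply: Rmult_le_pos; [apply: Rmult_le_pos|lra].
  have h4 : 0 <= N * exp (lam * (s - a)) by apply: Rmult_le_pos; lra.
  lra.
(* At the maximiser the weighted inequality reads [N <= A0 + (A1 + N) / 2]. *)
have hNle : N <= 2 * A0 + A1.
  have h1 := Rle_trans _ _ _ (hx ts hts) (Rplus_le_compat_l A0 _ _ (hst hb ts hts)).
  have hE := exp_pos (- (lam * (ts - a))).
  have h2 := Rmult_le_compat_l _ _ _ (Rlt_le _ _ hE) h1.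
  have hE1 : exp (- (lam * (ts - a))) <= 1.
    rewrite -exp_0; apply: exp_le.
    have : 0 <= lam * (ts - a) by apply: Rmult_le_pos; lra.
    lra.
  have h3 : exp (- (lam * (ts - a))) * (A0 + (A1 + N) / 2 * exp (lam * (ts - a))) =
    exp (- (lam * (ts - a))) * A0 + (A1 + N) / 2 *
      (exp (lam * (ts - a)) * exp (- (lam * (ts - a)))) by ring.
  rewrite h3 ee in h2.
  have h4 := Rmult_le_compat_r _ _ _ hA0 hE1.
  have : N <= A0 + (A1 + N) / 2.
    have : f ts = N by []. rewrite /f. lra.
  lra.
move=> t ht; apply: Rle_trans (hxN t ht) _.
apply: Rmult_le_compat => //; first by left; exact: exp_pos.
by apply: exp_le; apply: Rmult_le_compat_l; lra.
Qed.

End WeightedStep.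

Lemma pow_half_small (c eps : R) : 0 <= c -> 0 < eps ->
  exists k, c * (/ 2) ^ k < eps.
Proof.
move=> hc heps.
have h1 : Rabs (/ 2) < 1 by rewrite Rabs_pos_eq; lra.
have he : 0 < eps / (c + 1) by apply: Rdiv_lt_0_compat; lra.
have [k Hk] := pow_lt_1_zero _ h1 _ he.
exists k; have := Hk k (le_n k); have hp : 0 < (/ 2) ^ k by apply: pow_lt; lra.
rewrite Rabs_pos_eq => [h|]; last lra.
have := Rmult_lt_compat_l (c + 1) _ _ ltac:(lra) h.
have -> : (c + 1) * (eps / (c + 1)) = eps by field; lra.
lra.
Qed.

Section Picard.
Context {B1 B : Banach}.
Variables (K : R -> B -> B1) (gamma beta a : R) (phi : R -> B1) (F : R -> B1 -> B)
  (L L1 L2 : R).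
Hypotheses (hg : 0 < gamma <= 2) (hb : 0 < beta < 1)
  (hK : forall X, 0 < X -> exists C, 0 <= C /\ singular_kernel K gamma X C)
  (cphi : forall t, continuous phi t)
  (cF : forall x : R -> B1, (forall s, continuous x s) ->
     forall s, continuous (fun s => F s (x s)) s)
  (hL : 0 <= L) (hL1 : 0 <= L1) (hL2 : 0 <= L2)
  (FL : forall s v, norm (F s v) <= L * norm v)
  (FL1 : forall s v v', norm (minus (F s v) (F s v')) <=
     L1 * (1 + L2 * norm v) * norm (minus v v')).

Let Psi (x : R -> B1) (t : R) : B1 :=
  plus (phi t) (scal beta (volterra K a (fun s => F s (x s)) t)).

Fixpoint picard (k : nat) : R -> B1 :=
  if k is k'.+1 then Psi (picard k') else phi.

Lemma continuous_volterra_global (h : R -> B) t : (forall s, continuous h s) ->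
  continuous (volterra K a h) t.
Proof.
move=> ch; have hX : 0 < Rabs (t - a) + 1 by have := Rabs_pos (t - a); lra.
have [C [hC hKC]] := hK hX.
apply: (continuous_volterra hKC (proj1 hg) hC) => //.
have := Rle_abs (t - a); lra.
Qed.

Lemma continuous_Psi x t : (forall s, continuous x s) -> continuous (Psi x) t.
Proof.
move=> cx; apply: continuous_plus; first exact: cphi.
by apply: continuous_scal_r; apply: continuous_volterra_global; exact: cF.
Qed.

Lemma continuous_picard k t : continuous (picard k) t.
Proof. by elim: k t => [|k IH] t; [exact: cphi|apply: continuous_Psi]. Qed.

Lemma norm_scal_beta (v : B1) : norm (scal beta v) <= norm v.
Proof.
apply: Rle_trans (norm_scal_le _ _) _; rewrite Rabs_pos_eq; last lra.
by have := norm_ge_0 v => h; have := Rmult_le_compat_r _ _ _ h (Rlt_le _ _ (proj2 hb)); lra.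
Qed.

Lemma norm_Psi_minus x x' t X C : singular_kernel K gamma X C -> 0 <= C -> t < a + X ->
  (forall s, continuous x s) -> (forall s, continuous x' s) ->
  norm (minus (Psi x t) (Psi x' t)) <=
  norm (volterra K a (fun s => minus (F s (x s)) (F s (x' s))) t).
Proof.
move=> hKX hC ht cx cx'.
rewrite (volterra_minus hKX (proj1 hg) hC ht (cF cx) (cF cx')).
have -> : minus (Psi x t) (Psi x' t) =
  scal beta (minus (volterra K a (fun s => F s (x s)) t) (volterra K a (fun s => F s (x' s)) t)).
  by rewrite scal_minus_distr_l /Psi minus_plus_cancel.
exact: norm_scal_beta.
Qed.

(** Two weights in succession. Linear growth of [F] with the first keeps all iterates in one ball of
    radius [R0]. On that ball [F] has Lipschitz constant [L1 * (1 + L2 * R0)], and the second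
    weight, chosen for this constant, halves the increments. *)
Lemma picard_estimate (T : R) : 0 < T -> exists R0 Q, 0 <= R0 /\ 0 <= Q /\
  (forall k t, a <= t <= a + T -> norm (picard k t) <= R0) /\
  (forall k t, a <= t <= a + T ->
     norm (minus (picard k.+1 t) (picard k t)) <= Q * (/ 2) ^ k).
Proof.
move=> hT; have hX : 0 < T + 1 by lra.
have hTX : 0 < T < T + 1 by lra.
have [C [hC hKC]] := hK hX.
have [Fm [hFm HFm]] := bounded_on a (a + T) cphi.
have [lam hlam] := contracting_weight_exists T (proj1 hg) hC hL.
have lam0 := proj1 hlam.
have he1 l s : 0 < l -> a <= s -> 1 <= exp (l * (s - a)).
  by move=> hl hs; apply: exp_ge1; apply: Rmult_le_pos; lra.
have heT l s : 0 < l -> s <= a + T -> exp (l * (s - a)) <= exp (l * T).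
  by move=> hl hs; apply: exp_le; apply: Rmult_le_compat_l; lra.
(* The bound reproduces itself: [Fm] from the initial term plus half of [2 * Fm] from the
   integral. *)
have hw k t : a <= t <= a + T -> norm (picard k t) <= 2 * Fm * exp (lam * (t - a)).
  elim: k t => [|k IH] t ht.
    have := HFm t ht; have := Rmult_le_compat_l _ _ _ hFm (he1 lam t lam0 (proj1 ht)); rewrite /=; lra.
  apply: Rle_trans (norm_plus_le _ _) _.
  have h1 := norm_scal_beta (volterra K a (fun s => F s (picard k s)) t).
  have hF2 : 0 <= 2 * Fm by lra.
  have h2 : norm (volterra K a (fun s => F s (picard k s)) t) <=
      2 * Fm / 2 * exp (lam * (t - a)).
    apply: (weighted_step hKC hg hC hTX hlam hL hF2) => // [|s hs].
      by apply: cF => r; exact: continuous_picard.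
    apply: Rle_trans (FL _ _) _; rewrite Rmult_assoc.
    by apply: Rmult_le_compat_l => //; exact: IH.
  have h3 := HFm t ht; have h4 := Rmult_le_compat_l _ _ _ hFm (he1 lam t lam0 (proj1 ht)).
  apply: Rle_trans (Rplus_le_compat _ _ _ _ h3 (Rle_trans _ _ _ h1 h2)) _; lra.
pose R0 := 2 * Fm * exp (lam * T).
have hR0 : 0 <= R0 by apply: Rmult_le_pos; [lra|left; exact: exp_pos].
have hR k t : a <= t <= a + T -> norm (picard k t) <= R0.
  move=> ht; apply: Rle_trans (hw k t ht) _.
  by apply: Rmult_le_compat_l; [lra|apply: heT => //; lra].
clearbody R0.
have hL3 : 0 <= L1 * (1 + L2 * R0).
  by apply: Rmult_le_pos => //; have := Rmult_le_pos _ _ hL2 hR0; lra.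
have [mu hmu] := contracting_weight_exists T (proj1 hg) hC hL3.
have mu0 := proj1 hmu.
have hd k t : a <= t <= a + T ->
    norm (minus (picard k.+1 t) (picard k t)) <= 2 * R0 * (/ 2) ^ k * exp (mu * (t - a)).
  elim: k t => [|k IH] t ht.
    apply: Rle_trans (norm_minus_le _ _) _.
    have h1 := hR 1%N t ht; have h2 := hR 0%N t ht.
    have := Rmult_le_compat_l _ _ _ hR0 (he1 mu t mu0 (proj1 ht)).
    rewrite pow_O; lra.
  have hp : 0 < (/ 2) ^ k by apply: pow_lt; lra.
  apply: Rle_trans (norm_Psi_minus hKC hC (x := picard k.+1) (x' := picard k) _ _ _) _.
  - lra.
  - exact: continuous_picard.
  - exact: continuous_picard.
  have hN : 0 <= 2 * R0 * (/ 2) ^ k by apply: Rmult_le_pos; lra.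
  have ch s : continuous (fun s => minus (F s (picard k.+1 s)) (F s (picard k s))) s.
    by apply: continuous_minus; apply: cF; exact: continuous_picard.
  apply: Rle_trans (weighted_step hKC hg hC hTX hmu hL3 hN ch _ ht) _; last first.
    by right; rewrite -tech_pow_Rmult; field.
  move=> s hs; apply: Rle_trans (FL1 _ _ _) _.
  rewrite !Rmult_assoc; apply: Rmult_le_compat_l => //.
  apply: Rmult_le_compat; try exact: norm_ge_0.
  - by have := Rmult_le_pos _ _ hL2 (norm_ge_0 (picard k.+1 s)); lra.
  - by have := Rmult_le_compat_l _ _ _ hL2 (hR k.+1 s hs); lra.
  - by have := IH s hs; lra.
exists R0, (2 * R0 * exp (mu * T)); split=> //; split.
  by apply: Rmult_le_pos; [lra|left; exact: exp_pos].
split=> // k t ht; apply: Rle_trans (hd k t ht) _.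
have hp : 0 < (/ 2) ^ k by apply: pow_lt; lra.
have := Rmult_le_compat_l (2 * R0 * (/ 2) ^ k) _ _ ltac:(apply: Rmult_le_pos; lra)
  (heT mu t mu0 (proj2 ht)); lra.
Qed.

Lemma picard_const k t : t <= a -> picard k t = phi t.
Proof.
move=> ht; case: k => [|k] //=.
by rewrite /Psi volterra_le // scal_zero_r plus_zero_r.
Qed.

(** The estimate reaches below [a], where all iterates coincide with [phi], so that the limit is
    uniform on both sides of [a]. *)
Lemma picard_cauchy (T : R) : 0 < T -> exists R0 Q, 0 <= R0 /\ 0 <= Q /\
  (forall k t, a <= t <= a + T -> norm (picard k t) <= R0) /\
  (forall k m t, t <= a + T ->
     norm (minus (picard (k + m) t) (picard k t)) <= Q * (/ 2) ^ k).
Proof.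
move=> hT; have [R0 [Q [hR0 [hQ [h1 h2]]]]] := picard_estimate hT.
exists R0, (2 * Q); split=> //; split; first lra; split=> // k m t ht.
have hpk : 0 < (/ 2) ^ k by apply: pow_lt; lra.
have hQk : 0 <= Q * (/ 2) ^ k by apply: Rmult_le_pos; lra.
case: (Rlt_dec t a) => hta.
  by rewrite !picard_const ?minus_eq_zero ?norm_zero; lra.
(* The exact geometric sum is carried through the induction; the bound [2 * Q * (/ 2) ^ k] alone is
   not inductive. *)
suff H : norm (minus (picard (k + m) t) (picard k t)) <=
    Q * (/ 2) ^ k * (2 - 2 * (/ 2) ^ m).
  apply: Rle_trans H _.
  have hpm : 0 < (/ 2) ^ m by apply: pow_lt; lra.
  have := Rmult_le_pos _ _ hQk (Rlt_le _ _ hpm); lra.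
elim: m => [|m IH].
  by rewrite addn0 minus_eq_zero norm_zero pow_O; lra.
rewrite addnS; apply: Rle_trans (norm_minus_trans _ (picard (k + m) t) _) _.
have htt : a <= t <= a + T by lra.
have := h2 (k + m)%N t htt.
rewrite Rdef_pow_add -tech_pow_Rmult.
set u := (/ 2) ^ k in hpk hQk IH *; set v := (/ 2) ^ m in IH *.
move=> h3; lra.
Qed.

Let sol (t : R) : B1 := lim (filtermap (fun k => picard k t) eventually).

Lemma sol_approx (T : R) : 0 < T -> exists R0 Q, 0 <= R0 /\ 0 <= Q /\
  (forall k t, a <= t <= a + T -> norm (picard k t) <= R0) /\
  (forall k t, t <= a + T -> norm (minus (sol t) (picard k t)) <= Q * (/ 2) ^ k).
Proof.
move=> hT; have [R0 [Q [hR0 [hQ [h1 h2]]]]] := picard_cauchy hT.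
exists R0, Q; split=> //; split=> //; split=> // k t ht.
have hc : cauchy (filtermap (fun k => picard k t) eventually).
  move=> eps; have [k0 hk0] := pow_half_small hQ (cond_pos eps).
  exists (picard k0 t); exists k0 => j /leP hj.
  apply: norm_compat1; rewrite -(subnKC hj).
  by apply: Rle_lt_trans (h2 _ _ _ ht) hk0.
have hlim : filterlim (fun k => picard k t) eventually (locally (sol t)).
  apply/filterlim_locally => eps; exact (complete_cauchy (filtermap (fun k => picard k t) eventually) _ hc eps).
apply: le_epsilon => eps heps.
have [j0 hj0] := proj1 (filterlim_norm_minus _ _) hlim _ heps.
have := hj0 (k + j0)%N ltac:(apply/leP; exact: leq_addl).
have := norm_minus_trans (sol t) (picard (k + j0) t) (picard k t).
rewrite (norm_minusC (sol t) (picard (k + j0) t)); have := h2 k j0 t ht; lra.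
Qed.

Lemma continuous_sol t0 : continuous sol t0.
Proof.
apply/(continuousP (U := R_UniformSpace)) => eps heps.
have hT : 0 < Rabs (t0 - a) + 1 by have := Rabs_pos (t0 - a); lra.
have [R0 [Q [_ [hQ [_ h2]]]]] := sol_approx hT.
have he3 : 0 < eps / 3 by lra.
have [k hk] := pow_half_small hQ he3.
have h3 := proj1 (continuousP _ _) (@continuous_picard k t0) _ he3.
have h4 : locally t0 (fun t => Rabs (t - t0) < 1) by apply: (locally_Rabs Rlt_0_1).
apply: filter_imp (filter_and _ _ h3 h4) => t [h5 /Rabs_def2 h6].
have hta := Rle_abs (t0 - a).
have k1 := h2 k t ltac:(lra); have k2 := h2 k t0 ltac:(lra).
have k3 := norm_minus_trans (sol t) (picard k t) (sol t0).
have k4 := norm_minus_trans (picard k t) (picard k t0) (sol t0).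
rewrite (norm_minusC (sol t0)) in k2; lra.
Qed.

(** In [picard k.+1 = Psi (picard k)] both sides converge: the left by construction of [sol], the
    right because [Psi] contracts in the weighted norm. *)
Lemma volterra_solution : exists x : R -> B1, (forall s, continuous x s) /\
  forall t, x t = plus (phi t) (scal beta (volterra K a (fun s => F s (x s)) t)).
Proof.
exists sol; split=> [|t]; first exact: continuous_sol.
have hT : 0 < Rabs (t - a) + 1 by have := Rabs_pos (t - a); lra.
set T := Rabs (t - a) + 1 in hT.
have htT : t <= a + T by have := Rle_abs (t - a); rewrite /T; lra.
have [R0 [Q [hR0 [hQ [h1 h2]]]]] := sol_approx hT.
have hX : 0 < T + 1 by lra.
have hTX : 0 < T < T + 1 by lra.
have [C [hC hKC]] := hK hX.
have hL3 : 0 <= L1 * (1 + L2 * R0).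
  by apply: Rmult_le_pos => //; have := Rmult_le_pos _ _ hL2 hR0; lra.
have [mu hmu] := contracting_weight_exists T (proj1 hg) hC hL3.
have mu0 := proj1 hmu.
suff h0 : norm (minus (sol t) (Psi sol t)) <= 0.
  have : minus (sol t) (Psi sol t) = zero.
    by apply: norm_eq_zero; have := norm_ge_0 (minus (sol t) (Psi sol t)); lra.
  move=> h; have := f_equal (fun z => plus z (Psi sol t)) h.
  by rewrite /minus -plus_assoc plus_opp_l plus_zero_r plus_zero_l.
apply: le_epsilon => eps heps; rewrite Rplus_0_l.
have hQE : 0 <= Q * (1 + exp (mu * T)).
  by apply: Rmult_le_pos => //; have := exp_pos (mu * T); lra.
have [k hk] := pow_half_small hQE heps.
apply: Rle_trans (norm_minus_trans _ (picard k.+1 t) _) _.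
have hp : 0 < (/ 2) ^ k by apply: pow_lt; lra.
have hN : 0 <= Q * (/ 2) ^ k by apply: Rmult_le_pos; lra.
have k1 : norm (minus (sol t) (picard k.+1 t)) <= Q * (/ 2) ^ k.
  apply: Rle_trans (h2 k.+1 t htT) _; rewrite -tech_pow_Rmult; lra.
(* The Lipschitz factor in [FL1] involves only its first argument. Placing the iterate there makes
   the bound [R0] on iterates sufficient. *)
have k2 : norm (minus (picard k.+1 t) (Psi sol t)) <= Q * (/ 2) ^ k * exp (mu * T).
  apply: Rle_trans (norm_Psi_minus hKC hC (x := picard k) (x' := sol) _ _ _) _.
  - lra.
  - exact: continuous_picard.
  - exact: continuous_sol.
  case: (Rlt_dec t a) => hta.
    rewrite volterra_le ?norm_zero; last lra.
    by apply: Rmult_le_pos => //; left; exact: exp_pos.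
  have htt : a <= t <= a + T by lra.
  have ch s : continuous (fun s => minus (F s (picard k s)) (F s (sol s))) s.
    by apply: continuous_minus; apply: cF; [exact: continuous_picard|exact: continuous_sol].
  apply: Rle_trans (weighted_step hKC hg hC hTX hmu hL3 hN ch _ htt) _.
    move=> s hs; apply: Rle_trans (FL1 _ _ _) _.
    have hE : 1 <= exp (mu * (s - a)) by apply: exp_ge1; apply: Rmult_le_pos; lra.
    rewrite (Rmult_assoc _ _ (exp _)).
    apply: Rmult_le_compat; last first.
    - have := h2 k s (proj2 hs); rewrite norm_minusC => h3.
      have := Rmult_le_compat_l _ _ _ hN hE; lra.
    - apply: Rmult_le_compat_l => //.
      by have := Rmult_le_compat_l _ _ _ hL2 (h1 k s hs); lra.
    - exact: norm_ge_0.
    - apply: Rmult_le_pos => //.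
      by have := Rmult_le_pos _ _ hL2 (norm_ge_0 (picard k s)); lra.
  have hE := exp_pos (mu * (t - a)).
  apply: Rmult_le_compat; try lra.
  by apply: exp_le; apply: Rmult_le_compat_l; lra.
lra.
Qed.

End Picard.

(** * The mild equation *)

Definition mild_kernel {B1 B : Banach} (beta : R) (R01 : R -> B -> B1) (r : R) (v : B) : B1 :=
  scal (Rpower r (beta - 1)) (E'_op beta R01 (Rpower r beta) v).

(* [(t - a)^beta] for [t > a] and [0] for [t <= a], unlike [Rpower]. *)
Definition pos_power (beta a t : R) : R :=
  if Rlt_dec a t then Rpower (t - a) beta else 0.

Lemma pos_power_gt beta a t : a < t -> pos_power beta a t = Rpower (t - a) beta.
Proof. by rewrite /pos_power; case: Rlt_dec. Qed.

Lemma pos_power_le beta a t : t <= a -> pos_power beta a t = 0.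
Proof. by rewrite /pos_power; case: Rlt_dec => // h1 h2; lra. Qed.

Lemma pos_power_ge0 beta a t : 0 <= pos_power beta a t.
Proof.
by rewrite /pos_power; case: Rlt_dec => h; [left; exact: Rpower_pos|exact: Rle_refl].
Qed.

Lemma continuous_pos_power beta a t0 : 0 < beta -> continuous (pos_power beta a) t0.
Proof.
move=> hb; case: (Rtotal_order t0 a) => [h|[->|h]].
- have hd : 0 < a - t0 by lra.
  apply: (continuous_ext_loc _ (fun _ => 0)); last exact: continuous_const.
  by apply: (locally_Rabs hd) => t /Rabs_def2 ht; rewrite pos_power_le //; lra.
- apply/(filterlim_Rabs_minus (F := locally a)) => eps heps.
  apply: (locally_Rabs (Rpower_pos eps (/ beta))) => t ht.
  rewrite (@pos_power_le beta a a (Rle_refl a)) Rminus_0_r.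
  rewrite Rabs_pos_eq; last exact: pos_power_ge0.
  case: (Rlt_dec a t) => hat; last by rewrite pos_power_le //; lra.
  rewrite pos_power_gt //.
  have [h1 _] := Rabs_def2 _ _ ht.
  have : Rpower (t - a) beta < Rpower (Rpower eps (/ beta)) beta.
    by apply: Rlt_Rpower_l => //; lra.
  by rewrite Rpower_mult Rinv_l ?Rpower_1 //; lra.
- have hd : 0 < t0 - a by lra.
  apply: (continuous_ext_loc _ (fun t => Rpower (t - a) beta)).
    by apply: (locally_Rabs hd) => t /Rabs_def2 ht; rewrite pos_power_gt //; lra.
  apply: (ex_derive_continuous (V := R_NormedModule)).
  by rewrite /Rpower; auto_derive; lra.
Qed.

(** The substitution [s = t - r] carries [at_right 0] to [at_left t]. The sign from the reversed
    orientation cancels the one from the Jacobian. *)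
Lemma is_RInt_gen_reflect {V : Banach} (f : R -> V) (a t : R) (J : V) :
  is_RInt_gen (fun r => f (t - r)) (at_right 0) (at_point (t - a)) J ->
  is_RInt_gen f (at_point a) (at_left t) J.
Proof.
move=> hJ P hP.
have h : filter_prod (at_right 0) (at_point (t - a)) (fun ab => exists y,
   is_RInt (fun r => f (t - r)) ab.1 ab.2 y /\ P y) := hJ P hP.
have [Q1 Q2 hQ1 hQ2 hQ] := h.
have [d [hd Hd]] := at_right_0E hQ1.
apply: (Filter_prod _ _ _ (fun x => x = a) (fun c => t - d < c < t)).
- by [].
- exists (mkposreal d hd) => c hc hct.
  have hc' : Rabs (c - t) < d := hc.
  have := Rabs_def2 _ _ hc'; lra.
move=> _ c -> hc /=.
have [y [hy Py]] := hQ (t - c) (t - a) (Hd (t - c) ltac:(lra)) hQ2.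
exists y; split=> //.
have hy' := is_RInt_swap _ _ _ _ hy.
have e1 : t - a = -1 * a + t by ring.
have e2 : t - c = -1 * c + t by ring.
rewrite /= e1 e2 in hy'.
have := is_RInt_comp_lin (fun r => f (t - r)) (-1) t a c (opp y) hy' => hc2.
have hc3 := is_RInt_opp _ _ _ _ hc2.
rewrite opp_opp in hc3.
apply: is_RInt_ext hc3 => s _.
have -> : t - (-1 * s + t) = s by ring.
by rewrite -scal_opp_l /opp /= Ropp_involutive (scal_one (f s)).
Qed.

(** For [t <= a] this says [x t = E_op beta S1 0 Y], the constant continuation that lets [x] be
    continuous on the whole line. *)
Definition mild_equation {B1 B : Banach} (beta a : R) (S1 : R -> B1 -> B1)
    (R01 : R -> B -> B1) (F : R -> B1 -> B) (Y : B1) (x : R -> B1) (t : R) : Prop :=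
  x t = plus (E_op beta S1 (pos_power beta a t) Y)
    (scal beta (volterra (mild_kernel beta R01) a (fun s => F s (x s)) t)).

(** What is left of [H] and [D] once everything is measured in the norm of [B1]. Continuity is asked
    along continuous curves, the form in which it enters the integrals. *)
Record nonlinearity (B1 B Bpar : Banach) (F : Bpar -> R -> B1 -> B) (L L1 L2 L3 N : R) : Prop := {
  nl_cont : forall alpha (x : R -> B1), (forall s, continuous x s) ->
    forall s, continuous (fun s => F alpha s (x s)) s;
  nl_growth : forall alpha s v, norm (F alpha s v) <= L * norm v;
  nl_lip : forall alpha s v v', norm (minus (F alpha s v) (F alpha s v')) <=
    L1 * (1 + L2 * norm v) * norm (minus v v');
  nl_par : forall alpha alpha' s v, norm (minus (F alpha s v) (F alpha' s v)) <=
    L3 * norm (minus alpha alpha') * (1 + N * norm v) }.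

Arguments nl_cont {B1 B Bpar F L L1 L2 L3 N} _ alpha {x} _ s.
Arguments nl_growth {B1 B Bpar F L L1 L2 L3 N} _ alpha s v.
Arguments nl_lip {B1 B Bpar F L L1 L2 L3 N} _ alpha s v v'.
Arguments nl_par {B1 B Bpar F L L1 L2 L3 N} _ alpha alpha' s v.

Section MildEquationTheory.
Variables beta M1 m1 C0 mu omega : R.
Hypotheses (hbeta : 0 < beta < 1) (hM1 : 0 <= M1) (hm1 : 0 <= m1) (hC0 : 0 <= C0)
  (hmu : 0 <= mu) (homega : 0 < omega < 1).

Let gamma := beta * (1 - omega).

Let hgamma : 0 < gamma <= 2.
Proof. by rewrite /gamma; split; [apply: Rmult_lt_0_compat; lra|nra]. Qed.

(** The exponent comes from [r^(beta - 1) * (r^beta)^(-omega) = r^(gamma - 1)]. *)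
Lemma mild_kernel_singular (X : R) : 0 < X -> exists C, 0 <= C /\
  forall (B1 B : Banach) (S1 : R -> B1 -> B1) (R01 : R -> B -> B1),
  smoothing_semigroup S1 R01 M1 m1 C0 mu omega ->
  singular_kernel (mild_kernel beta R01) gamma X C.
Proof.
move=> hX.
have [C [hC H]] := E'_op_facts hbeta M1 m1 hC0 hmu homega (Rlt_le _ _ (Rpower_pos X beta)).
exists C; split=> // B1 B S1 R01 hS.
have [h1 [h2 h3]] := H _ _ _ _ hS.
have hr r : 0 < r < X -> 0 < Rpower r beta < Rpower X beta.
  by move=> hr; split; [exact: Rpower_pos|apply: Rlt_Rpower_l; lra].
split.
- move=> r v v' /hr h; rewrite /mild_kernel h2; last lra.
  exact: scal_minus_distr_l.
- move=> r v hrX; apply: continuous_scal.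
    apply: (ex_derive_continuous (V := R_NormedModule)).
    by rewrite /Rpower; auto_derive; lra.
  apply: (continuous_comp (fun r => Rpower r beta) (fun t => E'_op beta R01 t v)).
    apply: (ex_derive_continuous (V := R_NormedModule)).
    by rewrite /Rpower; auto_derive; lra.
  by apply: h3; exact: hr.
- move=> r v hrX; rewrite /mild_kernel; apply: Rle_trans (norm_scal_le _ _) _.
  rewrite Rabs_pos_eq; last by left; exact: Rpower_pos.
  have h := h1 (Rpower r beta) v ltac:(have := hr r hrX; lra).
  apply: Rle_trans (Rmult_le_compat_l _ _ _ (Rlt_le _ _ (Rpower_pos r (beta - 1))) h) _.
  right; rewrite Rpower_mult.
  have -> : Rpower r (gamma - 1) = Rpower r (beta - 1) * Rpower r (beta * - omega).
    by rewrite -Rpower_plus /gamma; congr Rpower; ring.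
  ring.
Qed.

Lemma continuous_initial_term (B1 B : Banach) (S1 : R -> B1 -> B1) (R01 : R -> B -> B1)
  (a : R) (Y : B1) (t : R) :
  smoothing_semigroup S1 R01 M1 m1 C0 mu omega ->
  continuous (fun t => E_op beta S1 (pos_power beta a t) Y) t.
Proof.
move=> hS.
have hX : 0 <= pos_power beta a t + 1 by have := pos_power_ge0 beta a t; lra.
have [C [_ H]] := E_op_facts hbeta C0 mu omega hM1 hm1 hX.
have [_ [_ h]] := H _ _ _ _ hS.
apply: (continuous_ext (fun t => E_op beta S1 (Rmax 0 (pos_power beta a t)) Y)).
  by move=> s; rewrite Rmax_right //; exact: pos_power_ge0.
apply: (continuous_comp (pos_power beta a) (fun q => E_op beta S1 (Rmax 0 q) Y)).
  by apply: continuous_pos_power; lra.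
by apply: h; lra.
Qed.

Lemma mild_equation_solution (B1 B Bpar : Banach) (S1 : R -> B1 -> B1) (R01 : R -> B -> B1)
  (F : Bpar -> R -> B1 -> B) (L L1 L2 L3 N a : R) (Y : B1) (alpha : Bpar) :
  smoothing_semigroup S1 R01 M1 m1 C0 mu omega -> nonlinearity F L L1 L2 L3 N ->
  0 <= L -> 0 <= L1 -> 0 <= L2 ->
  exists x, (forall s, continuous x s) /\
    forall t, mild_equation beta a S1 R01 (F alpha) Y x t.
Proof.
move=> hS hF hL hL1 hL2.
apply: (volterra_solution a (K := mild_kernel beta R01) hgamma hbeta
  (phi := fun t => E_op beta S1 (pos_power beta a t) Y) _ _ _ hL hL1 hL2).
- move=> X hX; have [C [hC H]] := mild_kernel_singular hX.
  by exists C; split=> //; apply: H hS.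
- by move=> t; apply: continuous_initial_term hS.
- by move=> x; apply: (nl_cont hF alpha).
- exact: (nl_growth hF alpha).
- exact: (nl_lip hF alpha).
Qed.

(** Gronwall is applied twice. For [x] alone the growth bound has no constant term, so
    [norm (x t) <= R1 * norm Y]. For [x - x'] the Lipschitz factor is then at most
    [L1 * (1 + R1 * rho)], since only the product [L2 * norm Y] enters it. Bounding [x] alone is
    enough, whence the asymmetric [1 + norm Y]. *)
Lemma mild_equation_lipschitz (L L1 L2 L3 N d rho : R) :
  0 <= L -> 0 <= L1 -> 0 <= L2 -> 0 <= L3 -> 0 <= N -> 0 < d -> 0 <= rho ->
  exists k, forall (B1 B Bpar : Banach) (S1 : R -> B1 -> B1) (R01 : R -> B -> B1)
    (F : Bpar -> R -> B1 -> B) (a : R) (Y Y' : B1) (alpha alpha' : Bpar) (x x' : R -> B1),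
  smoothing_semigroup S1 R01 M1 m1 C0 mu omega -> nonlinearity F L L1 L2 L3 N ->
  (forall s, continuous x s) -> (forall s, continuous x' s) ->
  (forall t, a <= t -> mild_equation beta a S1 R01 (F alpha) Y x t) ->
  (forall t, a <= t -> mild_equation beta a S1 R01 (F alpha') Y' x' t) ->
  L2 * norm Y <= rho ->
  forall t, a <= t <= a + d -> norm (minus (x t) (x' t)) <=
    k * (norm (minus alpha alpha') * (1 + norm Y) + norm (minus Y Y')).
Proof.
move=> hL hL1 hL2 hL3 hN hd hrho.
have [CE [hCE HE]] := E_op_facts hbeta C0 mu omega hM1 hm1 (Rlt_le _ _ (Rpower_pos d beta)).
have hd1 : 0 < d + 1 by lra.
have hdd : 0 < d < d + 1 by lra.
have [CK [hCK HK]] := mild_kernel_singular hd1.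
have hLp : 0 <= L + 1 by lra.
have [lam hlam] := contracting_weight_exists d (proj1 hgamma) hCK hLp.
pose R1 := 2 * CE * exp (lam * d).
have hR1 : 0 <= R1 by apply: Rmult_le_pos; [lra|left; exact: exp_pos].
pose L4 := L1 * (1 + R1 * rho).
have hL4 : 0 <= L4.
  by apply: Rmult_le_pos => //; have := Rmult_le_pos _ _ hR1 hrho; lra.
have hL4p : 0 <= L4 + 1 by lra.
have [lam2 hlam2] := contracting_weight_exists d (proj1 hgamma) hCK hL4p.
have hNR : 0 <= N * R1 by apply: Rmult_le_pos.
exists ((2 * CE + L3 * (1 + N * R1)) * exp (lam2 * d)).
move=> B1 B Bpar S1 R01 F a Y Y' alpha alpha' x x' hS hF cx cx' hx hx' hY.
have [e1 [e2 _]] := HE _ _ _ _ hS.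
have hKC := HK _ _ _ _ hS.
have nbeta (v : B1) : norm (scal beta v) <= norm v by exact: norm_scal_beta.
have hpp t : a <= t <= a + d -> 0 <= pos_power beta a t <= Rpower d beta.
  move=> ht; split; first exact: pos_power_ge0.
  case: (Rlt_dec a t) => hat; last by rewrite pos_power_le; [left; exact: Rpower_pos|lra].
  by rewrite pos_power_gt //; apply: Rle_Rpower_l; lra.
have hbound t : a <= t <= a + d -> norm (x t) <= R1 * norm Y.
  move=> ht.
  have hA0 : 0 <= CE * norm Y by apply: Rmult_le_pos => //; exact: norm_ge_0.
  have := volterra_gronwall hKC hgamma hCK hdd hlam hL hA0 (Rle_refl 0) cx
    (nl_cont hF alpha cx) (a := a) _ _ ht => h.
  apply: Rle_trans (h _ _) _.
  - move=> s hs; rewrite {1}(hx s (proj1 hs)); apply: Rle_trans (norm_plus_le _ _) _.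
    apply: Rplus_le_compat; [exact: e1 (hpp s hs)|exact: nbeta].
  - by move=> s hs; rewrite Rplus_0_l; exact: nl_growth hF _ _ _.
  - by right; rewrite /R1; ring.
pose y s := minus (x s) (x' s).
pose h s := minus (F alpha s (x s)) (F alpha' s (x' s)).
have cy s : continuous y s by apply: continuous_minus.
have ch s : continuous h s.
  by apply: continuous_minus; [exact: (nl_cont hF alpha cx)|exact: (nl_cont hF alpha' cx')].
set dal := norm (minus alpha alpha'); have hdal : 0 <= dal by exact: norm_ge_0.
set dY := norm (minus Y Y'); have hdY : 0 <= dY by exact: norm_ge_0.
have hnY := norm_ge_0 Y.
(* The cost of changing the parameter along [x], with [norm (x s) <= R1 * norm Y] inserted. *)
pose A1 := L3 * dal * ((1 + N * R1) * (1 + norm Y)).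
have hA1 : 0 <= A1.
  by apply: Rmult_le_pos; apply: Rmult_le_pos => //; lra.
have hA0 : 0 <= CE * dY by apply: Rmult_le_pos.
move=> t ht.
have hgr := volterra_gronwall hKC hgamma hCK hdd hlam2 hL4 hA0 hA1 cy ch (a := a) _ _ ht.
apply: Rle_trans (hgr _ _) _.
- move=> s hs.
  rewrite /h (volterra_minus hKC (proj1 hgamma) hCK); last first.
  + exact: (nl_cont hF alpha' cx').
  + exact: (nl_cont hF alpha cx).
  + lra.
  rewrite /y {1}(hx s (proj1 hs)) {1}(hx' s (proj1 hs)).
  set p := E_op _ _ _ Y; set p' := E_op _ _ _ Y'.
  set u := volterra _ _ _ s; set u' := volterra _ _ _ s.
  have -> : minus (plus p (scal beta u)) (plus p' (scal beta u')) =
      plus (minus p p') (scal beta (minus u u')).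
    rewrite scal_minus_distr_l /minus opp_plus -!plus_assoc; congr plus.
    by rewrite !plus_assoc; congr plus; rewrite plus_comm.
  apply: Rle_trans (norm_plus_le _ _) _; apply: Rplus_le_compat; last exact: nbeta.
  by rewrite /p /p' -e2; [exact: e1 (hpp s hs)|exact: hpp].
- move=> s hs.
  apply: Rle_trans (norm_minus_trans _ (F alpha' s (x s)) _) _.
  have hxs := hbound s hs.
  apply: Rplus_le_compat.
    apply: Rle_trans (nl_par hF _ _ _ _) _; rewrite /A1 -/dal.
    apply: Rmult_le_compat_l; first exact: Rmult_le_pos.
    have k1 := Rmult_le_compat_l _ _ _ hN hxs.
    have k2 : 0 <= N * R1 * norm Y by apply: Rmult_le_pos.
    lra.
  apply: Rle_trans (nl_lip hF _ _ _ _) _.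
  apply: Rmult_le_compat_r; first exact: norm_ge_0.
  apply: Rmult_le_compat_l => //.
  have k1 := Rmult_le_compat_l _ _ _ hL2 hxs.
  have k2 := Rmult_le_compat_l _ _ _ hR1 hY.
  lra.
- have hE := exp_pos (lam2 * d).
  (* The stated constant is a common factor for both data; the surplus cross terms are
     nonnegative. *)
  have -> : (2 * CE + L3 * (1 + N * R1)) * exp (lam2 * d) * (dal * (1 + norm Y) + dY) =
    (2 * (CE * dY) + A1) * exp (lam2 * d) +
    (2 * CE * (dal * (1 + norm Y)) + L3 * (1 + N * R1) * dY) * exp (lam2 * d).
    by rewrite /A1; ring.
  have : 0 <= (2 * CE * (dal * (1 + norm Y)) + L3 * (1 + N * R1) * dY) * exp (lam2 * d).
    apply: Rmult_le_pos; last lra.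
    have k1 : 0 <= 2 * CE * (dal * (1 + norm Y)).
      by apply: Rmult_le_pos; [lra|apply: Rmult_le_pos; lra].
    have k2 : 0 <= L3 * (1 + N * R1) * dY.
      by apply: Rmult_le_pos => //; apply: Rmult_le_pos; lra.
    lra.
  lra.
Qed.

End MildEquationTheory.

(** * From the data of the theorem to the abstract equation *)

Lemma sumR_le (n : nat) (f : 'I_n -> R) (c : R) :
  (forall j, f j <= c) -> \sumR_(j < n) f j <= INR n * c.
Proof.
elim: n f => [|n IH] f hf; first by rewrite big_ord0 Rmult_0_l; exact: Rle_refl.
rewrite big_ord_recl S_INR.
have := IH (fun j => f (lift ord0 j)) (fun j => hf _).
have := hf ord0; lra.
Qed.

Lemma sumR_ge0 (n : nat) (f : 'I_n -> R) :
  (forall j, 0 <= f j) -> 0 <= \sumR_(j < n) f j.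
Proof. by move=> hf; apply: big_ind => // [|x y]; lra. Qed.

(** Freezing [b] at [b a] to the left of [a] turns one-sided continuity into two-sided, because
    [Rmax a] is 1-Lipschitz. *)
Lemma continuous_from_clip {B1 : Banach} (a : R) (b : R -> B1) (s : R) :
  continuous_from a b -> continuous (fun s => b (Rmax a s)) s.
Proof.
move=> hb; apply/(continuousP (U := R_UniformSpace)) => eps heps.
have [d [hd Hd]] := locally_RabsE
  (proj1 (filterlim_norm_minus (F := within (fun s => a <= s) (locally (Rmax a s))) _ _)
    (hb (Rmax a s) (Rmax_l a s)) eps heps).
apply: (locally_Rabs hd) => y hy; apply: Hd (Rmax_l a y).
apply: Rle_lt_trans hy; rewrite /Rmax; do 2 case: Rle_dec => ?; split_Rabs; lra.
Qed.

Section MildSolution.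
Variables M1 m1 C0 mu omega : R.
Context {B1 B Bpar : Banach} (i1 : B1 -> B) (n : nat) (beta : R)
  (S1 : R -> B1 -> B1) (R01 : R -> B -> B1) (D : 'I_n -> B1 -> B)
  (H : R -> B -> ('I_n -> B) -> Bpar -> B) (a : R) (Y : B1) (alpha : Bpar).
Hypotheses (hbeta : 0 < beta < 1) (hM1 : 0 <= M1) (hm1 : 0 <= m1) (hC0 : 0 <= C0)
  (hmu : 0 <= mu) (homega : 0 < omega < 1)
  (hS : smoothing_semigroup S1 R01 M1 m1 C0 mu omega).
Let F s v := H s (i1 v) (fun j => D j v) alpha.
Hypothesis cF : forall x : R -> B1, (forall s, continuous x s) ->
  forall s, continuous (fun s => F s (x s)) s.

(** After reflection the integral only sees times in [[a, t]], so agreement of [b] with the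
    continuous [x] from [a] on suffices. *)
Lemma is_RInt_gen_mild (x b : R -> B1) (t : R) : a < t -> (forall s, continuous x s) ->
  (forall s, a <= s -> b s = x s) ->
  is_RInt_gen (fun s => scal (Rpower (t - s) (beta - 1))
     (E'_op beta R01 (Rpower (t - s) beta) (H s (i1 (b s)) (fun j => D j (b s)) alpha)))
    (at_point a) (at_left t) (volterra (mild_kernel beta R01) a (fun s => F s (x s)) t).
Proof.
move=> hat cx hbx.
have hX : 0 < t - a + 1 by lra.
have [C [hC HC]] := mild_kernel_singular M1 m1 hbeta hC0 hmu homega hX.
have hg : 0 < beta * (1 - omega) by apply: Rmult_lt_0_compat; lra.
have := volterra_correct (HC _ _ _ _ hS) hg hC (a := a) (t := t) _ (cF cx) => hv.
apply: is_RInt_gen_reflect; apply: is_RInt_gen_ext (hv _); last lra.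
exists (fun r => 0 < r < t - a) (fun r => r = t - a).
- have hta : 0 < t - a by lra.
  exact: (filterlim_0_right hta).
- by [].
move=> p q hp -> r /=; rewrite Rmin_left ?Rmax_right; try lra; move=> hr.
have -> : t - (t - r) = r by ring.
by rewrite /mild_kernel /F hbx //; lra.
Qed.

Lemma mild_solutionI (x : R -> B1) : (forall s, continuous x s) ->
  (forall t, mild_equation beta a S1 R01 F Y x t) ->
  mild_solution i1 beta S1 R01 D H a Y alpha x.
Proof.
move=> cx hx; split; last split.
- move=> t ht; apply: filterlim_filter_le_1 (cx t).
  exact: filter_le_within.
- by rewrite hx pos_power_le ?volterra_le ?scal_zero_r ?plus_zero_r; try lra.
- move=> t ht; exists (volterra (mild_kernel beta R01) a (fun s => F s (x s)) t).
  split; first exact: is_RInt_gen_mild.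
  by rewrite {1}hx pos_power_gt.
Qed.

(** Uniqueness of improper integrals identifies the [J] supplied by a mild solution with the value
    of [volterra]. *)
Lemma mild_solutionE (b : R -> B1) : mild_solution i1 beta S1 R01 D H a Y alpha b ->
  (forall s, continuous (fun s => b (Rmax a s)) s) /\
  forall t, a <= t -> mild_equation beta a S1 R01 F Y (fun s => b (Rmax a s)) t.
Proof.
move=> [cb [ba hb]].
have cx s : continuous (fun s => b (Rmax a s)) s by exact: continuous_from_clip.
split=> // t ht; rewrite /mild_equation Rmax_right //.
case: (Rle_lt_or_eq_dec _ _ ht) => [hat|<-]; last first.
  by rewrite pos_power_le ?volterra_le ?scal_zero_r ?plus_zero_r //; exact: Rle_refl.
have [J [hJ ->]] := hb t hat.
rewrite pos_power_gt //; congr plus; congr scal.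
have hv := is_RInt_gen_mild (b := b) hat cx
  (fun s hs => f_equal b (esym (Rmax_right _ _ hs))).
by rewrite -(is_RInt_gen_unique _ _ hJ) (is_RInt_gen_unique _ _ hv).
Qed.

End MildSolution.

(** A sum over the [n] operators [D j], each of norm at most 1, costs a factor [n], and the argument
    [b0] adds 1. [Rabs] and [Rmax 0] appear because no sign is assumed for [LH], [LH'] and
    [LHpar]. *)
Lemma nonlinearityI (B1 B Bpar : Banach) (i1 : B1 -> B) (n : nat) (D : 'I_n -> B1 -> B)
  (H : R -> B -> ('I_n -> B) -> Bpar -> B) (LH LH' LHpar : R) :
  is_linear i1 -> (forall x, norm (i1 x) <= norm x) ->
  (forall j, is_linear (D j)) -> (forall j x, norm (D j x) <= norm x) ->
  (forall p : R * B * ('I_n -> B) * Bpar,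
     continuous (fun q : R * B * ('I_n -> B) * Bpar =>
       H q.1.1.1 q.1.1.2 q.1.2 q.2) p) ->
  (forall t b0 b0' (b b' : 'I_n -> B) alpha,
     norm (minus (H t b0 b alpha) (H t b0' b' alpha))
     <= LH * (norm (minus b0 b0')
              + \sumR_(j < n) norm (minus (b j) (b' j)))
        * (1 + LH' * \sumR_(j < n) norm (b j))) ->
  (forall t b0 (b : 'I_n -> B) alpha alpha',
     norm (minus (H t b0 b alpha) (H t b0 b alpha'))
     <= LHpar * norm (minus alpha alpha')
        * (1 + \sumR_(j < n) norm (b j))) ->
  (forall t b0 (b : 'I_n -> B) alpha,
     norm (H t b0 b alpha) <= LH * \sumR_(j < n) norm (b j)) ->
  nonlinearity (fun alpha s v => H s (i1 v) (fun j => D j v) alpha)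
    (Rabs LH * INR n) (Rabs LH * (1 + INR n)) (Rmax 0 LH' * INR n) (Rabs LHpar) (INR n).
Proof.
move=> li ni lD nD Hc Hlip Hpar Hg.
have hn : 0 <= INR n by exact: pos_INR.
have sD v : 0 <= \sumR_(j < n) norm (D j v) <= INR n * norm v.
  by split; [apply: sumR_ge0 => j; exact: norm_ge_0|apply: sumR_le => j].
have hL := Rabs_pos LH; have hLl := Rle_abs LH.
have hL' : 0 <= Rmax 0 LH' by exact: Rmax_l.
have hL'' : LH' <= Rmax 0 LH' by exact: Rmax_r.
split.
- move=> alpha x cx s.
  apply: (continuous_comp (fun s => (s, i1 (x s), (fun j => D j (x s)), alpha))
    (fun q : R * B * ('I_n -> B) * Bpar => H q.1.1.1 q.1.1.2 q.1.2 q.2)); last exact: Hc.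
  (* One neighbourhood of [s] serves all components, since [i1] and every [D j] are contractions. *)
  apply/filterlim_locally => eps.
  have he := cond_pos eps.
  have h1 := proj1 (continuousP _ _) (cx s) _ he.
  have h2 : locally s (fun y => ball s eps y) by exists eps.
  apply: filter_imp (filter_and _ _ h1 h2) => y [k1 k2].
  split; last exact: ball_center.
  split; last first.
    move=> j; apply: norm_compat1; rewrite /= -(linear_minus _ _ _ (lD j)).
    by apply: Rle_lt_trans (nD _ _) k1.
  split=> //; apply: norm_compat1; rewrite /= -(linear_minus _ _ _ li).
  by apply: Rle_lt_trans (ni _) k1.
- move=> alpha s v; apply: Rle_trans (Hg _ _ _ _) _.
  have [h1 h2] := sD v.
  apply: Rle_trans (Rmult_le_compat_r _ _ _ h1 hLl) _.
  by rewrite Rmult_assoc; apply: Rmult_le_compat_l.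
- move=> alpha s v v'.
  have [h1 h2] := sD v.
  have hr : 0 <= Rabs LH * (1 + INR n) * (1 + Rmax 0 LH' * INR n * norm v) * norm (minus v v').
    apply: Rmult_le_pos; last exact: norm_ge_0.
    apply: Rmult_le_pos; first by apply: Rmult_le_pos; lra.
    have := Rmult_le_pos _ _ (Rmult_le_pos _ _ hL' hn) (norm_ge_0 v); lra.
  case: (Rlt_dec LH 0) => hneg.
    (* A negative [LH] forces [H = 0] by the growth bound. *)
    have H0 b0 (b : 'I_n -> B) : norm (H s b0 b alpha) <= 0.
      apply: Rle_trans (Hg _ _ _ _) _.
      have : 0 <= \sumR_(j < n) norm (b j) by apply: sumR_ge0 => j; exact: norm_ge_0.
      nra.
    apply: Rle_trans (norm_minus_le _ _) _.
    have := H0 (i1 v) (fun j => D j v); have := H0 (i1 v') (fun j => D j v'); lra.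
  apply: Rle_trans (Hlip _ _ _ _ _ _) _.
  have hi : norm (minus (i1 v) (i1 v')) <= norm (minus v v').
    by rewrite -(linear_minus _ _ _ li).
  have hsum : 0 <= \sumR_(j < n) norm (minus (D j v) (D j v')) <= INR n * norm (minus v v').
    split; first by apply: sumR_ge0 => j; exact: norm_ge_0.
    by apply: sumR_le => j; rewrite -(linear_minus _ _ _ (lD j)).
  have hi0 := norm_ge_0 (minus (i1 v) (i1 v')).
  rewrite (Rabs_pos_eq LH); last lra.
  apply: Rle_trans (_ : _ <= LH * ((1 + INR n) * norm (minus v v')) *
    (1 + Rmax 0 LH' * INR n * norm v)) _; last by right; ring.
  have k1 : 0 <= LH * (norm (minus (i1 v) (i1 v')) + \sumR_(j < n) norm (minus (D j v) (D j v'))).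
    by apply: Rmult_le_pos; lra.
  apply: Rle_trans (_ : _ <= LH * (norm (minus (i1 v) (i1 v'))
     + \sumR_(j < n) norm (minus (D j v) (D j v'))) * (1 + Rmax 0 LH' * INR n * norm v)) _.
    apply: Rmult_le_compat_l => //; apply: Rplus_le_compat_l.
    apply: Rle_trans (Rmult_le_compat_r _ _ _ h1 hL'') _.
    by rewrite Rmult_assoc; apply: Rmult_le_compat_l.
  apply: Rmult_le_compat_r.
    have := Rmult_le_pos _ _ (Rmult_le_pos _ _ hL' hn) (norm_ge_0 v); lra.
  by apply: Rmult_le_compat_l; lra.
- move=> alpha alpha' s v; apply: Rle_trans (Hpar _ _ _ _ _) _.
  have [h1 h2] := sD v.
  have hd := norm_ge_0 (minus alpha alpha').
  apply: Rle_trans (_ : _ <= Rabs LHpar * norm (minus alpha alpha') *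
     (1 + \sumR_(j < n) norm (D j v))) _.
    apply: Rmult_le_compat_r; first lra.
    by apply: Rmult_le_compat_r => //; exact: Rle_abs.
  apply: Rmult_le_compat_l; last lra.
  by apply: Rmult_le_pos => //; exact: Rabs_pos.
Qed.

(* K depends on the constants, on T - a, and on an upper bound rho of
   LH' * |Y|_1; no dependence on Y remains when LH' = 0.  For LH' > 0 a K
   independent of Y does not exist: A = 0, B2 = B1 = B = R^2, D = id and
   H = (0, u sin v) for b_1 = (u, v) is a counterexample. *)
Theorem theorem4p2
  (n : nat) (beta M m M1 m1 LH LH' LHpar kappa omega : R)
  (hbeta : 0 < beta < 1)
  (hM : 0 <= M) (hm : 0 <= m) (hM1 : 0 <= M1) (hm1 : 0 <= m1)
  (hkappa : 0 < kappa) (homega : 0 < omega < 1) :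
  exists K : R -> R -> R,
  forall (B2 B1 B Bpar : Banach)
    (i2 : B2 -> B1) (i1 : B1 -> B)
    (hi2 : dense_embedding i2) (hi1 : dense_embedding i1)
    (* (i) D j in L(B1,B), with restriction D2 j in L(B2,B1) *)
    (D : 'I_n -> B1 -> B) (D2 : 'I_n -> B2 -> B1)
    (hD : forall j, is_linear (D j)) (hD2 : forall j, is_linear (D2 j))
    (hDD2 : forall j x, i1 (D2 j x) = D j (i2 x))
    (hDn : forall j, Rbar_le (op_norm (D j)) 1)
    (hD2n : forall j, Rbar_le (op_norm (D2 j)) 1)
    (* (ii) S t and S1 t are e^{At} in B and in B1 *)
    (A : B2 -> B) (hA : is_linear A)
    (S : R -> B -> B) (S1 : R -> B1 -> B1)
    (hS : C0_semigroup S) (hS1 : C0_semigroup S1)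
    (hSS1 : forall t, 0 <= t -> forall x, i1 (S1 t x) = S t (i1 x))
    (hgen : generates_with_core (fun x => i1 (i2 x)) A S)
    (hinv : invariant_subspace (fun x => i1 (i2 x)) S)
    (hSn : forall t, 0 <= t -> Rbar_le (op_norm (S t)) (M * exp (m * t)))
    (hS1n : forall t, 0 <= t -> Rbar_le (op_norm (S1 t)) (M1 * exp (m1 * t)))
    (* (iii) *)
    (H : R -> B -> ('I_n -> B) -> Bpar -> B)
    (hHcont : forall p : R * B * ('I_n -> B) * Bpar,
       continuous (fun q : R * B * ('I_n -> B) * Bpar =>
         H q.1.1.1 q.1.1.2 q.1.2 q.2) p)
    (hHlip : forall t b0 b0' (b b' : 'I_n -> B) alpha,
       norm (minus (H t b0 b alpha) (H t b0' b' alpha))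
       <= LH * (norm (minus b0 b0')
                + \sumR_(j < n) norm (minus (b j) (b' j)))
          * (1 + LH' * \sumR_(j < n) norm (b j)))
    (hHpar : forall t b0 (b : 'I_n -> B) alpha alpha',
       norm (minus (H t b0 b alpha) (H t b0 b alpha'))
       <= LHpar * norm (minus alpha alpha')
          * (1 + \sumR_(j < n) norm (b j)))
    (hHgrowth : forall t b0 (b : 'I_n -> B) alpha,
       norm (H t b0 b alpha) <= LH * \sumR_(j < n) norm (b j))
    (* (iv) R01 t is e^{At} as a map from B to B1 *)
    (R01 : R -> B -> B1)
    (hR01 : forall t, 0 < t -> forall x, i1 (R01 t x) = S t x)
    (hR01n : forall t, 0 < t <= 1 ->
       Rbar_le (op_norm (R01 t)) (kappa * Rpower t (- omega)))
    (a : R),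
  (forall (Y : B1) (alpha : Bpar), exists b : R -> B1,
     mild_solution i1 beta S1 R01 D H a Y alpha b /\
     forall b', mild_solution i1 beta S1 R01 D H a Y alpha b' ->
       forall t, a <= t -> b' t = b t) /\
  (forall (rho : R) (Y Y' : B1) (alpha alpha' : Bpar) (b b' : R -> B1),
     LH' * norm Y <= rho ->
     mild_solution i1 beta S1 R01 D H a Y alpha b ->
     mild_solution i1 beta S1 R01 D H a Y' alpha' b' ->
     forall T, a < T -> forall t, a <= t <= T ->
       norm (minus (b t) (b' t))
       <= K (T - a) rho * (norm (minus alpha alpha') * (1 + norm Y)
                           + norm (minus Y Y'))).
Proof.
have hC0 : 0 <= kappa * (1 + M1) by apply: Rmult_le_pos; lra.
have hmu : 0 <= m1 + 1 by lra.
have hn : 0 <= INR n by exact: pos_INR.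
have hL : 0 <= Rabs LH * INR n by apply: Rmult_le_pos => //; exact: Rabs_pos.
have hL1 : 0 <= Rabs LH * (1 + INR n) by apply: Rmult_le_pos; [exact: Rabs_pos|lra].
have hL2 : 0 <= Rmax 0 LH' * INR n by apply: Rmult_le_pos => //; exact: Rmax_l.
have hL3 : 0 <= Rabs LHpar by exact: Rabs_pos.
(* [K] is a total function, so lengths [d <= 0] are given the dummy value 1. *)
have hd0 d : 0 < (if Rlt_dec 0 d then d else 1) by case: Rlt_dec => h /=; lra.
(* The abstract [L2] is [Rmax 0 LH' * INR n], hence the factor [INR n]; [Rmax 0] covers negative
   [LH'], for which [rho] may be negative. *)
have hrho rho : 0 <= INR n * Rmax 0 rho by apply: Rmult_le_pos => //; exact: Rmax_l.
have hk d rho := mild_equation_lipschitz hbeta hM1 hm1 hC0 hmu homega hL hL1 hL2 hL3 hn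
  (hd0 d) (hrho rho).
(* Choice turns the constant found for each pair [d], [rho] into a function, still before any space
   is introduced. *)
pose K d rho := proj1_sig (constructive_indefinite_description _ (hk d rho)).
have hK d rho := proj2_sig (constructive_indefinite_description _ (hk d rho)).
exists K => B2 B1 B Bpar i2 i1 hi2 hi1 D D2 hD hD2 hDD2 hDn hD2n A hA S S1 hS hS1 hSS1
  hgen hinv hSn hS1n H hHcont hHlip hHpar hHgrowth R01 hR01 hR01n a.
have hss := smoothing_semigroupI hM1 hm1 hkappa homega hi1 hS hS1 hSS1 hS1n hR01 hR01n.
have nD j x : norm (D j x) <= norm x.
  rewrite -(Rmult_1_l (norm x)); apply: op_norm_bound (hDn j) x.
  exact: (linear_scal _ (hD j)).
have hF := nonlinearityI (emb_linear hi1) (emb_norm hi1) hD nD hHcont hHlip hHpar hHgrowth.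
have lip (rho : R) (Y Y' : B1) (alpha alpha' : Bpar) (b b' : R -> B1) :
    LH' * norm Y <= rho ->
    mild_solution i1 beta S1 R01 D H a Y alpha b ->
    mild_solution i1 beta S1 R01 D H a Y' alpha' b' ->
    forall T, a < T -> forall t, a <= t <= T ->
    norm (minus (b t) (b' t))
    <= K (T - a) rho * (norm (minus alpha alpha') * (1 + norm Y) + norm (minus Y Y')).
  move=> hr hb hb' T hT t ht.
  have [cx hx] := mild_solutionE hbeta hC0 hmu homega hss (@nl_cont _ _ _ _ _ _ _ _ _ hF alpha) hb.
  have [cx' hx'] := mild_solutionE hbeta hC0 hmu homega hss (@nl_cont _ _ _ _ _ _ _ _ _ hF alpha') hb'.
  have hY : Rmax 0 LH' * INR n * norm Y <= INR n * Rmax 0 rho.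
    rewrite (Rmult_comm _ (INR n)) Rmult_assoc; apply: Rmult_le_compat_l => //.
    have hnY := norm_ge_0 Y.
    rewrite /Rmax; do 2 case: Rle_dec => ?; nra.
  have := hK (T - a) rho _ _ _ _ _ _ a _ _ _ _ _ _ hss hF cx cx' hx hx' hY t.
  rewrite !Rmax_right; try lra; apply.
  case: Rlt_dec => h /=; lra.
split=> // Y alpha.
have [x [cx hx]] := mild_equation_solution hbeta hM1 hm1 hC0 hmu homega a Y alpha hss hF hL hL1 hL2.
exists x.
have sx : mild_solution i1 beta S1 R01 D H a Y alpha x.
  exact: (mild_solutionI hbeta hC0 hmu homega hss (@nl_cont _ _ _ _ _ _ _ _ _ hF alpha)).
split=> // b' hb' t ht.
(* Uniqueness is the Lipschitz estimate with equal data; the horizon [t + 1] is beyond [a] even when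
   [t = a]. *)
have := lip (LH' * norm Y) Y Y alpha alpha b' x (Rle_refl _) hb' sx (t + 1) ltac:(lra) t ltac:(lra).
rewrite !minus_eq_zero !norm_zero Rmult_0_l Rplus_0_r Rmult_0_r => h.
have : minus (b' t) (x t) = zero.
  by apply: norm_eq_zero; have := norm_ge_0 (minus (b' t) (x t)); lra.
move=> e; have := f_equal (fun z => plus z (x t)) e.
by rewrite /minus -plus_assoc plus_opp_l plus_zero_r plus_zero_l.
Qed.
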